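(* Let $V\in L^\infty(\mathbb{R}^+)$ be complex-valued with $V_I:=\operatorname{Im}V\ge0$ almost everywhere, and assume $V_I\not\equiv0$ (i.e. $V_I$ is not almost everywhere zero). For every $h\in\mathbb{R}\cup\{\infty\}$, the operator $A_{h,0}$ in $L^2(\mathbb{R}^+)$ given by $$\mathcal{D}(A_{h,0})=\{f\in H^2(\mathbb{R}^+): f'(0)=hf(0)\},\qquad (A_{h,0}f)(x)=-f''(x)+V(x)f(x),$$ where for $h=\infty$ the boundary condition is interpreted as the Dirichlet condition $f(0)=0$, is completely non-selfadjoint.
   Context: $\mathbb{R}^+=(0,\infty)$, $H^2(\mathbb{R}^+)$ is the usual Sobolev space; the inner product is linear in the second component. A densely defined linear operator $A$ is dissipative if $\operatorname{Im}\langle u,Au\rangle\ge0$ for all $u\in\mathcal{D}(A)$, and maximally dissipative if moreover it has no non-trivial dissipative extension. The operators $A_{h,0}$ are maximally dissipative (known). A closed subspace $\mathcal{M}$ of a Hilbert space $\mathcal{H}$ is a reducing subspace of $A$ if $\mathcal{D}(A)=\mathcal{D}(A)\cap\mathcal{M}+\mathcal{D}(A)\cap\mathcal{M}^\perp$, $A(\mathcal{D}(A)\cap\mathcal{M})\subset\mathcal{M}$ and $A(\mathcal{D}(A)\cap\mathcal{M}^\perp)\subset\mathcal{M}^\perp$. A maximally dissipative operator $A$ is completely non-selfadjoint if there is no non-trivial (i.e. $\neq\{0\}$) reducing subspace $\mathcal{H}_1\subseteq\mathcal{H}$ such that the restriction of $A$ to $\mathcal{D}(A)\cap\mathcal{H}_1$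 is selfadjoint in $\mathcal{H}_1$. *)

(* Defs.v *)
From HB Require Import structures.
From mathcomp Require Import all_boot all_order all_algebra complex.
From mathcomp Require Import all_classical all_reals all_analysis.
From mathcomp Require Import measurable_realfun ess_sup_inf.

Set Implicit Arguments.
Unset Strict Implicit.
Unset Printing Implicit Defensive.
Import Order.TTheory GRing.Theory Num.Theory.
Import numFieldNormedType.Exports.

Local Open Scope classical_set_scope.
Local Open Scope ring_scope.
Local Open Scope complex_scope.
Local Open Scope quotient_scope.

(* Without these, [Re] and [Im] are the endomorphisms of a numClosedFieldType;
   the projections R[i] -> R are needed here. *)
Local Notation Re := complex.Re.
Local Notation Im := complex.Im.

Section complex_Lfun.
Context d (T : measurableType d) (R : realType).
Variables (mu : {measure set T -> \bar R}) (p : \bar R).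

(* Complex-valued L^p functions; [Lfun] only covers real-valued ones. *)
Definition cLfun : {pred T -> R[i]} :=
  [pred f : T -> R[i] |
    ((fun x => Re (f x)) \in Lfun mu p) && ((fun x => Im (f x)) \in Lfun mu p)].

Hypothesis p1 : (1 <= p)%E.

Lemma cLfun_submod_closed : submod_closed cLfun.
Proof.
have [L0 LD] := Lfun_submod_closed mu p1.
have D (u v : T -> R) b c : u \in Lfun mu p -> v \in Lfun mu p ->
    (fun x => b * u x + c * v x) \in Lfun mu p.
  move=> uL vL.
  have -> : (fun x => b * u x + c * v x) = b *: u + (c *: v + 0) by rewrite addr0.
  by apply: (LD) => //; apply: LD.
have A (u v : T -> R) : u \in Lfun mu p -> v \in Lfun mu p ->
    (fun x => u x + v x) \in Lfun mu p.
  move=> uL vL; have := D u v 1 1 uL vL.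
  by under eq_fun do rewrite !mul1r.
split=> [|a f g /andP[fr fi] /andP[gr gi]]; rewrite inE; apply/andP => //.
have reE : (fun x => Re ((a *: f + g) x)) =
    (fun x => (Re a * Re (f x) + - Im a * Im (f x)) + Re (g x)).
  apply/funext => x; rewrite !fctE.
  by case: a => ? ?; case: (f x) => ? ?; case: (g x) => ? ?; rewrite /= mulNr.
have imE : (fun x => Im ((a *: f + g) x)) =
    (fun x => (Re a * Im (f x) + Im a * Re (f x)) + Im (g x)).
  apply/funext => x; rewrite !fctE.
  by case: a {reE} => ? ?; case: (f x) => ? ?; case: (g x).
by split; [rewrite reE|rewrite imE]; apply: A => //; exact: D.
Qed.

End complex_Lfun.

Section complex_L2.
Context d (T : measurableType d) (R : realType).
Variable mu : {measure set T -> \bar R}.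

HB.instance Definition _ := GRing.isSubmodClosed.Build R[i] (T -> R[i])
  (cLfun mu 2%:E) (cLfun_submod_closed mu (lee1n 2)).

Definition cL2fun := {f : T -> R[i] | f \in cLfun mu 2%:E}.
HB.instance Definition _ := SubType.on cL2fun.
HB.instance Definition _ := [Choice of cL2fun by <:].
HB.instance Definition _ := [SubChoice_isSubLmodule of cL2fun by <:].

Lemma cL2fun_valP a (f g : cL2fun) x :
  val (a *: f + g) x = a * val f x + val g x.
Proof.
have -> : val (a *: f + g) = a *: (val f : T -> R[i]) + val g by exact: linearP.
by [].
Qed.

Definition ae_null : {pred cL2fun} :=
  [pred f : cL2fun | `[< {ae mu, forall x, val f x = 0} >]].

Lemma ae_null_submod_closed : submod_closed ae_null.
Proof.
split=> [|a f g /asboolP f0 /asboolP g0]; apply/asboolP; first exact: nearW.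
apply: filterS2 f0 g0 => x fx gx.
by rewrite cL2fun_valP fx gx mulr0 addr0.
Qed.

HB.instance Definition _ := GRing.isSubmodClosed.Build R[i] cL2fun
  ae_null ae_null_submod_closed.

Definition cL2 := Quotient.quot ae_null.
HB.instance Definition _ := Choice.on cL2.
HB.instance Definition _ := GRing.Zmodule.on cL2.

Lemma cL2P (f g : cL2fun) :
  \pi_cL2 f = \pi_cL2 g <-> {ae mu, forall x, val f x = val g x}.
Proof.
split=> [/eqP|fg].
  rewrite -Quotient.idealrBE => /asboolP; apply: filterS => x.
  rewrite addrC -scaleN1r cL2fun_valP mulN1r addrC.
  by move=> /eqP; rewrite subr_eq0 => /eqP.
apply/eqP; rewrite -Quotient.idealrBE; apply/asboolP.
apply: filterS fg => x fgx.
by rewrite addrC -scaleN1r cL2fun_valP mulN1r addrC fgx subrr.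
Qed.

Lemma cL2_reprK (f : cL2fun) :
  {ae mu, forall x, val (repr (\pi_cL2 f)) x = val f x}.
Proof. by apply/cL2P; rewrite reprK. Qed.

Definition cL2_scale (a : R[i]) (u : cL2) : cL2 := \pi_cL2 (a *: repr u).

Lemma cL2_scale_pi a f : cL2_scale a (\pi_cL2 f) = \pi_cL2 (a *: f).
Proof.
apply/cL2P; have := cL2_reprK f; apply: filterS => x fx.
by rewrite -[a *: repr _]addr0 -[a *: f]addr0 !cL2fun_valP fx.
Qed.

Let piD f g : \pi_cL2 f + \pi_cL2 g = \pi_cL2 (f + g).
Proof. by rewrite [RHS]raddfD. Qed.

Lemma cL2_scaleA a b u : cL2_scale a (cL2_scale b u) = cL2_scale (a * b) u.
Proof. by rewrite -[u]reprK (cL2_scale_pi b) !cL2_scale_pi scalerA. Qed.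

Lemma cL2_scale1 : left_id 1 cL2_scale.
Proof. by move=> u; rewrite -[u]reprK cL2_scale_pi scale1r. Qed.

Lemma cL2_scaleDr : right_distributive cL2_scale +%R.
Proof.
move=> a u v; rewrite -[u]reprK -[v]reprK.
by rewrite piD !cL2_scale_pi piD scalerDr.
Qed.

Lemma cL2_scaleDl u : {morph cL2_scale^~ u : a b / a + b}.
Proof. by move=> a b; rewrite -[u]reprK !cL2_scale_pi piD scalerDl. Qed.

HB.instance Definition _ := GRing.Zmodule_isLmodule.Build R[i] cL2
  cL2_scaleA cL2_scale1 cL2_scaleDr cL2_scaleDl.

(* An arbitrary representative, determined up to a null set. *)
Definition cL2_fun (u : cL2) : T -> R[i] := val (repr u).

(* The class of [f], with the junk value [0] when [f] is not square
   integrable. *)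
Definition to_cL2 (f : T -> R[i]) : cL2 := \pi_cL2 (insubd (0 : cL2fun) f).

Definition cintegral (f : T -> R[i]) : R[i] :=
  (\int[mu]_x Re (f x)) +i* (\int[mu]_x Im (f x)).

Definition cL2_inner (u v : cL2) : R[i] :=
  cintegral (fun x => (cL2_fun u x)^* * cL2_fun v x).

End complex_L2.

Section complex_L2_theory.
Context d (T : measurableType d) (R : realType).
Variable mu : {measure set T -> \bar R}.

Lemma measurable_Lfun p (f : T -> R) : f \in Lfun mu p -> measurable_fun setT f.
Proof. by rewrite inE => /andP[/[!inE]/= mf _]. Qed.

Lemma eq_ae_cintegral (f g : T -> R[i]) :
  measurable_fun setT (fun x => Re (f x)) ->
  measurable_fun setT (fun x => Im (f x)) ->
  measurable_fun setT (fun x => Re (g x)) ->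
  measurable_fun setT (fun x => Im (g x)) ->
  {ae mu, forall x, f x = g x} -> cintegral mu f = cintegral mu g.
Proof.
move=> mrf mif mrg mig fg; rewrite /cintegral /Rintegral.
congr (fine _ +i* fine _).
  apply: ae_eq_integral => //; [exact/measurable_EFinP|exact/measurable_EFinP|].
  by apply: filterS fg => x /= ->.
apply: ae_eq_integral => //; [exact/measurable_EFinP|exact/measurable_EFinP|].
by apply: filterS fg => x /= ->.
Qed.

Lemma cL2_innerE (f g : cL2fun mu) :
  cL2_inner (\pi_(cL2 mu) f) (\pi_(cL2 mu) g) =
  cintegral mu (fun x => (val f x)^* * val g x).
Proof.
have M (h k : cL2fun mu) :
    measurable_fun setT (fun x => Re ((val h x)^* * val k x)) /\
    measurable_fun setT (fun x => Im ((val h x)^* * val k x)).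
  have /andP[/measurable_Lfun rh /measurable_Lfun ih] := valP h.
  have /andP[/measurable_Lfun rk /measurable_Lfun ik] := valP k.
  split.
    rewrite (_ : (fun _ => _) = fun x => Re (val h x) * Re (val k x) + Im (val h x) * Im (val k x)).
      by apply: measurable_funD; apply: measurable_funM.
    by apply/funext => x; case: (val h x) => ? ?; case: (val k x) => ? ?;
       rewrite /= mulNr opprK.
  rewrite (_ : (fun _ => _) = fun x => Re (val h x) * Im (val k x) - Im (val h x) * Re (val k x)).
    by apply: measurable_funB; apply: measurable_funM.
  by apply/funext => x; case: (val h x) => ? ?; case: (val k x) => ? ?;
     rewrite /= mulNr.
apply: eq_ae_cintegral; try exact: (M _ _).1; try exact: (M _ _).2.
by apply: filterS2 (cL2_reprK f) (cL2_reprK g) => x fx gx; rewrite /cL2_fun fx gx.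
Qed.

Lemma Lfun_infty_mul2 (u v : T -> R) :
  u \in Lfun mu +oo%E -> v \in Lfun mu 2%:E ->
  (fun x => u x * v x) \in Lfun mu 2%:E.
Proof.
move=> uL vL; have mu_ := measurable_Lfun uL; have mv := measurable_Lfun vL.
have [M M0 uM] : exists2 M : R, 0 <= M & {ae mu, forall x, `|u x| <= M}.
  move: uL; rewrite inE => /andP[_]; rewrite inE/= /finite_norm unlock /Lnorm.
  case: ifPn => [T0 ufin|T0 _].
    have supge0 : (0 <= ess_sup mu (abse \o (EFin \o u)))%E.
      by apply: ess_sup_gee => //; apply: nearW => x /=.
    exists (fine (ess_sup mu (abse \o (EFin \o u)))); first exact: fine_ge0.
    have := ess_sup_ge mu (abse \o (EFin \o u)); apply: filterS => x /=.
    by move=> ux; rewrite -lee_fin fineK// ge0_fin_numE.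
  exists 0 => //; exists setT; split => //.
  by apply/eqP; rewrite eq_le measure_ge0 andbT leNgt.
rewrite inE; apply/andP; split.
  by rewrite inE /=; exact: measurable_funM.
have := Lfun_scale M (ler1n R 2) vL.
rewrite !inE /= => /andP[_]; rewrite !inE /= /finite_norm; apply: le_lt_trans.
rewrite unlock gt0_ler_poweR// ?in_itv/= ?leey ?integral_ge0//.
have mp (w : T -> R) : measurable_fun setT w ->
    measurable_fun setT (fun x => (`|w x| `^ 2)%:E).
  move=> mw; apply/measurable_EFinP.
  apply: (@measurableT_comp _ _ _ _ _ _ (fun x : R => x `^ 2)) => //.
  exact: measurableT_comp.
apply: ae_ge0_le_integral => //.
- by apply: mp; exact: measurable_funM.
- by apply: mp; exact: measurable_funM.
- apply: filterS uM => x uxM _; rewrite lee_fin ge0_ler_powR ?nnegrE//.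
  by rewrite !normrM (ger0_norm M0) mulrC ler_wpM2l.
Qed.

Lemma cLfun_mul2 (V f : T -> R[i]) :
  V \in cLfun mu +oo%E -> f \in cLfun mu 2%:E ->
  (fun x => V x * f x) \in cLfun mu 2%:E.
Proof.
move=> /andP[Vr Vi] /andP[fr fi].
have [_ LD] := Lfun_submod_closed mu (lee1n 2).
have L (u v : T -> R) c : u \in Lfun mu 2%:E -> v \in Lfun mu 2%:E ->
    c *: u + v \in Lfun mu 2%:E by exact: LD.
have reE : (fun x => Re (V x * f x)) =
    -1 *: (fun x => Im (V x) * Im (f x)) + (fun x => Re (V x) * Re (f x)).
  apply/funext => x; rewrite !fctE.
  by case: (V x) => ? ?; case: (f x) => ? ?; rewrite /= scaleN1r addrC.
have imE : (fun x => Im (V x * f x)) =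
    1 *: (fun x => Im (V x) * Re (f x)) + (fun x => Re (V x) * Im (f x)).
  apply/funext => x; rewrite !fctE.
  by case: (V x) => ? ?; case: (f x) => ? ?; rewrite /= scale1r addrC.
rewrite inE; apply/andP.
by split; [rewrite reE|rewrite imE]; apply: L; exact: Lfun_infty_mul2.
Qed.

Lemma to_cL2K (f : T -> R[i]) : f \in cLfun mu 2%:E ->
  {ae mu, forall x, cL2_fun (to_cL2 mu f) x = f x}.
Proof.
move=> fL; have := cL2_reprK (insubd (0 : cL2fun mu) f).
by rewrite (insubdK _ fL).
Qed.

End complex_L2_theory.

Section unbounded_operators.
Context (R : realType) (H : lmodType R[i]) (inner : H -> H -> R[i]).

Definition hnorm (u : H) : R := Num.sqrt (Re (inner u u)).

Definition closed_subspace (M : set H) : Prop :=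
  [/\ M 0,
      forall (a : R[i]) (u v : H), M u -> M v -> M (a *: u + v) &
      forall u : H,
        (forall e : R, 0 < e -> exists2 v, M v & hnorm (u - v) < e) -> M u].

Definition orthocomplement (M : set H) : set H :=
  [set v | forall u, M u -> inner u v = 0].

(* The values of [op_fun] outside [op_dom] are irrelevant. *)
Record operator := Operator { op_dom : set H; op_fun :> H -> H }.

Definition restriction (A : operator) (M : set H) : operator :=
  Operator (op_dom A `&` M) A.

Definition reducing_subspace (A : operator) (M : set H) : Prop :=
  let N := orthocomplement M in
  [/\ closed_subspace M,
      op_dom A = [set u + v | u in op_dom A `&` M & v in op_dom A `&` N],
      A @` (op_dom A `&` M) `<=` M &
      A @` (op_dom A `&` N) `<=` N].

(* [v] is in the domain of the adjoint of [B], taken in the Hilbert space [M],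
   and is mapped to [w] by that adjoint. *)
Definition adjoint_graph_in (M : set H) (B : operator) (v w : H) : Prop :=
  [/\ M v, M w & forall u, op_dom B u -> inner v (B u) = inner w u].

Definition densely_defined_in (M : set H) (B : operator) : Prop :=
  forall u : H, M u -> forall e : R, 0 < e ->
    exists2 v, op_dom B v & hnorm (u - v) < e.

Definition selfadjoint_in (M : set H) (B : operator) : Prop :=
  [/\ op_dom B `<=` M,
      B @` op_dom B `<=` M,
      densely_defined_in M B &
      forall v w, adjoint_graph_in M B v w <-> (op_dom B v /\ B v = w)].

Definition completely_nonselfadjoint (A : operator) : Prop :=
  ~ exists M : set H,
    [/\ reducing_subspace A M, M <> [set 0] &
        selfadjoint_in M (restriction A M)].

End unbounded_operators.

Section schroedinger_half_line.
Context (R : realType).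

(* Functions on ]0, +oo[ are represented by functions on R, considered up to
   null sets of this measure: their values on ]-oo, 0] play no role. *)
Definition mu_half_line : {measure set (measurableTypeR R) -> \bar R} :=
  mrestr (@lebesgue_measure R) (measurable_itv `]0, +oo[).

Local Notation L2 := (cL2 mu_half_line).

(* Real-valued test functions suffice: complex ones give the same weak
   derivatives by linearity. *)
Definition test_function (phi : R -> R) : Prop :=
  (forall n x, derivable (phi^`(n))%classic x 1) /\
  exists a b : R, 0 < a /\ forall x, phi x != 0 -> a <= x <= b.

Definition is_weak_derivative (u v : L2) : Prop :=
  forall phi : R -> R, test_function phi ->
    cintegral mu_half_line (fun x => cL2_fun u x * ((phi^`())%classic x)%:C) =
    - cintegral mu_half_line (fun x => cL2_fun v x * (phi x)%:C).

(* The weak derivative of [u], which is unique, with the junk value [0] if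
   [u] has none in L2. *)
Definition weak_derivative (u : L2) : L2 := xget 0 (is_weak_derivative u).

Definition sobolev_H2 : set L2 :=
  [set u | exists v w, is_weak_derivative u v /\ is_weak_derivative v w].

(* The value at 0 of the representative of [u] that is continuous on
   [0, +oo[. *)
Definition boundary_value (u : L2) (c : R[i]) : Prop :=
  exists F : R -> R[i]^o,
    [/\ {within `[0, +oo[, continuous F},
        {ae mu_half_line, forall x, cL2_fun u x = F x} & F 0 = c].

(* [Some h] stands for the real number [h], and [None] for [h = oo]. *)
Definition boundary_condition (h : option R) (u : L2) : Prop :=
  match h with
  | Some r => exists2 c, boundary_value u c &
                boundary_value (weak_derivative u) (r%:C * c)
  | None => boundary_value u 0
  end.

Definition schroedinger (V : R -> R[i]) (h : option R) : operator L2 :=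
  Operator [set u : L2 | sobolev_H2 u /\ boundary_condition h u]
    (fun u => - weak_derivative (weak_derivative u) +
      to_cL2 mu_half_line (fun x => V x * cL2_fun u x)).

End schroedinger_half_line.

(* Main.v *)
(* Suppose that M reduces A = A_{h,0} to a selfadjoint operator B. For u in
   D(B), Im <u, A u> = 0; as the boundary terms vanish, this says that the
   integral of V_I |u|^2 is 0, so u vanishes a.e. on {V_I <> 0}. At a density
   point x0 of that set, u(x0) = u'(x0) = 0 by Rolle's theorem, for all u in D(B).

   For u in D(B), n > 0 and tau > 0, put v_0 = (1 + i (tau / n) B)^(-n) u and
   v_{j+1} = B v_j. Then |v_0 - u| <= tau |B u| and |v_j| <= (n / tau)^j |u| for
   j <= n. Since v_j'' = V v_j - v_{j+1} and v_j has zero Cauchy data at x0,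
   integrating twice in the weight exp (n |x - x0|) gains a factor n^(-2) at each
   step of the chain, whereas the norms only lose n / tau. Hence, on bounded
   intervals, v_0 is O(n (C / (tau n))^(n - 1) exp (n |x - x0|)), which tends to 0
   as n grows, so that |u| <= tau |B u| for every tau > 0, and u = 0. *)
Require Import Defs.
From mathcomp Require Import all_boot all_order all_algebra complex.
From mathcomp Require Import all_classical all_reals all_analysis.
From mathcomp Require Import measurable_realfun ess_sup_inf.
From mathcomp Require Import ring lra.

Set Implicit Arguments.
Unset Strict Implicit.
Unset Printing Implicit Defensive.
Import Order.TTheory GRing.Theory Num.Theory.
Import numFieldNormedType.Exports.

Local Open Scope classical_set_scope.
Local Open Scope ring_scope.
Local Open Scope complex_scope.

Local Notation Re := complex.Re.
Local Notation Im := complex.Im.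

(** * Resolvents of selfadjoint operators *)

(** The obstacle is that an element u of D(B) solves no closed differential equation: u'' = V u - B
    u, where B u is merely another element of M, so zero Cauchy data at x0 do not yield u = 0 by
    uniqueness for the Cauchy problem. The information comes from long chains of powers of B, all of
    whose terms in D(B) have zero Cauchy data at the same x0; V is never differentiated, so a
    bounded V is enough. As u need not lie in the domain of B^n, powers of the resolvent replace it
    by a nearby vector that does, with explicit bounds and without a spectral theorem.

    The point x0 has to serve all of D(B) at once, although each u vanishes on {V_I <> 0} only
    outside a null set of its own. It is therefore chosen from that set alone.

    The weight exp (n |x - x0|) stands in for the Taylor factors |x - x0|^(2k) / (2k)!. Integration
    away from x0 reproduces it up to the factor 1 / n, and on a bounded interval it costs only exp
    (n X), which is geometric in n and is absorbed by the remaining n^(-n). *)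

Section hilbert.
Context (R : realType) (H : lmodType R[i]).

Record inner_product (inner : H -> H -> R[i]) : Prop := InnerProduct {
  innerDr : forall u v w, inner u (v + w) = inner u v + inner u w;
  innerZr : forall a u v, inner u (a *: v) = a * inner u v;
  innerC : forall u v, inner v u = (inner u v)^*;
  inner_ge0 : forall u, 0 <= Re (inner u u);
  inner_eq0 : forall u, Re (inner u u) = 0 -> u = 0 }.

(** Squared distances are used because in L2 they are the sum of those of the real and imaginary
    parts. *)
Definition complete_for (inner : H -> H -> R[i]) : Prop :=
  forall g : nat -> H,
  (forall e : R, 0 < e -> exists N, forall m n, (N <= m)%N -> (N <= n)%N ->
     Re (inner (g m - g n) (g m - g n)) < e) ->
  exists l, forall e : R, 0 < e -> exists N, forall n, (N <= n)%N ->
     Re (inner (g n - l) (g n - l)) < e.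

Variables (inner : H -> H -> R[i]).
Hypothesis ip : inner_product inner.

Local Notation nsq u := (Re (inner u u)).
Local Notation rin u v := (Re (inner u v)).
Local Notation hn := (hnorm inner).

Lemma innerDl u v w : inner (u + v) w = inner u w + inner v w.
Proof. by rewrite (innerC ip) (innerDr ip) rmorphD/= -!(innerC ip). Qed.

Lemma innerZl a u v : inner (a *: u) v = a^* * inner u v.
Proof. by rewrite (innerC ip) (innerZr ip) rmorphM/= -(innerC ip). Qed.

Lemma innerNr u v : inner u (- v) = - inner u v.
Proof. by rewrite -scaleN1r (innerZr ip) mulN1r. Qed.

Lemma innerNl u v : inner (- u) v = - inner u v.
Proof. by rewrite -scaleN1r innerZl rmorphN rmorph1 mulN1r. Qed.

Lemma inner0l u : inner 0 u = 0.
Proof. by rewrite -(scale0r (0 : H)) innerZl rmorph0 mul0r. Qed.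

Lemma rinC u v : rin u v = rin v u.
Proof. by rewrite (innerC ip v u); case: (inner v u). Qed.

Lemma nsqD u v : nsq (u + v) = nsq u + nsq v + 2 * rin u v.
Proof.
by rewrite innerDl !(innerDr ip) !raddfD/= (rinC v u); ring.
Qed.

Lemma nsqN u : nsq (- u) = nsq u.
Proof. by rewrite innerNl innerNr opprK. Qed.

Lemma nsqB u v : nsq (u - v) = nsq u + nsq v - 2 * rin u v.
Proof. by rewrite nsqD nsqN innerNr raddfN/=; ring. Qed.

Lemma Im_nsq u : Im (inner u u) = 0.
Proof.
have := congr1 (@complex.Im R) (innerC ip u u); case: (inner u u) => a b /= h; lra.
Qed.

Lemma nsqZ a u : nsq (a *: u) = (Re a ^+ 2 + Im a ^+ 2) * nsq u.
Proof.
rewrite innerZl (innerZr ip); have := Im_nsq u.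
by case: a => x y; case: (inner u u) => p q /= ->; ring.
Qed.

Lemma nsqZr (t : R) u : nsq (t%:C *: u) = t ^+ 2 * nsq u.
Proof. by rewrite nsqZ/= expr0n/= addr0. Qed.

Lemma rinZr (t : R) u v : rin u (t%:C *: v) = t * rin u v.
Proof. by rewrite (innerZr ip); case: (inner u v) => a b /=; ring. Qed.

(** Besides the Cauchy-Schwarz inequality, this serves in [resolvent_surj], where [a] is the small
    error of a near-minimiser. *)
Lemma quadratic_discriminant (a b c : R) : 0 <= c ->
  (forall t, 0 <= a + 2 * t * b + t ^+ 2 * c) -> b ^+ 2 <= a * c.
Proof.
move=> c0 h; have [ceq|cn0] := eqVneq c 0.
  rewrite ceq mulr0; have [->|bn0] := eqVneq b 0; first by rewrite expr0n.
  (* For c = 0 the polynomial is affine, and it takes the value -1 at this point. *)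
  have := h (- (a + 1) / (2 * b)); rewrite ceq mulr0 addr0.
  have -> : a + 2 * (- (a + 1) / (2 * b)) * b = -1 by field.
  by rewrite ler0N1.
have cp : 0 < c by rewrite lt_neqAle eq_sym cn0.
have := h (- b / c).
have -> : a + 2 * (- b / c) * b + (- b / c) ^+ 2 * c = (a * c - b ^+ 2) / c.
  by field.
by rewrite pmulr_lge0 ?invr_gt0// subr_ge0.
Qed.

Lemma cauchy_schwarz_re u v : rin u v ^+ 2 <= nsq u * nsq v.
Proof.
apply: quadratic_discriminant => [|t]; first exact: inner_ge0.
have := inner_ge0 ip (u + t%:C *: v).
by rewrite nsqD nsqZr rinZr; lra.
Qed.

Lemma cauchy_schwarz_im u v : Im (inner u v) ^+ 2 <= nsq u * nsq v.
Proof.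
have := cauchy_schwarz_re u ((- 'i) *: v).
rewrite nsqZ (innerZr ip); case: (inner u v) => a b /=.
by rewrite !expr2; nra.
Qed.

Lemma hnorm_sqr u : hn u ^+ 2 = nsq u.
Proof. by rewrite sqr_sqrtr// inner_ge0. Qed.

Lemma hnorm_ge0 u : 0 <= hn u. Proof. exact: sqrtr_ge0. Qed.

Lemma hnorm_lt u (e : R) : 0 < e -> (hn u < e) = (nsq u < e ^+ 2).
Proof.
by move=> e0; rewrite -hnorm_sqr ltr_pXn2r// nnegrE ?hnorm_ge0// ltW.
Qed.

Lemma hnorm_le u (e : R) : 0 <= e -> (hn u <= e) = (nsq u <= e ^+ 2).
Proof. by move=> e0; rewrite -hnorm_sqr ler_pXn2r// nnegrE ?hnorm_ge0. Qed.

Lemma hnormD u v : hn (u + v) <= hn u + hn v.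
Proof.
rewrite hnorm_le ?addr_ge0 ?hnorm_ge0// nsqD sqrrD !hnorm_sqr.
suff : rin u v <= hn u * hn v by move=> h; rewrite mulr_natl; lra.
rewrite (le_trans (ler_norm _))// -(@ler_pXn2r _ 2)// ?nnegrE//.
  by rewrite real_normK ?num_real// exprMn !hnorm_sqr cauchy_schwarz_re.
by rewrite mulr_ge0 ?hnorm_ge0.
Qed.

Section selfadjoint.
Variables (M : set H) (B : operator H).
Hypotheses (compl : complete_for inner) (clM : closed_subspace inner M)
  (saB : selfadjoint_in inner M B).

Let D := op_dom B.

Let M0 : M 0. Proof. by case: clM. Qed.

Let ML (a : R[i]) u v : M u -> M v -> M (a *: u + v).
Proof. by case: clM => _ + _; exact. Qed.

Let MZ (a : R[i]) u : M u -> M (a *: u).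
Proof. by move=> Mu; rewrite -[_ *: _]addr0; exact: ML. Qed.

Let MB u v : M u -> M v -> M (u - v).
Proof. by move=> Mu Mv; rewrite addrC -scaleN1r; exact: ML. Qed.

Let MD u v : M u -> M v -> M (u + v).
Proof. by move=> Mu Mv; rewrite -[u]scale1r; exact: ML. Qed.

Let DM u : D u -> M u. Proof. by case: saB => + _ _ _; exact. Qed.

Let BM u : D u -> M (B u).
Proof. by move=> Du; case: saB => _ + _ _; apply; exists u. Qed.

Let BP v w : M v -> M w -> (forall u, D u -> inner v (B u) = inner w u) ->
  D v /\ B v = w.
Proof. by move=> Mv Mw vw; case: saB => _ _ _ /(_ v w) [+ _]; apply. Qed.

Lemma selfadjoint_sym u v : D u -> D v -> inner u (B v) = inner (B u) v.
Proof.
move=> Du Dv; case: saB => _ _ _ /(_ u (B u)) [_ /(_ (conj Du erefl))].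
by case=> _ _; apply.
Qed.

(** An [operator] carries no linearity. It is forced by B being its own adjoint: a B u + B v
    satisfies the identity that characterises the adjoint at a u + v. *)
Lemma selfadjoint_linear (a : R[i]) u v : D u -> D v ->
  D (a *: u + v) /\ B (a *: u + v) = a *: B u + B v.
Proof.
move=> Du Dv; apply: BP; [by apply: ML; exact: DM|by apply: ML; exact: BM|].
move=> w Dw; rewrite !innerDl !innerZl.
by rewrite !selfadjoint_sym.
Qed.

Lemma selfadjoint_B u v : D u -> D v -> D (u - v) /\ B (u - v) = B u - B v.
Proof.
move=> Du Dv; have := selfadjoint_linear (-1) Dv Du.
by rewrite !scaleN1r addrC [- B v + _]addrC.
Qed.

Lemma selfadjoint_Z (a : R[i]) u : D u -> D (a *: u) /\ B (a *: u) = a *: B u.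
Proof.
move=> Du; have [D0 B0] := selfadjoint_B Du Du; rewrite !subrr in D0 B0.
by have := selfadjoint_linear a Du D0; rewrite B0 !addr0.
Qed.

Lemma selfadjoint_im0 u : D u -> Im (inner u (B u)) = 0.
Proof.
move=> Du; have := selfadjoint_sym Du Du; rewrite (innerC ip u (B u)).
by case: (inner u (B u)) => a b [] /= h; lra.
Qed.

Section resolvent.
Variable s : R.
Hypothesis s0 : 0 < s.
Let c : R[i] := Complex 0 s.
Let S u := u + c *: B u.

Let c0 : c != 0.
Proof. by rewrite /c eq_complex/= negb_and (gt_eqF s0) orbT. Qed.

Let SL a u v : D u -> D v -> S (a *: u + v) = a *: S u + S v.
Proof.
move=> Du Dv; rewrite /S (selfadjoint_linear a Du Dv).2 !scalerDr !scalerA.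
by rewrite mulrC addrACA.
Qed.

Let SB u v : D u -> D v -> D (u - v) /\ S (u - v) = S u - S v.
Proof.
move=> Du Dv; have [Duv Buv] := selfadjoint_B Du Dv.
by rewrite /S Buv scalerBr opprD addrACA.
Qed.

(** The cross term is a multiple of Im <u, B u> = 0. Every bound on the resolvent is read off from
    this identity: injectivity, closed range, and the norms of (1 + c B)^(-1) and B (1 + c
    B)^(-1). *)
Lemma nsq_resolvent u : D u -> nsq (u + c *: B u) = nsq u + s ^+ 2 * nsq (B u).
Proof.
move=> Du; rewrite nsqD nsqZ (innerZr ip) /= expr0n add0r.
have := selfadjoint_im0 Du; case: (inner u (B u)) => a b /= ->.
by rewrite mul0r mulr0 subrr mulr0 addr0.
Qed.

(* The nearest point to [u] in the range of [S] exists because [S] is bounded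
   below and [B] is closed; the error is then an eigenvector of [B] for a
   nonreal eigenvalue. *)
Lemma resolvent_surj u : M u -> exists2 w, D w & w + c *: B w = u.
Proof.
move=> Mu.
pose E := [set nsq (u - S f) | f in D].
have D0 : D 0.
  by have [] := BP M0 M0 (fun w _ => etrans (inner0l _) (esym (inner0l _))).
have hiE : has_inf E.
  split; first by exists (nsq (u - S 0)), 0.
  by exists 0 => _ [f _ <-]; exact: inner_ge0.
pose d := inf E.
have dE f : D f -> d <= nsq (u - S f).
  by move=> Df; apply: ge_inf; [case: hiE|exists f].
have /choice[f fP] : forall n : nat, exists f, D f /\ nsq (u - S f) < d + n.+1%:R^-1.
  move=> n; have n0 : 0 < n.+1%:R^-1 :> R by rewrite invr_gt0.
  by have [_ [f Df <-] fd] := inf_adherent n0 hiE; exists f.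
have Df n : D (f n) := (fP n).1.
(* By the parallelogram identity: the squared distance from [u] to the midpoint of the two images is
   at least [d]. *)
have par (m n : nat) : nsq (S (f m) - S (f n)) <= 2 * m.+1%:R^-1 + 2 * n.+1%:R^-1.
  have Dmn : D (2^-1 *: f m + 2^-1 *: f n).
    have [+ _] := selfadjoint_linear 2^-1 (Df n) D0; rewrite addr0 => D2.
    by have [] := selfadjoint_linear 2^-1 (Df m) D2.
  have S2 : S (2^-1 *: f m + 2^-1 *: f n) = 2^-1 *: (S (f m) + S (f n)).
    have [D2 _] := selfadjoint_linear 2^-1 (Df n) D0.
    rewrite SL//; last by rewrite addr0 in D2.
    have := SL 2^-1 (Df n) D0; rewrite addr0 => ->.
    have [_ E0] := SB D0 D0; rewrite subrr in E0; rewrite E0 subrr addr0.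
    exact/esym/scalerDr.
  have := dE _ Dmn; rewrite S2.
  set p := u - S (f m); set q := u - S (f n).
  have -> : u - 2^-1 *: (S (f m) + S (f n)) = (2^-1)%:C *: (p + q).
    have -> : (2^-1)%:C = 2^-1 :> R[i] by rewrite fmorphV rmorph_nat.
    rewrite /p /q; move: (S (f m)) (S (f n)) => x y.
    rewrite addrACA -opprD scalerBr; congr (_ - _).
    by rewrite -[in RHS](scale1r u) -scalerDl -mulr2n scalerA mulVf ?scale1r// pnatr_eq0.
  have -> : S (f m) - S (f n) = q - p by rewrite /p /q opprB [RHS]addrC addrA subrK.
  have := (fP m).2; have := (fP n).2; rewrite -/p -/q.
  move: p q => p q; rewrite nsqZr nsqD nsqB (rinC q p).
  move: (nsq p) (nsq q) (rin p q) (_^-1) (_^-1) => np nq pq em en.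
  by rewrite expr2; lra.
have small (e : R) : 0 < e ->
    exists N, forall m n, (N <= m)%N -> (N <= n)%N -> nsq (S (f m) - S (f n)) < e.
  move=> e0; exists (Num.truncn (4 / e)) => m n Nm Nn.
  have bnd k : (Num.truncn (4 / e) <= k)%N -> k.+1%:R^-1 < e / 4.
    move=> Nk; rewrite invf_plt ?posrE ?divr_gt0// invf_div.
    apply: (lt_le_trans (truncnS_gt _)); rewrite ler_nat ltnS//.
  have := par m n; have := bnd m Nm; have := bnd n Nn.
  by move: (m.+1%:R^-1) (n.+1%:R^-1) => x y; lra.
have SBn m n := selfadjoint_B (Df m) (Df n).
have nS m n : nsq (S (f m) - S (f n)) =
    nsq (f m - f n) + s ^+ 2 * nsq (B (f m) - B (f n)).
  rewrite -(SB (Df m) (Df n)).2 [LHS]nsq_resolvent ?(SBn m n).2//.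
  exact: (SBn m n).1.
have s20 : 0 < s ^+ 2 by rewrite exprn_gt0.
have [g fg] : exists g, forall e : R, 0 < e -> exists N, forall n, (N <= n)%N -> nsq (f n - g) < e.
  apply: compl => e /small[N hN]; exists N => m n Nm Nn.
  apply: le_lt_trans (hN m n Nm Nn); rewrite nS lerDl mulr_ge0 ?(ltW s20)//.
  exact: inner_ge0.
have [k Bk] : exists k, forall e : R, 0 < e -> exists N, forall n, (N <= n)%N -> nsq (B (f n) - k) < e.
  apply: (compl (g := fun n => B (f n))) => e e0; have [N hN] := small _ (mulr_gt0 s20 e0).
  exists N => m n Nm Nn; have := hN m n Nm Nn; rewrite nS => h.
  rewrite -(ltr_pM2l s20); apply: le_lt_trans h; rewrite lerDr.
  exact: inner_ge0.
have clos (x : nat -> H) y : (forall n, M (x n)) ->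
    (forall e : R, 0 < e -> exists N, forall n, (N <= n)%N -> nsq (x n - y) < e) -> M y.
  move=> Mx xy; case: clM => _ _; apply => e e0.
  have [N hN] := xy _ (exprn_gt0 2 e0); exists (x N) => //.
  by rewrite hnorm_lt// -nsqN opprB hN.
have Mg : M g by apply: clos fg => n; exact: DM.
have Mk : M k by apply: clos Bk => n; exact: BM.
have zero (x y : R) : 0 <= y -> (forall e, 0 < e -> x ^+ 2 <= e * y) -> x = 0.
  move=> y0 h; apply/eqP; rewrite -sqrf_eq0 eq_le sqr_ge0 andbT.
  rewrite leNgt; apply/negP => x0.
  have y1 : 0 < y + 1 by rewrite ltr_wpDl.
  have := h (x ^+ 2 / (y + 1)) (divr_gt0 x0 y1).
  rewrite mulrAC ler_pdivlMr// mulrDr mulr1.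
  by move: (x ^+ 2) x0 => z z0; lra.
(* B is closed because it is an adjoint: <f n, B h> = <B (f n), h> passes to the limit, with errors
   controlled by the Cauchy-Schwarz inequality. *)
have [Dg Bg] : D g /\ B g = k.
  apply: BP => // h Dh.
  have key (e : R) : 0 < e -> Re (inner g (B h) - inner k h) ^+ 2 <= e * (2 * (nsq (B h) + nsq h)) /\
       Im (inner g (B h) - inner k h) ^+ 2 <= e * (2 * (nsq (B h) + nsq h)).
    move=> e0; have [N1 /(_ (maxn N1 _))h1] := fg e e0.
    have [N2 /(_ (maxn _ N2))h2] := Bk e e0.
    have {}h1 := h1 N2 (leq_maxl _ _); have {}h2 := h2 N1 (leq_maxr _ _).
    set n := maxn N1 N2 in h1 h2.
    have -> : inner g (B h) - inner k h =
       inner (B (f n) - k) h - inner (f n - g) (B h).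
      rewrite !innerDl !innerNl -(selfadjoint_sym (Df n) Dh).
      by move: (inner _ _) (inner _ _) (inner _ _) => a b b'; ring.
    have := cauchy_schwarz_re (B (f n) - k) h; have := cauchy_schwarz_re (f n - g) (B h).
    have := cauchy_schwarz_im (B (f n) - k) h; have := cauchy_schwarz_im (f n - g) (B h).
    have p1 := inner_ge0 ip h; have p2 := inner_ge0 ip (B h).
    have q1 : nsq (f n - g) * nsq (B h) <= e * nsq (B h) by rewrite ler_wpM2r// ltW.
    have q2 : nsq (B (f n) - k) * nsq h <= e * nsq h by rewrite ler_wpM2r// ltW.
    move: q1 q2.
    move: (_ * nsq (B h)) (_ * nsq h) => q1 q2.
    case: (inner (B (f n) - k) h) => a b; case: (inner (f n - g) (B h)) => a' b' /=.
    move=> hq1 hq2 z1 z2 z3 z4; have := sqr_ge0 (a + a'); have := sqr_ge0 (b + b').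
    by rewrite !sqrrB !sqrrD => ? ?; split; lra.
  have nn : 0 <= 2 * (nsq (B h) + nsq h).
    by rewrite mulr_ge0// addr_ge0// inner_ge0.
  have h1 := zero _ _ nn (fun e e0 => (key e e0).1).
  have h2 := zero _ _ nn (fun e e0 => (key e e0).2).
  move: h1 h2; case: (inner g (B h)) => a b; case: (inner k h) => a' b' /= h1 h2.
  by congr (_ +i* _); lra.
pose r := u - S g.
have rS0 h : D h -> rin r (S h) = 0.
  move=> Dh; apply: (zero _ (4 * nsq (S h))); first by rewrite mulr_ge0// inner_ge0.
  (* With this [e1], the squared distance from S (f n) to S g is below (1 + s^2) e1 = e / 2. *)
  move=> e e0; pose e1 := e / (2 * (1 + s ^+ 2)).
  have e10 : 0 < e1 by rewrite divr_gt0// mulr_gt0// addr_gt0.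
  have [N1 h1] := fg e1 e10; have [N2 h2] := Bk e1 e10.
  pose n := maxn (maxn N1 N2) (Num.truncn e^-1).
  have {}h1 : nsq (f n - g) < e1 by apply: h1; rewrite /n -maxnA leq_maxl.
  have {}h2 : nsq (B (f n) - k) < e1.
    by apply: h2; rewrite /n maxnAC leq_maxr.
  have h3 : n.+1%:R^-1 < e.
    rewrite invf_plt ?posrE//; apply: (lt_le_trans (truncnS_gt _)).
    by rewrite ler_nat ltnS leq_maxr.
  have nSg : nsq (S (f n) - S g) < e.
    rewrite -(SB (Df n) Dg).2 [ltLHS]nsq_resolvent; last exact: (SB (Df n) Dg).1.
    have -> : B (f n - g) = B (f n) - k.
      by rewrite (selfadjoint_B (Df n) Dg).2 Bg.
    have : s ^+ 2 * nsq (B (f n) - k) <= s ^+ 2 * e1 by rewrite ler_pM2l// ltW.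
    have -> : s ^+ 2 * e1 = e / 2 - e1.
      by rewrite /e1; field; rewrite gt_eqF// addr_gt0.
    by move: h1 e0; move: (nsq _) (_ * _) => x y; lra.
  (* Moving the near-minimiser [f n] in the direction [h] cannot bring the squared distance below
     [d], so e + 2 t b + t^2 |S h|^2 >= 0 for all t, where b is the inner product to be bounded. *)
  have b1 : rin (u - S (f n)) (S h) ^+ 2 <= e * nsq (S h).
    apply: quadratic_discriminant => [|t]; first exact: inner_ge0.
    have := dE _ (selfadjoint_linear (- t%:C) Dh (Df n)).1.
    rewrite SL// scaleNr opprD opprK addrCA addrC nsqD nsqZr rinZr.
    by move: (fP n).2 h3; move: (nsq _) (nsq _) (rin _ _) (_^-1) => x y z w; lra.
  have b2 : rin (S (f n) - S g) (S h) ^+ 2 <= e * nsq (S h).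
    apply: (le_trans (cauchy_schwarz_re _ _)); rewrite ler_wpM2r ?(ltW nSg)//.
    exact: inner_ge0.
  have -> : rin r (S h) = rin (u - S (f n)) (S h) + rin (S (f n) - S g) (S h).
    by rewrite -raddfD/= -innerDl addrA subrK.
  rewrite mulrCA; move: b1 b2; move: (e * _) => z.
  move: (rin (u - S (f n)) (S h)) (rin (S (f n) - S g) (S h)) => x y b1 b2.
  by have := sqr_ge0 (x - y); rewrite sqrrB sqrrD; lra.
have rS h : D h -> inner r (S h) = 0.
  move=> Dh; have [D' _] := selfadjoint_linear 'i Dh D0; rewrite addr0 in D'.
  have := rS0 _ Dh; have := rS0 _ D'.
  have S0 : S 0 = 0 by have := (SB D0 D0).2; rewrite !subrr.
  have := SL 'i Dh D0; rewrite S0 !addr0 => ->; rewrite (innerZr ip).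
  case: (inner r (S h)) => a b /= h1 h2.
  by apply/eqP; rewrite eq_complex/= h2; apply/andP; split=> //; apply/eqP; lra.
have Mr : M r by apply: MB => //; apply: MD; [exact: DM|apply: MZ; exact: BM].
have [Dr Br] : D r /\ B r = c^-1 *: r.
  apply: BP => //; first exact: MZ.
  move=> h Dh; have := rS h Dh; rewrite /S (innerDr ip) (innerZr ip) innerZl => h0.
  rewrite [X in _ = X * _](_ : _ = - c^-1); last first.
    by apply/eqP; rewrite eq_complex/= !mul0r oppr0 !eqxx.
  rewrite mulNr; apply: (mulfI c0).
  by rewrite mulrN mulrA mulfV// mul1r; apply/eqP; rewrite -addr_eq0 addrC h0.
(* Here S r = 2 r, so orthogonality of [r] to the range gives 2 |r|^2 = 0. *)
have r0 : r = 0.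
  apply: (inner_eq0 ip); have := rS r Dr.
  rewrite /S Br scalerA mulfV// scale1r (innerDr ip); case: (inner r r) => a b [] /= h _.
  by lra.
by exists g => //; apply/eqP; rewrite eq_sym -subr_eq0 -/(S g) -/r r0.
Qed.

End resolvent.

(* [v 0] is the [n]-th implicit Euler approximation of [exp (- i tau B) u]. *)
Lemma selfadjoint_chain u (tau : R) n : D u -> 0 < tau -> (0 < n)%N ->
  exists v : nat -> H, [/\
    forall j, (j < n)%N -> D (v j) /\ B (v j) = v j.+1,
    forall j, hn (v j) <= (n%:R / tau) ^+ j * hn u &
    hn (v 0 - u) <= tau * hn (B u)].
Proof.
move=> Du tau0 n0; pose s := tau / n%:R.
have s0 : 0 < s by rewrite divr_gt0// ltr0n.
pose c : R[i] := Complex 0 s.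
have cn0 : c != 0 by rewrite /c eq_complex/= negb_and (gt_eqF s0) orbT.
have cN x : hn (c *: x) = s * hn x.
  by rewrite /hnorm nsqZ/= expr0n add0r sqrtrM ?sqr_ge0// sqrtr_sqr gtr0_norm.
have /choice[T TP] : forall u, exists w, M u -> D w /\ w + c *: B w = u.
  move=> x; have [Mx|nMx] := pselect (M x); last by exists 0.
  by have [w Dw Sw] := resolvent_surj s0 Mx; exists w.
have inj x y : D x -> D y -> x + c *: B x = y + c *: B y -> x = y.
  move=> Dx Dy xy; apply/eqP; rewrite -subr_eq0; apply/eqP.
  have [Dxy Bxy] := selfadjoint_B Dx Dy.
  apply: (inner_eq0 ip); apply/eqP; rewrite eq_le inner_ge0// andbT.
  have := nsq_resolvent s Dxy; rewrite Bxy -/c scalerBr addrACA -opprD xy subrr.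
  rewrite inner0l/= => ->.
  by rewrite lerDl mulr_ge0 ?sqr_ge0 ?inner_ge0.
(* On M, [T] is the resolvent (1 + c B)^(-1) and [C] is B T. This form of B T makes it clear that it
   commutes with [T]. *)
pose C x := c^-1 *: (x - T x).
have MT x : M x -> M (T x) by move=> /TP[+ _]; exact: DM.
have MC x : M x -> M (C x) by move=> Mx; apply/MZ/MB => //; exact: MT.
have BT x : M x -> B (T x) = C x.
  move=> /TP[_ E]; rewrite /C.
  have -> : x - T x = c *: B (T x) by rewrite -{1}E addrAC subrr add0r.
  by rewrite scalerA mulVf// scale1r.
have TL a x y : M x -> M y -> T (a *: x + y) = a *: T x + T y.
  move=> Mx My; have [Dx Ex] := TP _ Mx; have [Dy Ey] := TP _ My.
  have [Dz Ez] := TP _ (ML a Mx My).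
  have [Dw Bw] := selfadjoint_linear a Dx Dy.
  apply: inj => //; rewrite Bw Ez -{1}Ex -{1}Ey !scalerDr !scalerA (mulrC a).
  by rewrite addrACA.
have TC x : M x -> T (C x) = C (T x).
  move=> Mx; have MTx := MT _ Mx; rewrite /C.
  have -> : c^-1 *: (x - T x) = c^-1 *: x + (- c^-1) *: T x.
    by rewrite scalerBr scaleNr.
  rewrite TL//; last exact: MZ.
  have := TL (- c^-1) _ _ MTx M0.
  have T0 : T 0 = 0.
    by have := TL (-1) _ _ M0 M0; rewrite scaler0 addr0 scaleN1r addNr.
  by rewrite T0 !addr0 => ->; rewrite scalerBr scaleNr.
have hT x : M x -> hn (T x) <= hn x.
  move=> Mx; have [Dx Ex] := TP _ Mx.
  have := nsq_resolvent s Dx; rewrite -/c Ex => nx.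
  by rewrite hnorm_le ?hnorm_ge0// hnorm_sqr nx lerDl mulr_ge0 ?sqr_ge0 ?inner_ge0.
have hC x : M x -> hn (C x) <= (n%:R / tau) * hn x.
  move=> Mx; have [Dx Ex] := TP _ Mx; rewrite -BT//.
  have -> : n%:R / tau = s^-1 by rewrite invf_div.
  rewrite -(ler_pM2l s0) mulrA mulfV ?gt_eqF// mul1r.
  rewrite -cN hnorm_le ?hnorm_ge0// hnorm_sqr nsqZ/= expr0n add0r.
  have := nsq_resolvent s Dx; rewrite -/c Ex => ->.
  by rewrite lerDr inner_ge0.
have Mu := DM Du.
have MiC j : M (iter j C u) by elim: j => //= j; exact: MC.
have MiT m x : M x -> M (iter m T x) by move=> Mx; elim: m => //= m; exact: MT.
have CiT m x : M x -> C (iter m T x) = iter m T (C x).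
  by move=> Mx; elim: m => //= m IH; rewrite -IH TC//; exact: MiT.
have hCu : hn (T u - u) <= s * hn (B u).
  have [DTu ETu] := TP _ Mu.
  have [Dd Bd] := selfadjoint_B Du DTu.
  have [Dw Bw] := selfadjoint_Z c^-1 Dd.
  have -> : T u - u = - (c *: C u).
    by rewrite /C scalerA mulfV// scale1r opprB.
  have -> : hn (- (c *: C u)) = hn (c *: C u) by rewrite /hnorm nsqN.
  rewrite cN ler_pM2l// hnorm_le ?hnorm_ge0// hnorm_sqr.
  (* In other words C u = T (B u), so that |C u| <= |B u| because [T] is a contraction. *)
  have -> : B u = C u + c *: B (C u).
    rewrite Bw Bd scalerA mulfV// scale1r /C scalerBr.
    have -> : B (T u) = c^-1 *: u - c^-1 *: T u.
      by rewrite BT// /C scalerBr.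
    by rewrite [RHS]addrC subrK.
  by rewrite nsq_resolvent// lerDl mulr_ge0 ?sqr_ge0 ?inner_ge0.
(* For j <= n this is B^j T^n u. Beyond n the truncated subtraction leaves C^j u, for which the norm
   bound still holds. *)
pose v j := iter (n - j) T (iter j C u).
exists v; split.
- move=> j jn; rewrite /v -(subnSK jn) iterS.
  have Mj := MiT (n - j.+1)%N _ (MiC j).
  by split; [exact: (TP _ Mj).1|rewrite BT// CiT].
- move=> j; have hiT m x : M x -> hn (iter m T x) <= hn x.
    move=> Mx; elim: m => //= m IH; apply: le_trans IH; apply: hT.
    exact: MiT.
  apply: (le_trans (hiT _ _ (MiC j))).
  elim: j => [|j IH]; first by rewrite expr0 mul1r.
  rewrite iterS exprS -mulrA; apply: (le_trans (hC _ (MiC j))).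
  by rewrite ler_wpM2l// divr_ge0// ltW.
- rewrite /v subn0 /= .
  (* T^n u - u telescopes into n terms T^i (T u - u), each of norm at most s |B u|. *)
  have -> : tau = n%:R * s by rewrite /s mulrC divfK// pnatr_eq0 -lt0n.
  elim: (n) => [|m IH] /=.
    by rewrite subrr !mul0r hnorm_le// expr0n/= inner0l.
  have -> : T (iter m T u) - u = T (iter m T u - u) + (T u - u).
    have -> : iter m T u - u = (-1) *: u + iter m T u by rewrite scaleN1r addrC.
    rewrite TL//; last exact: MiT.
    by rewrite scaleN1r addrACA addNr add0r.
  apply: (le_trans (hnormD _ _)); rewrite -natr1 !mulrDl mul1r.
  apply: lerD => //; apply: le_trans IH; apply: hT.
  by apply: MB => //; exact: MiT.
Qed.

End selfadjoint.
End hilbert.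

(** * Complex square-integrable functions *)

Section real_L2.
Context d (T : measurableType d) (R : realType).
Variable mu : {measure set T -> \bar R}.
Implicit Types f g h : T -> R.

Lemma integrable_scale (D : set T) f k : measurable D ->
  mu.-integrable D (EFin \o f) -> mu.-integrable D (EFin \o (fun x => k * f x)).
Proof.
move=> mD fi; rewrite (_ : _ \o _ = fun x => k%:E * (f x)%:E)%E//.
exact: integrableZl.
Qed.

Lemma integrable_lin (D : set T) a b f g : measurable D ->
  mu.-integrable D (EFin \o f) -> mu.-integrable D (EFin \o g) ->
  mu.-integrable D (EFin \o (fun x => a * f x + b * g x)).
Proof.
move=> mD fi gi.
exact: (integrableD mD (integrable_scale a mD fi) (integrable_scale b mD gi)).
Qed.

Lemma Lfun2P f : f \in Lfun mu 2%:E <->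
  measurable_fun setT f /\ mu.-integrable setT (EFin \o (fun x => f x ^+ 2)).
Proof.
split=> [fL|[mf /integrableP[_ fi]]].
  by split; [exact: measurable_Lfun fL|exact: Lfun2_integrable_sqr].
rewrite inE; apply/andP; split; rewrite inE//= /finite_norm unlock /Lnorm.
apply: poweR_lty; apply: le_lt_trans fi; rewrite le_eqVlt; apply/orP; left.
apply/eqP; apply: eq_integral => x _ /=.
by rewrite powR_mulrn// normrX.
Qed.

Lemma Lfun2_mul f g : f \in Lfun mu 2%:E -> g \in Lfun mu 2%:E ->
  mu.-integrable setT (EFin \o (fun x => f x * g x)).
Proof. by move=> fL gL; apply/Lfun1_integrable; exact: Lfun2_mul_Lfun1. Qed.

Lemma Lfun2_lin a b f g : f \in Lfun mu 2%:E -> g \in Lfun mu 2%:E ->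
  (fun x => a * f x + b * g x) \in Lfun mu 2%:E.
Proof.
move=> fL gL; have [L0 LD] := Lfun_submod_closed mu (lee1n 2).
rewrite (_ : (fun _ => _) = a *: f + (b *: g + 0)); last by rewrite addr0.
by apply: (LD) => //; exact: (LD).
Qed.

Lemma Lfun2B f g : f \in Lfun mu 2%:E -> g \in Lfun mu 2%:E ->
  (fun x => f x - g x) \in Lfun mu 2%:E.
Proof.
move=> fL gL; have := Lfun2_lin 1 (-1) fL gL.
by under eq_fun do rewrite mul1r mulN1r.
Qed.

Lemma Lfun2D f g : f \in Lfun mu 2%:E -> g \in Lfun mu 2%:E ->
  (fun x => f x + g x) \in Lfun mu 2%:E.
Proof.
move=> fL gL; have := Lfun2_lin 1 1 fL gL.
by under eq_fun do rewrite !mul1r.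
Qed.

Lemma ae_eq_Rintegral f g : measurable_fun setT f -> measurable_fun setT g ->
  {ae mu, forall x, f x = g x} -> \int[mu]_x f x = \int[mu]_x g x.
Proof.
move=> mf mg fg; rewrite /Rintegral; congr fine; apply: ae_eq_integral => //.
- exact/measurable_EFinP.
- exact/measurable_EFinP.
- by apply: filterS fg => x /= ->.
Qed.

Definition L2_dot f g : R := \int[mu]_x (f x * g x).

Lemma EFin_L2_dot f g : f \in Lfun mu 2%:E -> g \in Lfun mu 2%:E ->
  (L2_dot f g)%:E = (\int[mu]_x (f x * g x)%:E)%E.
Proof.
by move=> fL gL; rewrite fineK//; apply: integrable_fin_num => //; exact: Lfun2_mul.
Qed.

Lemma L2_dotC f g : L2_dot f g = L2_dot g f.
Proof. by apply: eq_Rintegral => x _; rewrite mulrC. Qed.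

Lemma L2_dot_linr a b f g h : f \in Lfun mu 2%:E -> g \in Lfun mu 2%:E ->
  h \in Lfun mu 2%:E ->
  L2_dot h (fun x => a * f x + b * g x) = a * L2_dot h f + b * L2_dot h g.
Proof.
move=> fL gL hL; have If := Lfun2_mul hL fL; have Ig := Lfun2_mul hL gL.
rewrite /L2_dot -!RintegralZl// -RintegralD//.
- by apply: eq_Rintegral => x _; ring.
- exact: integrable_scale.
- exact: integrable_scale.
Qed.

Lemma L2_dot_aer f g h : f \in Lfun mu 2%:E -> g \in Lfun mu 2%:E ->
  h \in Lfun mu 2%:E -> {ae mu, forall x, f x = g x} ->
  L2_dot h f = L2_dot h g.
Proof.
move=> fL gL hL fg; apply: ae_eq_Rintegral.
- by apply: measurable_funM; [exact: measurable_Lfun hL|exact: measurable_Lfun fL].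
- by apply: measurable_funM; [exact: measurable_Lfun hL|exact: measurable_Lfun gL].
- by apply: filterS fg => x ->.
Qed.

Lemma L2_dot_ge0 f : 0 <= L2_dot f f.
Proof. by apply: Rintegral_ge0 => x _; rewrite -expr2 sqr_ge0. Qed.

Lemma L2_dot_eq0 f : f \in Lfun mu 2%:E -> L2_dot f f = 0 ->
  {ae mu, forall x, f x = 0}.
Proof.
move=> fL f0; have := EFin_L2_dot fL fL; rewrite f0 => /esym I0.
have mf := measurable_Lfun fL.
have mff : measurable_fun setT (fun x => (f x * f x)%:E).
  by apply/measurable_EFinP; exact: measurable_funM.
have [+ _] := ae_eq_integral_abs mu measurableT mff.
rewrite (eq_integral (fun x => (f x * f x)%:E)) => [/(_ I0)|x _]; last first.
  by rewrite gee0_abs// lee_fin -expr2 sqr_ge0.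
apply: filterS => x /(_ I) [] /eqP.
by rewrite mulf_eq0 orbb => /eqP.
Qed.

Lemma limn_einf_le (u : (\bar R)^nat) l : (\forall n \near \oo, (u n <= l)%E) ->
  (limn_einf u <= l)%E.
Proof.
move=> ul; rewrite limn_einf_lim; apply: lime_le; first exact: is_cvg_einfs.
near=> n; have : (u n <= l)%E by near: n.
by apply: le_trans; apply: ereal_inf_lbound => /=; exists n => /=.
Unshelve. all: by end_near. Qed.

(** The Riesz-Fischer argument with weighted squares. Along a fast subsequence the sum of 4^k D_k^2
    is integrable, hence finite almost everywhere, which bounds |D_k x| by a geometric sequence. No
    summation of L2 norms is needed, and [mu] may be infinite. *)
Lemma L2_dot_complete (u : nat -> T -> R) : (forall n, u n \in Lfun mu 2%:E) ->
  (forall e : R, 0 < e -> exists N, forall m n, (N <= m)%N -> (N <= n)%N ->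
     L2_dot (fun x => u m x - u n x) (fun x => u m x - u n x) < e) ->
  exists2 l, l \in Lfun mu 2%:E & forall e : R, 0 < e ->
    exists N, forall n, (N <= n)%N ->
     L2_dot (fun x => u n x - l x) (fun x => u n x - l x) < e.
Proof.
move=> uL uC; pose q f := L2_dot f f.
have uBL m n := Lfun2B (uL m) (uL n).
have /choice[N NP] : forall k, exists N, forall m n, (N <= m)%N -> (N <= n)%N ->
    q (fun x => u m x - u n x) < 16^-1 ^+ k.
  by move=> k; apply: uC; rewrite exprn_gt0// invr_gt0.
(* The running maximum makes the indices nondecreasing, and [maxn i] makes them tend to infinity. *)
pose phi k := (\max_(i < k.+1) maxn i (N i))%N.
have phi_max k : (maxn k (N k) <= phi k)%N.
  by rewrite (leq_bigmax (F := fun i : 'I_k.+1 => maxn i (N i)) (@ord_max k)).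
have phiN k m : (phi k <= m)%N -> (N k <= m)%N.
  by apply: leq_trans; apply: leq_trans (phi_max k); exact: leq_maxr.
have phik k : (k <= phi k)%N by apply: leq_trans (phi_max k); exact: leq_maxl.
have phiS k : (phi k <= phi k.+1)%N.
  by rewrite {2}/phi big_ord_recr/= leq_maxl.
pose D k x := u (phi k.+1) x - u (phi k) x.
have DL k : D k \in Lfun mu 2%:E by exact: uBL.
have mD k : measurable_fun setT (D k) by exact: measurable_Lfun (DL k).
(* The squared norm of [D k] is below 16^(-k), so the weight 4^k still leaves a summable 4^(-k). *)
pose f k x := (4 ^+ k * (D k x * D k x))%:E.
have f0 k x : (0 <= f k x)%E by rewrite lee_fin mulr_ge0 ?exprn_ge0// -expr2 sqr_ge0.
have mf k : measurable_fun setT (f k).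
  apply/measurable_EFinP; apply: measurable_funM => //.
  exact: measurable_funM.
have If : (\int[mu]_x (\sum_(k <oo) f k x) < +oo)%E.
  rewrite integral_nneseries//.
  apply: (@le_lt_trans _ _ 2%:E); last exact: ltry.
  apply: le_trans (@epsilon_trick0 R 2 xpredT _); last by [].
  apply: lee_nneseries => [i _ _|k _]; first exact: integral_ge0.
  rewrite /f; under eq_integral do rewrite EFinM.
  rewrite ge0_integralZl_EFin ?exprn_ge0//; last 2 first.
  - by move=> x _; rewrite lee_fin -expr2 sqr_ge0.
  - by apply/measurable_EFinP; exact: measurable_funM.
  rewrite -EFin_L2_dot// -EFinM lee_fin.
  have := NP k _ _ (phiN _ _ (phiS k)) (phiN _ _ (leqnn _)).
  rewrite -/(q (D k)) => qk.
  have : 4 ^+ k * q (D k) <= 4 ^+ k * 16^-1 ^+ k by rewrite ler_wpM2l ?exprn_ge0// ltW.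
  move=> /le_trans; apply; rewrite -exprMn natrX exprS invfM mulrA divff// mul1r.
  rewrite -exprVn lerXn2r// ?nnegrE//; lra.
have If' : mu.-integrable setT (fun x => \sum_(k <oo) f k x)%E.
  apply/integrableP; split.
    by apply: ge0_emeasurable_sum => // k x _ _; exact: f0.
  apply: le_lt_trans If; rewrite le_eqVlt; apply/orP; left; apply/eqP.
  by apply: eq_integral => x _; rewrite gee0_abs// nneseries_ge0// => k _ _; exact: f0.
(* The upper limit is measurable without any convergence, and it is the limit at almost every
   point. *)
pose l x := fine (limn_esup (fun k => (u (phi k) x)%:E)).
have mu_ n : measurable_fun setT (u n) by exact: measurable_Lfun.
have ml : measurable_fun setT l.
  apply: (measurableT_comp (fine_measurable measurableT)) => //.
  by apply: measurable_fun_limn_esup => n; apply/measurable_EFinP.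
have ul : {ae mu, forall x, u (phi k) x @[k --> \oo] --> l x}.
  have := integrable_ae measurableT If'; apply: filterS => x /(_ I) fin.
  set S := fine (\sum_(k <oo) f k x)%E.
  have SE : (\sum_(k <oo) f k x)%E = S%:E by rewrite fineK.
  have fS k : (2 ^+ k * D k x) ^+ 2 <= S.
    have := @nneseries_lim_ge R (f^~ x) xpredT 0%N k.+1 (fun k _ _ => f0 k x).
    rewrite SE big_nat_recr//= => h.
    have : (f k x <= S%:E)%E.
      by apply: le_trans h; rewrite leeDr// sume_ge0// => i _; exact: f0.
    have -> : (2 ^+ k * D k x) ^+ 2 = 4 ^+ k * (D k x * D k x).
      have -> : 4 = 2 ^+ 2 :> R by ring.
      by rewrite exprMn exprAC (expr2 (D k x)).
    by rewrite lee_fin.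
  have S0 : 0 <= S by apply: le_trans (fS 0%N); exact: sqr_ge0.
  have Db k : `|D k x| <= geometric (Num.sqrt S) 2^-1 k.
    rewrite /geometric/= exprVn ler_pdivlMr ?exprn_gt0//.
    rewrite -(@ler_pXn2r _ 2)// ?nnegrE ?mulr_ge0 ?exprn_ge0 ?sqrtr_ge0//.
    by rewrite sqr_sqrtr// exprMn real_normK ?num_real// -exprMn mulrC.
  have cv : cvgn (series (D^~ x)).
    apply: (@normed_cvg R R^o); apply: (series_le_cvg _ _ Db).
    - by move=> k; exact: normr_ge0.
    - by move=> k; rewrite /geometric/= mulr_ge0 ?sqrtr_ge0// exprn_ge0.
    - by apply: is_cvg_geometric_series; rewrite gtr0_norm//; lra.
  have uE : (fun k => u (phi k) x) = (fun k => u (phi 0) x + series (D^~ x) k).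
    by apply/funext => k; rewrite (eq_sum_telescope (fun k => u (phi k) x) k).
  have cvu : (fun k => u (phi k) x) @ \oo --> u (phi 0) x + limn (series (D^~ x)).
    by rewrite uE; apply: cvgD; [exact: cvg_cst|exact: cv].
  suff -> : l x = u (phi 0) x + limn (series (D^~ x)) by [].
  have cvE : (fun k => (u (phi k) x)%:E) @ \oo --> (u (phi 0) x + limn (series (D^~ x)))%:E.
    by apply: cvg_EFin; [exact: nearW|exact: cvu].
  by rewrite /l (cvg_limn_einf_sup cvE).2.
(* Fatou's lemma with [m] fixed and [k] going to infinity turns the Cauchy property into convergence
   to [l] of the whole sequence. *)
have fat m (e : R) : 0 <= e -> (\forall k \near \oo, q (fun x => u m x - u (phi k) x) <= e) ->
    (\int[mu]_x ((u m x - l x) ^+ 2)%:E <= e%:E)%E.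
  move=> e0 qe; case: ul => Z [mZ Z0 ulZ].
  have msq g h : measurable_fun setT g -> measurable_fun setT h ->
      measurable_fun setT (fun x => ((g x - h x) ^+ 2)%:E).
    by move=> mg mh; apply/measurable_EFinP; apply: measurable_funX; exact: measurable_funB.
  rewrite (@ge0_negligible_integral _ _ _ _ _ Z)//; last 2 first.
  - exact: msq.
  - by move=> x _; rewrite lee_fin sqr_ge0.
  rewrite (eq_integral (fun x => limn_einf (fun k => ((u m x - u (phi k) x) ^+ 2)%:E))).
    have mTZ : measurable ([set: T] `\` Z) by exact: measurableD.
    apply: (le_trans (fatou mu mTZ _ _)).
    - by move=> n; apply: measurable_funTS; exact: msq.
    - by move=> n x _; rewrite lee_fin sqr_ge0.
    apply: limn_einf_le; apply: filterS qe => k qk.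
    apply: (@le_trans _ _ (\int[mu]_x ((u m x - u (phi k) x) ^+ 2)%:E)%E).
      apply: ge0_subset_integral => //; first exact: msq.
      by move=> x _; rewrite lee_fin sqr_ge0.
    by have := EFin_L2_dot (uBL m (phi k)) (uBL m (phi k)); under eq_integral do rewrite -expr2; move=> <-; rewrite lee_fin.
  move=> x; rewrite inE => -[_ Zx].
  have ux : u (phi k) x @[k --> \oo] --> l x by apply: contrapT => nux; exact/Zx/ulZ.
  have /cvg_limn_einf_sup[-> _] // : (fun k => ((u m x - u (phi k) x) ^+ 2)%:E) @ \oo -->
      ((u m x - l x) ^+ 2)%:E.
  apply: cvg_EFin; first exact: nearW.
  rewrite /comp/=; under eq_fun do rewrite expr2.
  by rewrite expr2; apply: cvgM; apply: cvgB => //; exact: cvg_cst.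
have lL : l \in Lfun mu 2%:E.
  have [N1 hN1] := uC 1 ltr01.
  have h := fat N1 1 ler01.
  suff uml : (fun x => u N1 x - l x) \in Lfun mu 2%:E.
    by have := Lfun2B (uL N1) uml; under eq_fun do rewrite opprB addrC subrK.
  apply/Lfun2P; split; first exact: measurable_funB.
  apply/integrableP; split.
    by apply/measurable_EFinP; apply: measurable_funX; exact: measurable_funB.
  apply: (@le_lt_trans _ _ 1%:E); last exact: ltry.
  under eq_integral do rewrite /= ger0_norm ?sqr_ge0//.
  apply: h; exists N1 => // k /= N1k; apply/ltW/hN1 => //.
  exact: leq_trans (phik k).
exists l => // e e0; have e20 : 0 < e / 2 by rewrite divr_gt0.
have [N1 hN1] := uC _ e20; exists N1 => n N1n.
have : (\int[mu]_x ((u n x - l x) ^+ 2)%:E <= (e / 2)%:E)%E.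
  apply: fat; first exact: ltW.
  exists N1 => // k /= N1k; apply/ltW/hN1 => //.
  exact: leq_trans (phik k).
have := EFin_L2_dot (Lfun2B (uL n) lL) (Lfun2B (uL n) lL).
under eq_integral do rewrite -expr2.
by move=> <-; rewrite lee_fin; lra.
Qed.

End real_L2.

(** * Complex L2 as a Hilbert space, through real and imaginary parts *)

Section complex_L2_space.
Context d (T : measurableType d) (R : realType).
Variable mu : {measure set T -> \bar R}.
Implicit Types u v w : cL2 mu.
Local Open Scope quotient_scope.

Definition cL2_re u : T -> R := fun x => Re (cL2_fun u x).
Definition cL2_im u : T -> R := fun x => Im (cL2_fun u x).

Lemma cL2_reL u : cL2_re u \in Lfun mu 2%:E.
Proof. by have /andP[] := valP (repr u). Qed.

Lemma cL2_imL u : cL2_im u \in Lfun mu 2%:E.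
Proof. by have /andP[] := valP (repr u). Qed.

Lemma cL2_fun_linear a u v :
  {ae mu, forall x, cL2_fun (a *: u + v) x = a * cL2_fun u x + cL2_fun v x}.
Proof.
have -> : a *: u + v = \pi_(cL2 mu) (a *: repr u + repr v).
  by rewrite [RHS]raddfD/= reprK.
have := cL2_reprK (a *: repr u + repr v); apply: filterS => x.
by rewrite cL2fun_valP.
Qed.

Lemma cL2_re_linear a u v :
  {ae mu, forall x, cL2_re (a *: u + v) x =
    Re a * cL2_re u x + - Im a * cL2_im u x + cL2_re v x}.
Proof.
apply: filterS (cL2_fun_linear a u v) => x; rewrite /cL2_re /cL2_im => ->.
by case: a => ? ?; case: (cL2_fun u x) => ? ?; case: (cL2_fun v x) => ? ?; rewrite /= mulNr.
Qed.

Lemma cL2_im_linear a u v :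
  {ae mu, forall x, cL2_im (a *: u + v) x =
    Re a * cL2_im u x + Im a * cL2_re u x + cL2_im v x}.
Proof.
apply: filterS (cL2_fun_linear a u v) => x; rewrite /cL2_re /cL2_im => ->.
by case: a => ? ?; case: (cL2_fun u x) => ? ?; case: (cL2_fun v x) => ? ?.
Qed.

Lemma cL2_eqP u v : {ae mu, forall x, cL2_re u x = cL2_re v x} ->
  {ae mu, forall x, cL2_im u x = cL2_im v x} -> u = v.
Proof.
move=> re_uv im_uv; rewrite -[u]reprK -[v]reprK; apply/cL2P.
apply: filterS2 re_uv im_uv => x; rewrite /cL2_re /cL2_im /cL2_fun.
by case: (val _ x) => ? ?; case: (val _ x) => ? ? /= -> ->.
Qed.

Lemma cL2_innerE_dot u v : cL2_inner u v =
  (L2_dot mu (cL2_re u) (cL2_re v) + L2_dot mu (cL2_im u) (cL2_im v)) +i*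
  (L2_dot mu (cL2_re u) (cL2_im v) - L2_dot mu (cL2_im u) (cL2_re v)).
Proof.
have ru := cL2_reL u; have iu := cL2_imL u.
have rv := cL2_reL v; have iv := cL2_imL v.
rewrite /cL2_inner /cintegral /L2_dot -RintegralD//; try exact: Lfun2_mul.
rewrite -RintegralB//; try exact: Lfun2_mul.
congr (_ +i* _); apply: eq_Rintegral => x _; rewrite /cL2_re /cL2_im.
  by case: (cL2_fun u x) => ? ?; case: (cL2_fun v x) => ? ? /=; ring.
by case: (cL2_fun u x) => ? ?; case: (cL2_fun v x) => ? ? /=; ring.
Qed.

Lemma L2_dot_re_linear a u v h : h \in Lfun mu 2%:E ->
  L2_dot mu h (cL2_re (a *: u + v)) = Re a * L2_dot mu h (cL2_re u) -
    Im a * L2_dot mu h (cL2_im u) + L2_dot mu h (cL2_re v).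
Proof.
move=> hL; rewrite (L2_dot_aer (cL2_reL _) _ hL (cL2_re_linear a u v)); last first.
  by apply: Lfun2D; [apply: Lfun2_lin|]; rewrite ?cL2_reL ?cL2_imL.
have l := Lfun2_lin (Re a) (- Im a) (cL2_reL u) (cL2_imL u).
have := L2_dot_linr 1 1 l (cL2_reL v) hL.
under [X in L2_dot mu h X = _ -> _]eq_fun do rewrite !mul1r.
by move=> ->; rewrite L2_dot_linr ?cL2_reL ?cL2_imL// !mul1r mulNr.
Qed.

Lemma L2_dot_im_linear a u v h : h \in Lfun mu 2%:E ->
  L2_dot mu h (cL2_im (a *: u + v)) = Re a * L2_dot mu h (cL2_im u) +
    Im a * L2_dot mu h (cL2_re u) + L2_dot mu h (cL2_im v).
Proof.
move=> hL; rewrite (L2_dot_aer (cL2_imL _) _ hL (cL2_im_linear a u v)); last first.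
  by apply: Lfun2D; [apply: Lfun2_lin|]; rewrite ?cL2_reL ?cL2_imL.
have l := Lfun2_lin (Re a) (Im a) (cL2_imL u) (cL2_reL u).
have := L2_dot_linr 1 1 l (cL2_imL v) hL.
under [X in L2_dot mu h X = _ -> _]eq_fun do rewrite !mul1r.
by move=> ->; rewrite L2_dot_linr ?cL2_reL ?cL2_imL// !mul1r.
Qed.

Lemma cL2_inner_linear a u v w :
  cL2_inner w (a *: u + v) = a * cL2_inner w u + cL2_inner w v.
Proof.
rewrite !cL2_innerE_dot !L2_dot_re_linear ?cL2_reL ?cL2_imL//.
rewrite !L2_dot_im_linear ?cL2_reL ?cL2_imL//.
by case: a => a b /=; apply/eqP; rewrite eq_complex/=; apply/andP; split; apply/eqP; ring.
Qed.

Lemma cL2_inner_product : inner_product (@cL2_inner _ _ R mu).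
Proof.
have D u v w : cL2_inner u (v + w) = cL2_inner u v + cL2_inner u w.
  by have := cL2_inner_linear 1 v w u; rewrite scale1r mul1r.
split=> // [a u v|u v|u|u].
- have := cL2_inner_linear a v 0 u; rewrite addr0 => ->.
  have := D u 0 0; rewrite addr0 => /eqP; rewrite -subr_eq subrr => /eqP <-.
  by rewrite addr0.
- rewrite !cL2_innerE_dot/=; apply/eqP; rewrite eq_complex/=.
  rewrite (L2_dotC _ (cL2_re v)) (L2_dotC _ (cL2_im v)) eqxx/=.
  by rewrite (L2_dotC _ (cL2_re v)) (L2_dotC _ (cL2_im v)) opprB.
- by rewrite cL2_innerE_dot/= addr_ge0// L2_dot_ge0.
- rewrite cL2_innerE_dot/= => /eqP; rewrite paddr_eq0 ?L2_dot_ge0// => /andP[/eqP r0 /eqP i0].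
  have r1 := L2_dot_eq0 (cL2_reL u) r0; have i1 := L2_dot_eq0 (cL2_imL u) i0.
  rewrite -[u]reprK; apply/eqP; rewrite -(raddf0 (\pi_(cL2 mu))); apply/eqP/cL2P.
  apply: filterS2 r1 i1 => x; rewrite /cL2_re /cL2_im /cL2_fun.
  by case: (val _ x) => ? ? /= -> ->.
Qed.

Lemma cL2_nsqE u : Re (cL2_inner u u) =
  L2_dot mu (cL2_re u) (cL2_re u) + L2_dot mu (cL2_im u) (cL2_im u).
Proof. by rewrite cL2_innerE_dot. Qed.

Lemma L2_dot_ae2 f g : f \in Lfun mu 2%:E -> g \in Lfun mu 2%:E ->
  {ae mu, forall x, f x = g x} -> L2_dot mu f f = L2_dot mu g g.
Proof.
by move=> fL gL fg; rewrite (L2_dot_aer fL gL fL fg) L2_dotC (L2_dot_aer fL gL gL fg).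
Qed.

Lemma cL2_nsqB u v : Re (cL2_inner (u - v) (u - v)) =
  L2_dot mu (fun x => cL2_re u x - cL2_re v x) (fun x => cL2_re u x - cL2_re v x) +
  L2_dot mu (fun x => cL2_im u x - cL2_im v x) (fun x => cL2_im u x - cL2_im v x).
Proof.
rewrite cL2_nsqE; congr (_ + _); apply: L2_dot_ae2; rewrite ?cL2_reL ?cL2_imL//.
- exact: Lfun2B (cL2_reL u) (cL2_reL v).
- have := cL2_re_linear (-1) v u; rewrite scaleN1r addrC; apply: filterS => x ->.
  by rewrite /= oppr0; ring.
- exact: Lfun2B (cL2_imL u) (cL2_imL v).
- have := cL2_im_linear (-1) v u; rewrite scaleN1r addrC; apply: filterS => x ->.
  by rewrite /=; ring.
Qed.

Lemma cL2_complete : complete_for (@cL2_inner _ _ R mu).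
Proof.
move=> g gC.
have [|lr lrL lrP] := L2_dot_complete (fun n => cL2_reL (g n)).
  move=> e /gC[N NP]; exists N => m n Nm Nn; apply: le_lt_trans (NP m n Nm Nn).
  by rewrite cL2_nsqB lerDl L2_dot_ge0.
have [|li liL liP] := L2_dot_complete (fun n => cL2_imL (g n)).
  move=> e /gC[N NP]; exists N => m n Nm Nn; apply: le_lt_trans (NP m n Nm Nn).
  by rewrite cL2_nsqB lerDr L2_dot_ge0.
pose l : T -> R[i] := fun x => lr x +i* li x.
have lL : l \in cLfun mu 2%:E by rewrite inE; apply/andP.
have lE := to_cL2K lL.
exists (to_cL2 mu l) => e e0; have e20 : 0 < e / 2 by rewrite divr_gt0.
have [N1 h1] := lrP _ e20; have [N2 h2] := liP _ e20.
exists (maxn N1 N2) => n; rewrite geq_max => /andP[/h1 {}h1 /h2 {}h2].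
rewrite cL2_nsqB (@L2_dot_ae2 _ (fun x => cL2_re (g n) x - lr x)).
- rewrite (@L2_dot_ae2 (fun x => cL2_im (g n) x - cL2_im (to_cL2 mu l) x)
    (fun x => cL2_im (g n) x - li x)).
  + by have := ltrD h1 h2; rewrite -splitr.
  + exact: Lfun2B (cL2_imL _) (cL2_imL _).
  + exact: Lfun2B (cL2_imL _) liL.
  + by apply: filterS lE => x; rewrite {2}/cL2_im => ->.
- exact: Lfun2B (cL2_reL _) (cL2_reL _).
- exact: Lfun2B (cL2_reL _) lrL.
- by apply: filterS lE => x; rewrite {2}/cL2_re => ->.
Qed.

End complex_L2_space.

(** * Test functions and the du Bois-Reymond lemma *)

Section smooth_bumps.
Context (R : realType).
Implicit Types (p : {poly R}) (f g : R -> R) (x y a b : R).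

(* The derivatives of [y |-> exp (- 1 / y)] are all of this form. *)
Definition flat_exp p y : R :=
  if 0 < y then p.[y^-1] * expR (- y^-1) else 0.

(** The k-th power of t <= exp t at t = z / (k + 1). Dividing by k + 1 instead of k covers k = 0. *)
Lemma exprn_le_expR k (z : R) : 0 <= z -> z ^+ k <= k.+1%:R ^+ k * expR z.
Proof.
move=> z0; have k0 : 0 < k.+1%:R :> R by [].
rewrite mulrC -ler_pdivrMr ?exprn_gt0// -expr_div_n.
have zk0 : 0 <= z / k.+1%:R by rewrite divr_ge0.
apply: (@le_trans _ _ (expR (z / k.+1%:R) ^+ k)).
  rewrite lerXn2r// ?nnegrE ?expR_ge0//.
  by apply: le_trans (expR_ge1Dx _); rewrite lerDr.
rewrite -expRM_natl ler_expR mulrCA ler_piMr//.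
by rewrite ler_pdivrMr// mul1r ler_nat.
Qed.

Lemma horner_expR_bounded p : exists2 C, 0 <= C &
  forall z, 0 <= z -> `|p.[z]| * expR (- z) <= C.
Proof.
exists (\sum_(i < size p) `|p`_i| * i.+1%:R ^+ i).
  by apply: sumr_ge0 => i _; rewrite mulr_ge0// exprn_ge0.
move=> z z0; rewrite expRN ler_pdivrMr ?expR_gt0// mulr_suml horner_coef.
apply: le_trans (ler_norm_sum _ _ _) _; apply: ler_sum => i _.
by rewrite normrM normrX (ger0_norm z0) -mulrA ler_wpM2l// exprn_le_expR.
Qed.

(** Boundedness of z^2 p(z) exp (- z) at z = 1 / y. A quadratic bound is what makes the difference
    quotient at 0 tend to 0. *)
Lemma flat_exp_le p : exists2 C, 0 <= C &
  forall y, `|flat_exp p y| <= C * `|y| ^+ 2.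
Proof.
have [C C0 pC] := horner_expR_bounded ('X^2 * p); exists C => // y.
rewrite /flat_exp; case: ifPn => [y0|_]; last by rewrite normr0 mulr_ge0// exprn_ge0.
have yV0 : 0 <= y^-1 by rewrite invr_ge0 ltW.
have := pC _ yV0; rewrite hornerM hornerXn normrM normrX (ger0_norm yV0) normrM.
rewrite (ger0_norm (expR_ge0 _)) exprVn -mulrA mulrC ler_pdivrMr ?exprn_gt0//.
by rewrite (gtr0_norm y0).
Qed.

(** With z = 1 / y, d/dy is - z^2 d/dz, and the derivative of p(z) exp (- z) in z is (p' - p)(z) exp
    (- z). *)
Lemma is_derive_flat_exp p y :
  is_derive y 1 (flat_exp p) (flat_exp ('X^2 * (p - p^`())) y).
Proof.
have [y0|y0|y0] := ltrgtP y 0.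
- rewrite {2}/flat_exp ltNge (ltW y0)/=.
  apply: (@near_eq_is_derive _ _ _ (cst 0)).
  near=> z; rewrite /flat_exp ifF//; apply/negbTE; rewrite -leNgt.
  apply: ltW; near: z; exact: lt_nbhsl.
- rewrite {2}/flat_exp y0.
  apply: (@near_eq_is_derive _ _ _ ((horner p \o GRing.inv) * (expR \o (-%R \o GRing.inv)))).
    near=> z; rewrite /flat_exp ifT//.
    near: z; exact: lt_nbhsr.
  have yn0 : y != 0 by rewrite gt_eqF.
  have dV : is_derive y 1 GRing.inv (- y ^- 2).
    by have := is_deriveV yn0 (is_derive_id y 1); rewrite scaler1.
  have dN : is_derive y 1 (-%R \o GRing.inv) (y ^- 2).
    by have := is_deriveN dV; rewrite opprK.
  have d1 := is_derive1_comp (is_derive_poly p y^-1) dV.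
  have d2 := is_derive1_comp (g := -%R \o GRing.inv) (is_derive_expR (- y^-1)) dN.
  rewrite [X in is_derive _ _ _ X](_ : _ =
    (horner p \o GRing.inv) y *: (expR (- y^-1) * y ^- 2) +
    (expR \o (-%R \o GRing.inv)) y *: (p^`().[y^-1] * - y ^- 2)); first exact: is_deriveM.
  rewrite /= hornerM hornerXn hornerD hornerN /GRing.scale/= -exprVn.
  by ring.
- subst y; rewrite {2}/flat_exp ltxx.
  have [C C0 hC] := flat_exp_le p.
  have f0 : flat_exp p 0 = 0 by rewrite /flat_exp ltxx.
  have cv : h^-1 *: ((flat_exp p \o shift 0) (h *: 1) - flat_exp p 0) @[h --> 0^'] --> 0.
    apply/cvgr0Pnorm_lt => e e0; near=> h.
    have h0 : h != 0 by near: h; exact: nbhs_dnbhs_neq.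
    rewrite f0 subr0 /= addr0 /GRing.scale/= mulr1 normrM normfV.
    apply: (@le_lt_trans _ _ (C * `|h|)).
      by rewrite mulrC ler_pdivrMr ?normr_gt0// -mulrA -expr2 hC.
    apply: (@le_lt_trans _ _ ((C + 1) * `|h|)).
      by rewrite ler_wpM2r// lerDl.
    rewrite mulrC -ltr_pdivlMr ?ltr_wpDl//.
    by near: h; apply: dnbhs0_lt; rewrite divr_gt0// ltr_wpDl.
  by apply: DeriveDef; [apply/cvg_ex; exists 0|apply/cvg_lim].
Unshelve. all: by end_near. Qed.

(** This class is closed under differentiation, so derivatives of every order exist by induction,
    without a formula for the n-th one. *)
Inductive smooth_bump : (R -> R) -> Prop :=
| smooth_base p a b : smooth_bump (fun x => flat_exp p (a * x + b))
| smooth_add f g : smooth_bump f -> smooth_bump g -> smooth_bump (fun x => f x + g x)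
| smooth_mul f g : smooth_bump f -> smooth_bump g -> smooth_bump (fun x => f x * g x)
| smooth_scale a f : smooth_bump f -> smooth_bump (fun x => a * f x).

Lemma smooth_bump_is_derive f : smooth_bump f ->
  exists2 g, smooth_bump g & forall x, is_derive x 1 f (g x).
Proof.
elim=> {f} [p a b|f g _ [f' sf' df] _ [g' sg' dg]|f g sf [f' sf' df] sg [g' sg' dg]|a f _ [f' sf' df]].
- exists (fun x => a * flat_exp ('X^2 * (p - p^`())) (a * x + b)).
    by apply: smooth_scale; exact: smooth_base.
  move=> x; have d1 : is_derive x 1 (fun x => a * x + b) a.
    have := is_deriveD (is_deriveZ a (is_derive_id x 1)) (is_derive_cst b x 1).
    by rewrite addr0 scaler1.
  have := is_derive1_comp (g := fun x => a * x + b) (is_derive_flat_exp p (a * x + b)) d1.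
  by rewrite mulrC.
- by exists (fun x => f' x + g' x); [exact: smooth_add|move=> x; exact: is_deriveD].
- exists (fun x => f x * g' x + g x * f' x).
    by apply: smooth_add; exact: smooth_mul.
  by move=> x; exact: is_deriveM.
- by exists (fun x => a * f' x); [exact: smooth_scale|move=> x; exact: is_deriveZ].
Qed.

Lemma smooth_bump_derivable f : smooth_bump f -> forall n x, derivable (f^`(n))%classic x 1.
Proof.
move=> sf n; suff : smooth_bump (f^`(n))%classic.
  by move=> /smooth_bump_is_derive[g _ dg] x; have [] := dg x.
elim: n => [|n IH]; first by rewrite derive1n0.
rewrite derive1nS; have [g sg dg] := smooth_bump_is_derive IH.
suff -> : ((f^`(n))^`())%classic = g by [].
by apply/funext => x; rewrite derive1E; exact: derive_val.
Qed.

Lemma smooth_bump_continuous f : smooth_bump f -> continuous f.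
Proof.
move=> sf x; apply: differentiable_continuous; apply/derivable1_diffP.
by have := @smooth_bump_derivable _ sf 0%N x; rewrite derive1n0.
Qed.

(** On ]a, b[ this is exp (- 1 / (n (x - a)) - 1 / (n (b - x))) when n > 0. As n grows it tends to
    the indicator of ]a, b[ while staying below 1, so it needs no normalisation. *)
Definition bump a b n x : R :=
  flat_exp 1 (n%:R * x + - (n%:R * a)) * flat_exp 1 (- n%:R * x + n%:R * b).

Lemma flat_exp1_itv y : 0 <= flat_exp 1 y <= 1.
Proof.
rewrite /flat_exp; case: ifPn => y0; last by rewrite lexx ler01.
rewrite hornerC mul1r expR_ge0/= -[leRHS]expR0 ler_expR oppr_le0.
by rewrite invr_ge0 ltW.
Qed.

Lemma bump_itv a b n x : 0 <= bump a b n x <= 1.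
Proof.
have /andP[h1 h2] := flat_exp1_itv (n%:R * x + - (n%:R * a)).
have /andP[h3 h4] := flat_exp1_itv (- n%:R * x + n%:R * b).
by rewrite /bump mulr_ge0//= mulr_ile1.
Qed.

Lemma bump_smooth a b n : smooth_bump (bump a b n).
Proof. by apply: smooth_mul; exact: smooth_base. Qed.

Lemma bump_support a b n x : bump a b n x != 0 -> a < x < b.
Proof.
rewrite /bump /flat_exp; case: ifPn => [h1|]; last by rewrite mul0r eqxx.
case: ifPn => [h2|]; last by rewrite mulr0 eqxx.
move=> _; apply/andP; split.
  rewrite ltNge; apply/negP => xa; move: h1.
  by rewrite -mulrBr ltNge mulr_ge0_le0// subr_le0.
rewrite ltNge; apply/negP => bx; move: h2.
by rewrite mulNr addrC -mulrBr ltNge mulr_ge0_le0// subr_le0.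
Qed.

Lemma flat_exp1_cvg t : 0 < t -> flat_exp 1 (n%:R * t) @[n --> \oo] --> (1 : R).
Proof.
move=> t0; rewrite -(cvg_shiftS (fun n => flat_exp 1 (n%:R * t))).
have -> : (fun n => flat_exp 1 (n.+1%:R * t)) =
    (fun n => expR (- (t^-1 * n.+1%:R^-1))).
  apply/funext => n; rewrite /flat_exp ifT ?mulr_gt0//.
  by rewrite hornerC mul1r invfM mulrC.
have h : - (t^-1 * n.+1%:R^-1) @[n --> \oo] --> - (t^-1 * 0).
  by apply: cvgN; apply: cvgM; [exact: cvg_cst|exact: cvg_harmonic].
have := continuous_cvg _ (@continuous_expR R _) h.
by move=> /(_ _); rewrite mulr0 oppr0 expR0.
Qed.

Lemma bump_cvg a b x : bump a b n x @[n --> \oo] --> (\1_`]a, b[%classic x : R).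
Proof.
have [xab|xab] := boolP (a < x < b); last first.
  rewrite (_ : (fun _ => _) = cst 0); last first.
    apply/funext => n /=; apply/eqP; apply: contraNT xab; exact: bump_support.
  by rewrite indicE memNset ?in_itv//=; [exact: cvg_cst|exact/negP].
rewrite indicE mem_set//=.
move: xab => /andP[ax xb].
have xa0 : 0 < x - a by rewrite subr_gt0.
have bx0 : 0 < b - x by rewrite subr_gt0.
have h : flat_exp 1 (n%:R * (x - a)) * flat_exp 1 (n%:R * (b - x)) @[n --> \oo] -->
    (1 * 1 : R) by apply: cvgM; exact: flat_exp1_cvg.
rewrite mulr1 in h; have -> // : (fun n => bump a b n x) = (fun n =>
  flat_exp 1 (n%:R * (x - a)) * flat_exp 1 (n%:R * (b - x))).
by apply/funext => n; rewrite /bump !mulrBr mulNr [n%:R * b - _]addrC.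
Qed.

Local Notation leb := (@lebesgue_measure R).

(* [measurable_itv] for the display under which [lebesgue_measure] is declared. *)
Lemma lebesgue_measurable_itv (i : interval R) :
  measurable ([set` i]%classic : set (g_sigma_algebraType R.-ocitv.-measurable)).
Proof. exact: measurable_itv. Qed.

Lemma lebesgue_aeS (P Q : R -> Prop) : (forall x, P x -> Q x) ->
  {ae leb, forall x, P x} -> {ae leb, forall x, Q x}.
Proof. by apply: filterS; exact: (ae_filter_ringOfSetsType leb). Qed.

Lemma lebesgue_aeS2 (P Q S : R -> Prop) : (forall x, P x -> Q x -> S x) ->
  {ae leb, forall x, P x} -> {ae leb, forall x, Q x} -> {ae leb, forall x, S x}.
Proof. by apply: filterS2; exact: (ae_filter_ringOfSetsType leb). Qed.

Lemma Rintegral_support (E D : set R) f : E `<=` D ->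
  (forall x, D x -> ~ E x -> f x = 0) ->
  \int[leb]_(x in D) f x = \int[leb]_(x in E) f x.
Proof.
move=> ED f0; rewrite Rintegral_mkcond [RHS]Rintegral_mkcond; apply: eq_Rintegral => x _.
rewrite !patchE; case: ifPn => [/set_mem Dx|xD]; case: ifPn => [//|/negP xE].
  by apply: f0 => // Ex; apply: xE; rewrite inE.
  by move/set_mem/ED/mem_set; rewrite (negbTE xD).
by [].
Qed.

Lemma smooth_bump_measurable f : smooth_bump f -> measurable_fun setT f.
Proof. by move=> sf; apply: continuous_measurable_fun; exact: smooth_bump_continuous. Qed.

Lemma smooth_bump_integrable f a b : smooth_bump f ->
  (forall x, f x != 0 -> a <= x <= b) -> leb.-integrable setT (EFin \o f).
Proof.
move=> sf fab.
have Iab : leb.-integrable `[a, b] (EFin \o f).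
  apply: continuous_compact_integrable; first exact: segment_compact.
  exact/continuous_subspaceT/smooth_bump_continuous.
have := (@integrable_mkcond _ _ R leb `[a, b]%classic (EFin \o f) (measurable_itv _)).1 Iab.
apply: eq_integrable => // x _; rewrite patchE; case: ifPn => // /negP xab.
apply/esym/eqP; apply/negPn/negP => fx; apply: xab; rewrite inE/= in_itv/=.
by apply: fab; apply: contra fx => /eqP /= ->.
Qed.

Lemma smooth_bump_primitive f a b : smooth_bump f -> 0 < a ->
  (forall x, f x != 0 -> a <= x <= b) -> \int[leb]_x f x = 0 ->
  exists2 phi, test_function phi & (phi^`())%classic = f.
Proof.
move=> sf a0 fab f0; have fi := smooth_bump_integrable sf fab.
pose phi x := \int[leb]_(t in `]-oo, x]) f t.
have dphi x : derivable phi x 1 /\ (phi^`())%classic x = f x.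
  apply: (@continuous_FTC1 _ f -oo%O x (x + 1)).
  - by rewrite ltrDl.
  - exact: integrableS fi.
  - by rewrite ltNyr.
  - exact: smooth_bump_continuous.
have phiE : (phi^`())%classic = f by apply/funext => x; exact: (dphi x).2.
have phin n : (phi^`(n.+1))%classic = (f^`(n))%classic.
  elim: n => [|n IH]; first by rewrite derive1n1 derive1n0.
  by rewrite derive1nS IH -derive1nS.
exists phi => //; split.
  case=> [x|n x]; first by rewrite derive1n0; exact: (dphi x).1.
  by rewrite phin; exact: smooth_bump_derivable.
exists a, b; split=> // x; apply: contraNT; rewrite negb_and -!ltNge.
have f_eq0 t : ~ (a <= t <= b) -> f t = 0.
  by move=> tab; apply/eqP; apply/negPn/negP => /fab.
case/orP => [xa|bx]; apply/eqP; rewrite /phi.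
  rewrite (@Rintegral_support set0)// ?Rintegral_set0// => t /=.
  by rewrite in_itv/= => tx _; apply: f_eq0 => /andP[at_ _]; move: (le_trans at_ tx); rewrite leNgt xa.
rewrite -(@Rintegral_support _ setT)// => t _ /=; rewrite in_itv/= => /negP.
rewrite -ltNge => xt; apply: f_eq0 => /andP[_ tb].
by move: (lt_trans bx xt); rewrite ltNge tb.
Qed.

Lemma bump_dominated (U : R -> R) a b M : 0 <= a -> b <= M ->
  leb.-integrable `[0, M] (EFin \o U) ->
  \int[leb]_(x in `[0, M]) (U x * bump a b n x) @[n --> \oo] -->
  \int[leb]_(x in `]a, b[) U x.
Proof.
move=> a0 bM IU.
have mU : measurable_fun `[0, M] U
  by apply/measurable_EFinP; exact: (measurable_int leb IU).
have mb n : measurable_fun `[0, M] (bump a b n).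
  by apply: measurable_funTS; apply: smooth_bump_measurable; exact: bump_smooth.
have ab0M : `]a, b[ `<=` `[0, M].
  move=> x /=; rewrite !in_itv/= => /andP[ax xb].
  by rewrite (ltW (le_lt_trans a0 ax)) (le_trans (ltW xb)).
have IabE : \int[leb]_(x in `]a, b[) U x = \int[leb]_(x in `[0, M]) (U x * \1_`]a, b[%classic x).
  rewrite (@Rintegral_support `]a, b[%classic `[0, M]%classic)//.
    by apply: eq_Rintegral => x xab; rewrite indicE xab mulr1.
  by move=> x _ xab; rewrite indicE memNset ?mulr0.
have mUb n : measurable_fun `[0, M] (fun x => (U x * bump a b n x)%:E).
  by apply/measurable_EFinP; apply: measurable_funM.
have mUi : measurable_fun `[0, M] (fun x => (U x * \1_`]a, b[%classic x)%:E).
  apply/measurable_EFinP; apply: measurable_funM => //.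
rewrite IabE; have [] := @dominated_convergence _ _ R leb `[0, M]%classic (measurable_itv _)
  (fun n x => (U x * bump a b n x)%:E) (fun x => (U x * \1_`]a, b[%classic x)%:E)
  (fun x => `|U x|%:E) mUb mUi.
- by apply: aeW => x _; apply: cvg_EFin; [exact: nearW|apply: cvgM; [exact: cvg_cst|exact: bump_cvg]].
- exact: (@integrable_abse _ _ R leb `[0, M]%classic (EFin \o U)).
- apply: aeW => x n _; rewrite lee_fin normrM ler_piMr//.
  by have /andP[h1 h2] := bump_itv a b n x; rewrite ger0_norm.
- move=> I1 _ I2; rewrite /Rintegral; apply: fine_cvg; rewrite fineK ?integrable_fin_num//.
Qed.

Lemma cvg_prod_eq (u v u' v' : nat -> R) a b a' b' :
  u @ \oo --> a -> v @ \oo --> b -> u' @ \oo --> a' -> v' @ \oo --> b' ->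
  (forall n, u n * v n = u' n * v' n) -> a * b = a' * b'.
Proof.
move=> ua vb ua' vb' uv; have h : u n * v n @[n --> \oo] --> a * b by exact: cvgM.
have h' : u n * v n @[n --> \oo] --> a' * b'.
  by under eq_fun do rewrite uv; exact: cvgM.
exact: cvg_unique h h'.
Qed.

(** The ratio of the integral of U times a bump to the integral of the bump does not depend on the
    bump. In the limit, the mean of U over every ]a, b[ with a > 0 is one constant c, and Lebesgue
    differentiation gives U = c almost everywhere. *)
Lemma du_bois_reymond (U : R -> R) :
  (forall b, leb.-integrable `[0, b] (EFin \o U)) ->
  (forall phi, test_function phi ->
    \int[leb]_(x in `]0, +oo[) (U x * (phi^`())%classic x) = 0) ->
  exists c, {ae leb, forall x, 0 < x -> U x = c}.
Proof.
move=> IU Uphi.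
have mbU M (f : R -> R) : smooth_bump f -> (exists C, forall x, `|f x| <= C) ->
    leb.-integrable `[0, M] (EFin \o (fun x => U x * f x)).
  move=> sf [C fC].
  have : leb.-integrable `[0, M] ((EFin \o U) \* (EFin \o f))%E.
    apply: integrableMl => //.
      by apply: measurable_funTS; exact: smooth_bump_measurable.
    by exists C; split; [exact: num_real|move=> y Cy x _; apply: le_trans (ltW Cy)].
  by apply: eq_integrable => // x _.
have b1 a b n : exists C, forall x, `|bump a b n x| <= C.
  by exists 1 => x; have /andP[h1 h2] := bump_itv a b n x; rewrite ger0_norm.
(* The combination [f] of the two bumps below has integral 0, so it is the derivative of a test
   function and U integrates to 0 against it. *)
have key a b a' b' n m M : 0 < a -> 0 < a' -> b <= M -> b' <= M ->
    (\int[leb]_(x in `[0, M]) bump a' b' m x) * (\int[leb]_(x in `[0, M]) (U x * bump a b n x)) =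
    (\int[leb]_(x in `[0, M]) bump a b n x) * (\int[leb]_(x in `[0, M]) (U x * bump a' b' m x)).
  move=> a0 a'0 bM b'M.
  set k := \int[leb]_(x in `[0, M]) bump a b n x.
  set k' := \int[leb]_(x in `[0, M]) bump a' b' m x.
  pose f x := k' * bump a b n x + (- k) * bump a' b' m x.
  have sf : smooth_bump f.
    by apply: smooth_add; apply: smooth_scale; exact: bump_smooth.
  have fE x : f x != 0 -> Num.min a a' <= x <= M.
    apply: contraNT; rewrite /f => xM.
    have z c d l : 0 < c -> d <= M -> Num.min a a' <= c -> bump c d l x = 0.
      move=> c0 dM ac; apply/eqP; apply: contraNT xM => /bump_support/andP[cx xd].
      by rewrite (le_trans ac (ltW cx)) (le_trans (ltW xd)).
    by rewrite !z ?ge_min ?lexx ?orbT// !mulr0 addr0.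
  have suppM g : (forall x, f x = 0 -> g x = 0) -> forall x : R, ~ `[0, M]%classic x -> g x = 0.
    move=> fg x xM; apply: fg; apply/eqP; apply: contrapT => /negP /fE /andP[h1 h2].
    by apply: xM; rewrite /= in_itv/= h2 andbT (le_trans _ h1)// le_min !ltW.
  have bi a1 b1' n1 : leb.-integrable `[0, M] (EFin \o bump a1 b1' n1).
    apply: (@integrableS _ _ _ _ setT) => //.
    apply: (@smooth_bump_integrable _ a1 b1'); first exact: bump_smooth.
    by move=> x /bump_support/andP[h1 h2]; rewrite !ltW.
  have f0 : \int[leb]_x f x = 0.
    rewrite (@Rintegral_support `[0, M]%classic)//; last by move=> x _; exact: suppM.
    have e1 : leb.-integrable `[0, M] (EFin \o (fun x => k' * bump a b n x)).
      by apply: integrable_scale => //; exact: bi.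
    have e2 : leb.-integrable `[0, M] (EFin \o (fun x => (- k) * bump a' b' m x)).
      by apply: integrable_scale => //; exact: bi.
    rewrite RintegralD// !RintegralZl//.
    by rewrite -/k -/k' mulrC mulNr subrr.
  have a00 : 0 < Num.min a a' by rewrite lt_min a0.
  have [phi tphi phiE] := smooth_bump_primitive sf a00 fE f0.
  have := Uphi _ tphi; rewrite phiE.
  have -> : \int[leb]_(x in `]0, +oo[) (U x * f x) = \int[leb]_(x in `]0, M]) (U x * f x).
    apply: Rintegral_support.
      by move=> x /=; rewrite !in_itv/= andbT => /andP[].
    move=> x /=; rewrite !in_itv/= andbT => x0; rewrite x0/= => xM.
    rewrite (suppM f) ?mulr0//= in_itv/= (ltW x0)/=; exact: xM.
  have iUf : leb.-integrable `[0, M] (EFin \o (fun x => U x * f x)).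
    apply: mbU => //; exists (`|k'| + `|k|) => x.
    apply: (le_trans (ler_normD _ _)); rewrite (normrM k') (normrM (- k)) normrN.
    have c1 : `|bump a b n x| <= 1 by have /andP[h1 h2] := bump_itv a b n x; rewrite ger0_norm.
    have c2 : `|bump a' b' m x| <= 1 by have /andP[h1 h2] := bump_itv a' b' m x; rewrite ger0_norm.
    by rewrite lerD// ler_piMr.
  rewrite Rintegral_itv_obnd_cbnd; last first.
    by apply: integrableS iUf => //; apply: subset_itvr; rewrite bnd_simp.
  rewrite (_ : (fun x => U x * f x) = (fun x => k' * (U x * bump a b n x) + (- k) * (U x * bump a' b' m x))); last first.
    by apply/funext => x; rewrite /f; ring.
  have e1 := mbU M _ (bump_smooth a b n) (b1 a b n).
  have e2 := mbU M _ (bump_smooth a' b' m) (b1 a' b' m).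
  have mI := lebesgue_measurable_itv `[0, M].
  have e1' := integrable_scale k' mI e1.
  have e2' := integrable_scale (- k) mI e2.
  rewrite (RintegralD mI e1' e2').
  rewrite (RintegralZl _ mI e1) (RintegralZl _ mI e2).
  by rewrite mulNr => /eqP; rewrite subr_eq0 => /eqP.
have lenE a b : a <= b -> \int[leb]_(x in `]a, b[) 1 = b - a.
  move=> ab; rewrite Rintegral_cst// mul1r [X in fine X](lebesgue_measure_itv `]a, b[) /= lte_fin.
  by case: ltP => // ba; rewrite (_ : a = b) ?subrr//; apply/le_anti; rewrite ab ba.
have I1 M : leb.-integrable `[0, M] (EFin \o cst 1).
  apply: continuous_compact_integrable; first exact: segment_compact.
  by apply: continuous_subspaceT => x; exact: cvg_cst.
pose c := \int[leb]_(x in `]1, 2[) U x.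
have lin a b : 0 < a -> a <= b -> \int[leb]_(x in `]a, b[) U x = c * (b - a).
  move=> a0 ab; pose M := Num.max 2 b.
  have bM : b <= M by rewrite le_max lexx orbT.
  have M2 : 2 <= M by rewrite le_max lexx.
  have o0 : (0 : R) <= 1 by exact: ler01.
  have len_cvg a' b' : 0 <= a' -> a' <= b' -> b' <= M ->
      \int[leb]_(x in `[0, M]) bump a' b' n x @[n --> \oo] --> b' - a'.
    move=> a'0 ab' b'M; rewrite -lenE//.
    apply: cvg_trans (bump_dominated a'0 b'M (I1 M)).
    apply: near_eq_cvg; apply: nearW => n /=.
    by apply: eq_Rintegral => x _; rewrite mul1r.
  (* The limit is taken in [n] first, with [m] fixed, and then in [m]. *)
  have h m : (\int[leb]_(x in `[0, M]) bump 1 2 m x) * (\int[leb]_(x in `]a, b[) U x) =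
     (b - a) * (\int[leb]_(x in `[0, M]) (U x * bump 1 2 m x)).
    apply: (cvg_prod_eq (cvg_cst _) (bump_dominated (ltW a0) bM (IU M))
      (len_cvg _ _ (ltW a0) ab bM) (cvg_cst _)) => n.
    by rewrite key.
  have := cvg_prod_eq (len_cvg _ _ o0 (ler1n _ 2) M2) (cvg_cst _) (cvg_cst _)
    (bump_dominated o0 M2 (IU M)) h.
  by rewrite -/c mulrC [RHS]mulrC => <-; ring.
exists c; have : forall N : nat, {ae leb, forall x, 0 < x < N%:R -> U x = c}.
  (* U is integrable only on bounded intervals, hence the truncation. By [lin], the primitive of [f]
     is affine with slope [c] inside ]0, N[. *)
  move=> N; pose f := U \_ `[0, N%:R].
  have mI := lebesgue_measurable_itv `[0, N%:R].
  have fi : leb.-integrable setT (EFin \o f).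
    by rewrite /f -restrict_EFin; apply/(integrable_mkcond _ mI).1.
  have fb b : leb.-integrable `[0, b] (EFin \o f) by exact: integrableS fi.
  have lf := integrable_locally mI (IU N%:R).
  have := FTC1 (a := BLeft 0) fb lf; apply: lebesgue_aeS => x + /andP[x0 xN].
  have l0 : (0%:E < x%:E)%E by rewrite lte_fin.
  move=> /(_ l0) [_ Fx].
  have fU y : 0 <= y -> y <= N%:R -> f y = U y.
    by move=> y0 yN; rewrite /f patchE mem_set//= in_itv/= y0.
  rewrite -fU ?ltW// -Fx derive1E.
  set F := (F in 'D_1 F x).
  have FB y z : 0 < y -> y <= z -> z < N%:R -> F z - F y = c * (z - y).
    move=> y0 yz zN; rewrite /F Rintegral_itvB//; last by rewrite bnd_simp ltW.
    rewrite -Rintegral_itv_bndo_bndc; last first.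
      by apply: integrableS (fb z) => //; apply: subset_itv; rewrite bnd_simp// ltW.
    rewrite -lin//; apply: eq_Rintegral => t; rewrite inE/= in_itv/= => /andP[yt tz].
    by rewrite fU ?ltW// ?(lt_trans y0)// (lt_trans tz).
  have d1 : is_derive x 1 (fun y => F x + c * (y - x)) c.
    have := is_deriveD (is_derive_cst (F x) x 1)
      (is_deriveZ c (is_deriveB (is_derive_id x 1) (is_derive_cst x x 1))).
    by rewrite subr0 add0r scaler1.
  suff dF : is_derive x 1 F c by rewrite (@derive_val _ _ _ _ _ _ _ dF).
  apply: near_eq_is_derive d1; near=> y.
  have y0 : 0 < y by near: y; exact: lt_nbhsr.
  have yN : y < N%:R by near: y; exact: lt_nbhsl.
  have [xy|yx] := leP x y; first by rewrite -FB// addrC subrK.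
  by have := FB y x y0 (ltW yx) xN; lra.
move=> /ae_foralln; apply: lebesgue_aeS => x h x0.
by apply: (h (Num.truncn x).+1); rewrite x0 truncnS_gt.
Unshelve. all: by end_near. Qed.

End smooth_bumps.

(** * Primitives of locally integrable functions *)

Section primitives.
Context (R : realType).
Local Notation leb := (@lebesgue_measure R).
Implicit Types (p q v w : R -> R) (a b x y : R).

(** Integrability is required up to 0, and not only on compact subsets of the open half-line, so
    that primitives can start at the boundary point. *)
Definition locint v := forall b, leb.-integrable `[0, b] (EFin \o v).

Definition prim v x : R := \int[leb]_(t in `[0, x]) v t.

Local Notation mitv := (@lebesgue_measurable_itv R).

Lemma locint_itv v (i : interval R) b : [set` i] `<=` `[0, b] -> locint v ->
  leb.-integrable [set` i] (EFin \o v).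
Proof. by move=> ib iv; apply: integrableS (iv b). Qed.

Lemma prim0 v : prim v 0 = 0.
Proof. by rewrite /prim set_itv1 Rintegral_set1. Qed.

Lemma primB v a b : locint v -> 0 <= a -> a <= b ->
  prim v b - prim v a = \int[leb]_(t in `]a, b]) v t.
Proof. by move=> iv a0 ab; rewrite /prim Rintegral_itvB// bnd_simp. Qed.

Lemma prim_continuous v b : 0 <= b -> locint v -> {within `[0, b], continuous (prim v)}.
Proof. by move=> b0 iv; exact: (parameterized_integral_continuous b0 (iv b)). Qed.

Lemma prim_measurable v b : locint v -> measurable_fun `[0, b] (prim v).
Proof.
move=> iv; have [b0|b0] := leP 0 b; last first.
  by rewrite set_itv_ge ?bnd_simp -?ltNge//; exact: measurable_fun_set0.
by apply: subspace_continuous_measurable_fun => //; exact: prim_continuous.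
Qed.

Lemma prim_bounded v b : 0 <= b -> locint v ->
  forall x, 0 <= x -> x <= b -> `|prim v x| <= prim (fun t => `|v t|) b.
Proof.
move=> b0 iv x x0 xb; have ix := iv x.
apply: (le_trans (le_normr_Rintegral (mitv _) ix)).
rewrite -subr_ge0 -/(prim _ x) primB//.
  by apply: Rintegral_ge0.
by move=> c; exact: (@integrable_abse _ _ R leb `[0, c]%classic (EFin \o v)).
Qed.

Lemma locint_norm v : locint v -> locint (fun t => `|v t|).
Proof. by move=> iv c; exact: (@integrable_abse _ _ R leb `[0, c]%classic (EFin \o v)). Qed.

Lemma locintD v w : locint v -> locint w -> locint (fun x => v x + w x).
Proof.
move=> iv iw b; rewrite (_ : _ \o _ = (EFin \o v) \+ (EFin \o w))%E//.
by apply: integrableD; [exact: mitv|exact: iv|exact: iw].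
Qed.

Lemma locintZ k v : locint v -> locint (fun x => k * v x).
Proof. by move=> iv b; apply: integrable_scale; [exact: mitv|exact: iv]. Qed.

Lemma continuous_locint v : continuous v -> locint v.
Proof.
move=> cv b; apply: continuous_compact_integrable; first exact: segment_compact.
exact: continuous_subspaceT.
Qed.

Lemma locint_cst c : locint (fun=> c).
Proof. by apply: continuous_locint => x; exact: cvg_cst. Qed.

Lemma prim_cst c b : 0 <= b -> prim (fun=> c) b = c * b.
Proof.
move=> b0; rewrite /prim Rintegral_cst//; congr (_ * _).
rewrite [X in fine X](lebesgue_measure_itv `[0, b]) /= lte_fin.
by case: ltP => /= [_|b0']; [rewrite subr0|apply/le_anti; rewrite b0 b0'].
Qed.

Lemma prim_lin a b v w x : locint v -> locint w ->
  prim (fun x => a * v x + b * w x) x = a * prim v x + b * prim w x.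
Proof.
move=> iv iw; rewrite /prim (RintegralD (mitv _) (locintZ a iv x) (locintZ b iw x)).
by rewrite (RintegralZl _ (mitv _) (iv x)) (RintegralZl _ (mitv _) (iw x)).
Qed.

Lemma locint_mul v w : locint v -> (forall b, measurable_fun `[0, b] w) ->
  (forall b, exists C, forall x, 0 <= x -> x <= b -> `|w x| <= C) ->
  locint (fun x => v x * w x).
Proof.
move=> iv mw bw b; have [C wC] := bw b.
have : leb.-integrable `[0, b] ((EFin \o v) \* (EFin \o w))%E.
  apply: integrableMl; [exact: mitv|exact: iv|exact: mw|].
  exists C; split; [exact: num_real|move=> z Cz x /=].
  by rewrite in_itv/= => /andP[x0 xb]; rewrite (le_trans (wC _ x0 xb))// ltW.
by apply: eq_integrable => //; exact: mitv.
Qed.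

Lemma locint_mul_prim v w : locint v -> locint w -> locint (fun x => v x * prim w x).
Proof.
move=> iv iw; apply: locint_mul => // [b|b]; first exact: prim_measurable.
exists (prim (fun t => `|w t|) b) => x x0 xb.
by apply: prim_bounded => //; exact: le_trans xb.
Qed.

Lemma mem_itv_set (i : interval R) y : (y \in [set` i]%classic) = (y \in i).
Proof. by apply/idP/idP => [/set_mem|h]//; exact/mem_set. Qed.

Lemma EFin_Rintegral (D : set R) v : leb.-integrable D (EFin \o v) ->
  measurable (D : set (g_sigma_algebraType R.-ocitv.-measurable)) ->
  (\int[leb]_(x in D) (v x)%:E)%E = (\int[leb]_(x in D) v x)%:E.
Proof. by move=> iv mD; rewrite fineK//; exact: integrable_fin_num. Qed.

Lemma subset_oc0 x : `]0, x]%classic `<=` `[0, x]%classic.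
Proof. by apply: subset_itvr; rewrite bnd_simp. Qed.

Lemma prim_oc v x : locint v -> prim v x = \int[leb]_(t in `]0, x]) v t.
Proof.
by move=> iv; rewrite Rintegral_itv_obnd_cbnd//; exact: locint_itv (@subset_oc0 x) iv.
Qed.

Lemma ae_eq_prim v w x : locint v -> locint w ->
  {ae leb, forall t, 0 < t -> t <= x -> v t = w t} -> prim v x = prim w x.
Proof.
move=> iv iw vw; rewrite !prim_oc// /Rintegral; congr fine.
apply: ae_eq_integral => //.
- exact: measurable_int (locint_itv (@subset_oc0 x) iv).
- exact: measurable_int (locint_itv (@subset_oc0 x) iw).
- by apply: lebesgue_aeS vw => t tvw /=; rewrite in_itv/= => /andP[t0 tx]; rewrite tvw.
Qed.

Lemma le_prim v w x : locint v -> locint w ->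
  {ae leb, forall t, 0 < t -> t <= x -> v t <= w t} -> prim v x <= prim w x.
Proof.
move=> iv iw vw; have iwv : locint (fun t => 1 * w t + (- 1) * v t).
  by apply: locintD; exact: locintZ.
rewrite -subr_ge0 -[X in _ <= X - _]mul1r -mulN1r -prim_lin//.
rewrite (ae_eq_prim iwv (locint_norm iwv)); first exact: Rintegral_ge0.
apply: lebesgue_aeS vw => t tvw t0 tx; have := tvw t0 tx.
by rewrite mul1r mulN1r -subr_ge0 => h; rewrite ger0_norm.
Qed.

Lemma prim_patch v b : locint v -> (\int[leb]_x ((v \_ `[0, b]) x)%:E)%E = (prim v b)%:E.
Proof.
move=> iv; rewrite -(EFin_Rintegral (iv b) (mitv _)) [RHS]integral_mkcond.
by rewrite restrict_EFin.
Qed.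

(* Both sides integrate [p s * q t] over the square [0, b]^2. *)
Lemma prim_mul p q b : locint p -> locint q -> 0 <= b ->
  prim (fun t => q t * prim p t) b + prim (fun t => p t * prim q t) b =
  prim p b * prim q b.
Proof.
move=> ip iq b0.
pose p0 := p \_ `[0, b]; pose q0 := q \_ `[0, b].
have I0 v : locint v -> leb.-integrable setT (EFin \o (v \_ `[0, b])).
  by move=> iv; rewrite -restrict_EFin; apply/(integrable_mkcond _ (mitv `[0, b])).1.
have ip0 := I0 _ ip; have iq0 := I0 _ iq.
have mp0 : measurable_fun setT p0 by apply/measurable_EFinP; exact: (measurable_int leb ip0).
have mq0 : measurable_fun setT q0 by apply/measurable_EFinP; exact: (measurable_int leb iq0).
pose T := g_sigma_algebraType R.-ocitv.-measurable.
(* Only the triangle s <= t is integrated. Depending on the order, the inner integral produces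
   [prim p t] or [prim q b - prim q s], and Fubini equates the two. *)
pose K (z : T * T) := (if (z.1 : R) <= z.2 then p0 z.1 * q0 z.2 else 0)%:E.
have mK : measurable_fun setT K.
  have m1 : measurable_fun setT (fun z : T * T => z.1 : R) by exact: measurable_fst.
  have m2 : measurable_fun setT (fun z : T * T => z.2 : R) by exact: measurable_snd.
  apply/measurable_EFinP; apply: measurable_fun_ifT => //.
    exact: measurable_fun_ler m1 m2.
  apply: measurable_funM.
    exact: measurableT_comp mp0 m1.
  exact: measurableT_comp mq0 m2.
pose P (z : T * T) := (p0 z.1 * q0 z.2)%:E.
have mP : measurable_fun setT P.
  apply/measurable_EFinP; apply: measurable_funM.
    exact: measurableT_comp mp0 measurable_fst.
  exact: measurableT_comp mq0 measurable_snd.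
have iP : (leb \x leb)%E.-integrable setT P.
  apply/(integrable12ltyP _ _ mP).
  have -> : (\int[leb]_x \int[leb]_y `|P (x, y)| = \int[leb]_x (`|p0 x|%:E * \int[leb]_y `|q0 y|%:E))%E.
    apply: eq_integral => x _; rewrite -ge0_integralZl_EFin//.
      by apply: eq_integral => y _; rewrite /P/= normrM.
    by apply/measurable_EFinP; exact: measurableT_comp.
  move/integrableP : iq0 => [_ q0y]; move/integrableP : ip0 => [_ p0y].
  have q0f : (\int[leb]_y `|q0 y|%:E)%E \is a fin_num by rewrite ge0_fin_numE// integral_ge0.
  rewrite -(fineK q0f); under eq_integral do rewrite muleC.
  rewrite ge0_integralZl_EFin ?fine_ge0 ?integral_ge0//.
    by rewrite lte_mul_pinfty// lee_fin fine_ge0// integral_ge0.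
  by apply/measurable_EFinP; exact: measurableT_comp.
have iK : (leb \x leb)%E.-integrable setT K.
  apply: (le_integrable measurableT mK _ iP) => z _; rewrite /K /P.
  by case: ifP => // _; rewrite lee_fin normr0.
have FK := Fubini iK.
have E1 : (\int[leb]_x \int[leb]_y K (x, y) =
    (prim (fun t => p t * (prim q b - prim q t)) b)%:E)%E.
  rewrite -prim_patch.
    apply: eq_integral => x _; rewrite /K/=.
    rewrite patchE; case: ifPn => [|xb]; last first.
      by rewrite /p0 patchE (negbTE xb); under eq_integral do rewrite mul0r if_same; rewrite integral0.
    move=> /[dup] xb /set_mem/=; rewrite in_itv/= => /andP[x0 xb'].
    have iqx : leb.-integrable `]x, b] (EFin \o q).
      by apply: (locint_itv (b := b) _ iq) => t /=; rewrite !in_itv/= => /andP[xt ->]; rewrite (le_trans x0 (ltW xt)).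
    rewrite primB// -(RintegralZl _ (mitv _) iqx).
    rewrite Rintegral_itv_obnd_cbnd; last first.
      apply: (locint_itv (b := b) _ (locintZ (p x) iq)) => t /=; rewrite !in_itv/= => /andP[xt ->].
      by rewrite (le_trans x0 (ltW xt)).
    rewrite -EFin_Rintegral; last 2 first.
    - apply: (locint_itv (b := b) _ (locintZ (p x) iq)) => t /=; rewrite !in_itv/= => /andP[xt ->].
      by rewrite (le_trans x0 xt).
    - exact: mitv.
    rewrite [RHS]integral_mkcond; apply: eq_integral => y _.
    rewrite /p0 /q0 !patchE xb !mem_itv_set !in_itv/=.
    case: (leP x y) => xy /=; last by [].
    by rewrite (le_trans x0 xy)/=; case: ifP => //; rewrite mulr0.
  have := locintD (locintZ (prim q b) ip) (locintZ (-1) (locint_mul_prim ip iq)).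
  by congr locint; apply/funext => t; ring.
have E2 : (\int[leb]_y \int[leb]_x K (x, y) =
    (prim (fun t => q t * prim p t) b)%:E)%E.
  rewrite -prim_patch; last exact: locint_mul_prim.
  apply: eq_integral => y _; rewrite /K/=.
  rewrite patchE; case: ifPn => [|yb]; last first.
    by rewrite /q0 patchE (negbTE yb); under eq_integral do rewrite mulr0 if_same; rewrite integral0.
  move=> /[dup] yb /set_mem/=; rewrite in_itv/= => /andP[y0 yb'].
  rewrite -(RintegralZl _ (mitv _) (ip y)).
  rewrite -EFin_Rintegral; last 2 first.
  - exact: (locintZ (q y) ip).
  - exact: mitv.
  rewrite [RHS]integral_mkcond; apply: eq_integral => x _.
  rewrite /p0 /q0 !patchE yb !mem_itv_set !in_itv/=.
  case: (leP x y) => xy /=; last by rewrite andbF.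
  rewrite (le_trans xy yb') !andbT; case: ifP => _; first by rewrite mulrC.
  by rewrite mul0r.
move: FK; rewrite E1 E2 => -[<-].
have -> : (fun t => p t * (prim q b - prim q t)) = (fun t => prim q b * p t + (- 1) * (p t * prim q t)).
  by apply/funext => t; ring.
rewrite prim_lin//; last exact: locint_mul_prim.
by ring.
Qed.

End primitives.

(** * Integration with respect to the half-line measure *)

Section half_line.
Context (R : realType).
Local Notation leb := (@lebesgue_measure R).
Local Notation mu := (mu_half_line R).
Local Notation mitv := (@lebesgue_measurable_itv R).
Implicit Types (f g v : R -> R) (P : R -> Prop) (x : R).

Lemma half_line_aeS (P Q : R -> Prop) : (forall x, P x -> Q x) ->
  {ae mu, forall x, P x} -> {ae mu, forall x, Q x}.
Proof. by apply: filterS; exact: (ae_filter_ringOfSetsType mu). Qed.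

Lemma half_line_aeS2 (P Q S : R -> Prop) : (forall x, P x -> Q x -> S x) ->
  {ae mu, forall x, P x} -> {ae mu, forall x, Q x} -> {ae mu, forall x, S x}.
Proof. by apply: filterS2; exact: (ae_filter_ringOfSetsType mu). Qed.

Lemma half_line_ae P : {ae mu, forall x, P x} <-> {ae leb, forall x, 0 < x -> P x}.
Proof.
split=> -[A [mA A0 PA]].
  exists (A `&` `]0, +oo[%classic); split; first exact: measurableI.
    exact: A0.
  move=> x /= /not_implyP[x0 Px]; split; first exact: PA.
  by rewrite /= in_itv/= x0.
exists (A `|` ~` `]0, +oo[%classic); split.
- by apply: measurableU => //; apply: measurableC; exact: mitv.
- rewrite /mu_half_line/= /mrestr setIUl (_ : ~` _ `&` _ = set0) ?setU0; last exact: setICl.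
  apply/eqP; rewrite eq_le measure_ge0 andbT -A0; apply: le_measure.
  + by rewrite inE; apply: measurableI => //; exact: mitv.
  + by rewrite inE.
  + exact: subIsetl.
- move=> x /= Px; have [x0|x0] := ltP 0 x.
    by left; apply: PA => /= h; apply/Px/h.
  by right => /=; rewrite in_itv/= andbT; apply/negP; rewrite -leNgt.
Qed.

Lemma half_line_integral (f : R -> \bar R) : measurable_fun setT f ->
  (\int[mu]_x f x = \int[leb]_(x in `]0%R, +oo[) f x)%E.
Proof.
have key (g : R -> \bar R) : measurable_fun setT g -> (forall x, 0 <= g x)%E ->
    (\int[mu]_x g x = \int[leb]_(x in `]0%R, +oo[) g x)%E.
  move=> mg g0.
  have mI := mitv `]0, +oo[.
  rewrite (@ge0_negligible_integral _ _ _ _ _ (~` (`]0, +oo[%classic : set (g_sigma_algebraType R.-ocitv.-measurable))))//; last 2 first.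
  - exact: measurableC.
  - by rewrite /mu_half_line/= /mrestr setICl measure0.
  rewrite setDE setCK setTI; apply: eq_measure_integral => A mA A0.
  by rewrite /mu_half_line/= /mrestr setIidl.
move=> mf; rewrite integralE [RHS]integralE; congr (_ - _)%E.
- by apply: key => //; exact: measurable_funepos.
- by apply: key => //; exact: measurable_funeneg.
Qed.

Lemma half_line_Rintegral f : measurable_fun setT f ->
  \int[mu]_x f x = \int[leb]_(x in `]0, +oo[) f x.
Proof. by move=> mf; rewrite /Rintegral half_line_integral//; exact/measurable_EFinP. Qed.

Lemma half_line_integrable f : mu.-integrable setT (EFin \o f) ->
  leb.-integrable `]0, +oo[ (EFin \o f).
Proof.
move=> /integrableP[mf fi]; apply/integrableP; split; first exact: measurable_funTS.
by rewrite -half_line_integral//; exact: measurableT_comp.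
Qed.

Lemma half_line_locint f : mu.-integrable setT (EFin \o f) -> locint f.
Proof.
move=> fi; have /half_line_integrable/integrableP[mf fy] := fi.
have /integrableP[mfT _] := fi => b.
apply/integrableP; split; first exact: measurable_funTS.
rewrite -integral_itv_obnd_cbnd; last first.
  by apply: measurable_funTS; exact: measurableT_comp.
apply: le_lt_trans fy; apply: ge0_subset_integral => //.
- by apply: measurable_funTS; exact: measurableT_comp.
- by apply: subset_itvl.
Qed.

Lemma Lfun2_locint f : f \in Lfun mu 2%:E -> locint f.
Proof.
move=> fL; have [mf f2] := (Lfun2P mu f).1 fL.
have i2 := half_line_locint f2 => b.
have i1 : leb.-integrable `[0, b] (EFin \o (fun x => 1 + f x ^+ 2)).
  exact: (locintD (locint_cst 1) i2).
apply: le_integrable i1 => //.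
  by apply: measurable_funTS; exact/measurable_EFinP.
move=> x _ /=; rewrite lee_fin [leRHS]ger0_norm ?addr_ge0 ?sqr_ge0//.
have := sqr_ge0 (`|f x| - 1); rewrite sqrrB1 real_normK ?num_real//.
by have := normr_ge0 (f x); lra.
Qed.

Lemma prim_le_integral f (b : R) : mu.-integrable setT (EFin \o f) ->
  (forall x, 0 <= f x) -> prim f b <= \int[mu]_x f x.
Proof.
move=> fi f0; have /integrableP[/measurable_EFinP mf _] := fi.
have fl := half_line_locint fi.
rewrite prim_oc// half_line_Rintegral// /Rintegral fine_le//.
- by apply: integrable_fin_num; [exact: mitv|exact: locint_itv (@subset_oc0 _ b) fl].
- by apply: integrable_fin_num; [exact: mitv|exact: half_line_integrable].
- apply: ge0_subset_integral; [exact: mitv|exact: mitv| |by move=> x _; rewrite lee_fin|exact: subset_itvl].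
  by apply: measurable_funTS; exact/measurable_EFinP.
Qed.

(** From |f| <= N + f^2 / N. When N bounds the L2 norm of f, the right-hand side is at most N (b +
    1), an estimate linear in N that avoids the square root of b. *)
Lemma prim_norm_le f (N b : R) : f \in Lfun mu 2%:E -> 0 < N -> 0 <= b ->
  prim (fun x => `|f x|) b <= N * b + L2_dot mu f f / N.
Proof.
move=> fL N0 b0; have [mf f2] := (Lfun2P mu f).1 fL.
have i2 := half_line_locint f2.
have i1 := @locint_cst R 1.
apply: (@le_trans _ _ (prim (fun x => N * 1 + N^-1 * f x ^+ 2) b)).
  apply: le_prim.
  - by apply: locint_norm; exact: Lfun2_locint.
  - by apply: locintD; exact: locintZ.
  - apply: aeW => x x0 _; rewrite /= mulr1 -(ler_pM2l N0) mulrDr mulrA mulfV ?gt_eqF// mul1r.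
    have := sqr_ge0 (`|f x| - N); rewrite sqrrB real_normK ?num_real//.
    by have := mulr_ge0 (ltW N0) (normr_ge0 (f x)); rewrite -expr2; nra.
rewrite prim_lin//; apply: lerD.
  by rewrite prim_cst// mul1r.
rewrite mulrC ler_pM2r ?invr_gt0//.
have -> : L2_dot mu f f = \int[mu]_x f x ^+ 2 by [].
by apply: prim_le_integral => // x; exact: sqr_ge0.
Qed.

End half_line.

(** * Weak derivatives on the half-line *)

Section weak_derivatives.
Context (R : realType).
Local Notation leb := (@lebesgue_measure R).
Local Notation mu := (mu_half_line R).
Local Notation mitv := (@lebesgue_measurable_itv R).
Implicit Types (phi : R -> R) (u v w : cL2 mu).

Lemma test_function_is_derive phi (x : R) : test_function phi ->
  is_derive x 1 phi ((phi^`())%classic x).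
Proof.
move=> [dphi _]; rewrite derive1E; apply/derivableP.
by have := dphi 0%N x; rewrite derive1n0.
Qed.

Lemma test_function_continuous phi : test_function phi -> continuous phi.
Proof.
move=> [dphi _] x; apply: differentiable_continuous; apply/derivable1_diffP.
by have := dphi 0%N x; rewrite derive1n0.
Qed.

Lemma test_function_derive phi : test_function phi -> test_function (phi^`())%classic.
Proof.
move=> tphi; have [dphi [a [b [a0 phiab]]]] := tphi; split.
  move=> n x; have -> : ((phi^`())^`(n))%classic = (phi^`(n.+1))%classic; last exact: dphi.
  elim: n {x} => [|n IH]; first by rewrite derive1n1 derive1n0.
  by rewrite derive1nS IH -derive1nS.
exists a, b; split=> // x; apply: contraNT; rewrite negb_and -!ltNge => xab.
have d0 : is_derive x 1 phi 0.
  apply: (@near_eq_is_derive _ _ _ (cst 0)).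
  have z y : ~~ (a <= y <= b) -> 0 = phi y.
    by move=> yab; apply/esym/eqP; apply: contraNT yab; exact: phiab.
  case/orP: xab => [xa|bx].
    near=> y; apply: z; rewrite negb_and -!ltNge; apply/orP; left.
    by near: y; exact: lt_nbhsl.
  near=> y; apply: z; rewrite negb_and -!ltNge; apply/orP; right.
  by near: y; exact: lt_nbhsr.
by rewrite derive1E (@derive_val _ _ _ _ _ _ _ d0).
Unshelve. all: by end_near. Qed.

Lemma test_function_support phi : test_function phi ->
  exists2 b, 0 < b & forall x, x <= 0 \/ b <= x -> phi x = 0.
Proof.
(* [b] may lie below [a] when [phi] is 0, hence the maximum; adding 1 makes [phi] vanish at the new
   endpoint itself. *)
move=> [_ [a [b [a0 phiab]]]]; exists (Num.max a b + 1).
  by rewrite ltr_wpDl// le_max ltW.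
move=> x x_out; apply/eqP; apply: contrapT => /negP /phiab /andP[ax xb].
case: x_out => [x0|]; first by move: (lt_le_trans a0 ax); rewrite ltNge x0.
by apply/negP; rewrite -ltNge (le_lt_trans xb)// ltr_pwDr// le_max lexx orbT.
Qed.

Lemma test_function_bounded phi b : test_function phi ->
  exists C, forall x, 0 <= x -> x <= b -> `|phi x| <= C.
Proof.
move=> tphi; have [b0|b0] := leP 0 b; last first.
  by exists 0 => x x0 xb; move: (le_lt_trans (le_trans x0 xb) b0); rewrite ltxx.
have c : {within `[0, b], continuous (fun x => `|phi x|)}.
  apply: continuous_subspaceT => x; apply: continuous_comp; first exact: test_function_continuous.
  exact: norm_continuous.
have [z _ zP] := EVT_max b0 c; exists `|phi z| => x x0 xb.
by apply: zP; rewrite in_itv/= x0.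
Qed.

Lemma locint_mul_test (f : R -> R) phi : locint f -> test_function phi ->
  locint (fun x => f x * phi x).
Proof.
move=> fi tphi; apply: locint_mul => // b; last exact: test_function_bounded.
apply: measurable_funTS; apply: continuous_measurable_fun.
exact: test_function_continuous.
Qed.

Lemma test_function_locint phi : test_function phi -> locint phi.
Proof.
move=> tphi; have := locint_mul_test (locint_cst 1) tphi.
by congr locint; apply/funext => x; rewrite mul1r.
Qed.

Lemma prim_derive_test phi x : test_function phi -> 0 <= x ->
  prim (phi^`())%classic x = phi x.
Proof.
move=> tphi; have [b b0 phi0] := test_function_support tphi.
have p00 : phi 0 = 0 by apply: phi0; left.
rewrite le_eqVlt => /predU1P[<-|x0]; first by rewrite prim0 p00.
have tphi' := test_function_derive tphi.
have := @continuous_FTC2 _ (phi^`())%classic phi 0 x x0.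
rewrite p00 sube0 /prim /Rintegral => -> //.
- by apply: continuous_subspaceT; exact: test_function_continuous.
- split; first by move=> y _; case: (test_function_is_derive y tphi).
  + by apply: cvg_at_right_filter; exact: test_function_continuous.
  + by apply: cvg_at_left_filter; exact: test_function_continuous.
Qed.

Lemma test_integral (f : R -> R) phi b : locint f -> test_function phi ->
  (forall x, x <= 0 \/ b <= x -> phi x = 0) ->
  \int[leb]_(x in `]0, +oo[) (f x * phi x) = prim (fun x => f x * phi x) b.
Proof.
move=> fi tphi phi0; rewrite prim_oc; last exact: locint_mul_test.
apply: Rintegral_support.
  by move=> x /=; rewrite !in_itv/= andbT => /andP[].
move=> x /=; rewrite !in_itv/= andbT => x0; rewrite x0/= => /negP.
by rewrite -ltNge => bx; rewrite phi0 ?mulr0//; right; exact: ltW.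
Qed.

Lemma half_line_test (f : R -> R) phi b : f \in Lfun mu 2%:E -> test_function phi ->
  (forall x, x <= 0 \/ b <= x -> phi x = 0) ->
  \int[mu]_x (f x * phi x) = prim (fun x => f x * phi x) b.
Proof.
move=> fL tphi phi0; rewrite half_line_Rintegral.
  by apply: test_integral => //; exact: Lfun2_locint.
apply: measurable_funM; first exact: measurable_Lfun fL.
by apply: continuous_measurable_fun; exact: test_function_continuous.
Qed.

Lemma weak_derivative_real u v : is_weak_derivative u v ->
  forall phi, test_function phi ->
  (\int[mu]_x (cL2_re u x * (phi^`())%classic x) = - \int[mu]_x (cL2_re v x * phi x)) /\
  (\int[mu]_x (cL2_im u x * (phi^`())%classic x) = - \int[mu]_x (cL2_im v x * phi x)).
Proof.
move=> uv phi /uv; rewrite /cintegral => -[].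
have reE (z : R[i]) (r : R) : Re (z * r%:C) = Re z * r by case: z => a b /=; rewrite mulr0 subr0.
have imE (z : R[i]) (r : R) : Im (z * r%:C) = Im z * r by case: z => a b /=; rewrite mulr0 add0r.
have reI w (psi : R -> R) : \int[mu]_x Re (cL2_fun w x * (psi x)%:C) = \int[mu]_x (cL2_re w x * psi x).
  by apply: eq_Rintegral => x _; exact: reE.
have imI w (psi : R -> R) : \int[mu]_x Im (cL2_fun w x * (psi x)%:C) = \int[mu]_x (cL2_im w x * psi x).
  by apply: eq_Rintegral => x _; exact: imE.
by rewrite (reI u (phi^`())%classic) (reI v phi) (imI u (phi^`())%classic) (imI v phi).
Qed.

(** Integration by parts, with no boundary term as phi vanishes at both ends, shows that f - prim g
    is orthogonal to all derivatives of test functions. The du Bois-Reymond lemma then makes it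
    constant. *)
Lemma weak_primitive (f g : R -> R) : f \in Lfun mu 2%:E -> g \in Lfun mu 2%:E ->
  (forall phi, test_function phi ->
    \int[mu]_x (f x * (phi^`())%classic x) = - \int[mu]_x (g x * phi x)) ->
  exists c, {ae leb, forall x, 0 < x -> f x = c + prim g x}.
Proof.
move=> fL gL fg; have fi := Lfun2_locint fL; have gi := Lfun2_locint gL.
have pgi : locint (prim g).
  have := locint_mul_prim (locint_cst 1) gi.
  by congr locint; apply/funext => x; rewrite mul1r.
pose U x := 1 * f x + (- 1) * prim g x.
have Ui : locint U by apply: locintD; exact: locintZ.
have [phi tphi|c Uc] := du_bois_reymond Ui; last first.
  exists c; apply: lebesgue_aeS Uc => x xc x0.
  by rewrite -(xc x0) /U; ring.
have tphi' := test_function_derive tphi.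
have [b b0 phib] := test_function_support tphi.
have [b' b'0 phib'] := test_function_support tphi'.
pose B := Num.max b b'.
have B0 : 0 < B by rewrite lt_max b0.
have phiB x : x <= 0 \/ B <= x -> phi x = 0.
  by case=> [x0|]; [by apply: phib; left|rewrite ge_max => /andP[bx _]; apply: phib; right].
have phiB' x : x <= 0 \/ B <= x -> (phi^`())%classic x = 0.
  by case=> [x0|]; [by apply: phib'; left|rewrite ge_max => /andP[_ bx]; apply: phib'; right].
rewrite (test_integral Ui tphi' phiB').
have fE := fg _ tphi; rewrite (half_line_test fL tphi' phiB') (half_line_test gL tphi phiB) in fE.
have -> : (fun x => U x * (phi^`())%classic x) =
    (fun x => 1 * (f x * (phi^`())%classic x) + (- 1) * (prim g x * (phi^`())%classic x)).
  by apply/funext => x; rewrite /U; ring.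
rewrite prim_lin; [|exact: locint_mul_test|exact: locint_mul_test].
rewrite fE; have := prim_mul gi (test_function_locint tphi') (ltW B0).
rewrite (prim_derive_test tphi (ltW B0)) phiB; last by right.
have -> : prim (fun t => g t * prim (phi^`())%classic t) B = prim (fun x => g x * phi x) B.
  apply: eq_Rintegral => x; rewrite inE/= in_itv/= => /andP[x0 _].
  by rewrite (prim_derive_test tphi x0).
under [X in prim X B + _ = _ -> _]eq_fun do rewrite mulrC.
by rewrite mulr0 => /eqP; rewrite addr_eq0 => /eqP ->; ring.
Qed.

Lemma bump_test_function (a b : R) n : 0 < a -> test_function (bump a b n).
Proof.
move=> a0; split; first exact: smooth_bump_derivable (bump_smooth a b n).
by exists a, b; split=> // x /bump_support/andP[h1 h2]; rewrite !ltW.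
Qed.

(** Derivatives of test functions are test functions, so g - g' is a constant by the du Bois-Reymond
    lemma. Bumps converging to the indicator of ]1, 2[ show that the constant is 0. *)
Lemma test_functions_separate (g g' : R -> R) : g \in Lfun mu 2%:E -> g' \in Lfun mu 2%:E ->
  (forall phi, test_function phi -> \int[mu]_x (g x * phi x) = \int[mu]_x (g' x * phi x)) ->
  {ae mu, forall x, g x = g' x}.
Proof.
move=> gL gL' gg'; have gi := Lfun2_locint gL; have gi' := Lfun2_locint gL'.
pose h x := 1 * g x + (- 1) * g' x.
have hi : locint h by apply: locintD; exact: locintZ.
have h0 phi b : test_function phi -> (forall x, x <= 0 \/ b <= x -> phi x = 0) ->
    prim (fun x => h x * phi x) b = 0.
  move=> tphi phib; have := gg' _ tphi.
  rewrite (half_line_test gL tphi phib) (half_line_test gL' tphi phib) => E.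
  have -> : (fun x => h x * phi x) = (fun x => 1 * (g x * phi x) + (- 1) * (g' x * phi x)).
    by apply/funext => x; rewrite /h; ring.
  rewrite prim_lin; [|exact: locint_mul_test|exact: locint_mul_test].
  by rewrite E; ring.
have [phi tphi|c hc] := du_bois_reymond hi.
  have tphi' := test_function_derive tphi.
  have [b b0 phib] := test_function_support tphi'.
  by rewrite (test_integral hi tphi' phib) h0.
have c0 : c = 0.
  have i12 : (0 : R) <= 1 by exact: ler01.
  have := bump_dominated i12 (lexx 2) (locint_cst c 2).
  have bs n x : x <= 0 \/ 2 <= x -> bump (1 : R) 2 n x = 0.
    move=> x12; apply/eqP; apply: contrapT => /negP/bump_support/andP[x1 x2].
    by case: x12; apply/negP; rewrite -ltNge// (lt_trans _ x1).
  rewrite (_ : (fun n => _) = cst 0); last first.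
    apply/funext => n /=; have tb := @bump_test_function 1 2 n ltr01.
    rewrite -[RHS](h0 _ 2 tb (bs n)); apply: ae_eq_prim.
    - exact: (locint_mul_test (locint_cst c)).
    - exact: locint_mul_test.
    - by apply: lebesgue_aeS hc => t /[swap] t0 /(_ t0) <- _.
  move=> /(cvg_unique _ (cvg_cst 0)) => /(_ (@norm_hausdorff _ _)).
  rewrite Rintegral_cst// [X in fine X](lebesgue_measure_itv `]1, 2[) /= lte_fin ltr1n/=.
  by move=> ->; ring.
apply/half_line_ae; apply: lebesgue_aeS hc => x xc x0.
by have := xc x0; rewrite c0 /h => /eqP; rewrite mul1r mulN1r subr_eq0 => /eqP.
Qed.

Lemma weak_derivative_unique u v w : is_weak_derivative u v -> is_weak_derivative u w -> v = w.
Proof.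
move=> /weak_derivative_real uv /weak_derivative_real uw; apply: cL2_eqP.
  apply: (test_functions_separate (cL2_reL v) (cL2_reL w)) => phi tphi.
  by apply: oppr_inj; rewrite -(uv _ tphi).1 (uw _ tphi).1.
apply: (test_functions_separate (cL2_imL v) (cL2_imL w)) => phi tphi.
by apply: oppr_inj; rewrite -(uv _ tphi).2 (uw _ tphi).2.
Qed.

Lemma sobolev_H2_weak_derivative u : sobolev_H2 u ->
  is_weak_derivative u (weak_derivative u) /\
  is_weak_derivative (weak_derivative u) (weak_derivative (weak_derivative u)).
Proof.
move=> [v [w [uv vw]]].
have wd (x y : cL2 mu) : is_weak_derivative x y -> weak_derivative x = y.
  by move=> xy; apply: (@weak_derivative_unique x) => //; apply: xgetPex; exists y.
by rewrite (wd _ _ uv) (wd _ _ vw).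
Qed.

End weak_derivatives.

(** * Boundary terms and the energy identity *)

Section absorption.
Context (R : realType).
Local Notation leb := (@lebesgue_measure R).
Local Notation mu := (mu_half_line R).
Local Notation mitv := (@lebesgue_measurable_itv R).
Implicit Types (f g v w : R -> R) (P Q : R -> Prop) (x y : R).

Lemma ae_exists_itv P (a b : R) : a < b -> {ae leb, forall x, P x} ->
  exists2 x, a < x < b & P x.
Proof.
move=> ab [A [mA A0 PA]]; apply: contrapT => noP.
have : (leb `]a, b[%classic <= leb A)%E.
  apply: le_measure; rewrite ?inE//.
  move=> x /=; rewrite in_itv/= => xab; apply: PA => /= Px.
  by apply: noP; exists x.
rewrite A0 [X in (X <= _)%E](lebesgue_measure_itv `]a, b[) /= lte_fin ab.
by rewrite -EFinD lee_fin leNgt subr_gt0 ab.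
Qed.

Lemma prim_continuous_at v x : locint v -> 0 < x -> {for x, continuous (prim v)}.
Proof.
move=> iv x0; have x10 : 0 < x + 1 by rewrite ltr_wpDr.
have [c _ _] := (continuous_within_itvP _ x10).1 (prim_continuous (ltW x10) iv).
by have := c x; rewrite in_itv/= x0 ltrDl ltr01 => /(_ isT).
Qed.

Lemma prim_cvg0 v : locint v -> prim v x @[x --> 0^'+] --> (0 : R).
Proof.
move=> iv; have [_ c _] := (continuous_within_itvP _ ltr01).1 (prim_continuous ler01 iv).
by rewrite prim0 in c.
Qed.

(** The two sides agree only almost everywhere, but different limits at 0 would make them differ on
    a whole interval ]0, d[. *)
Lemma primitive_boundary f v (c : R) : locint v -> f x @[x --> 0^'+] --> f 0 ->
  {ae leb, forall x, 0 < x -> f x = c + prim v x} -> f 0 = c.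
Proof.
move=> iv fc fE; apply/eqP; apply: contrapT => /negP fc0.
have h : f x - (c + prim v x) @[x --> 0^'+] --> f 0 - (c + 0).
  by apply: cvgB => //; apply: cvgD; [exact: cvg_cst|exact: prim_cvg0].
have d0 : f 0 - (c + 0) != 0 by rewrite addr0 subr_eq0.
have := cvgr_neq0 _ h d0 => -[d /= d_gt0 dP].
have [x /andP[x0 xd] xP] := ae_exists_itv d_gt0 fE.
have := dP x; rewrite /ball/= sub0r normrN gtr0_norm// => /(_ xd x0).
by rewrite (xP x0) subrr eqxx.
Qed.

Lemma complex_cvg_Re_Im (F : R -> R[i]^o) : F x @[x --> 0^'+] --> F 0 ->
  Re (F x) @[x --> 0^'+] --> Re (F 0) /\ Im (F x) @[x --> 0^'+] --> Im (F 0).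
Proof.
move=> Fc; split; apply/cvgrPdist_lt => e e0.
  have e0' : 0 < e%:C by rewrite ltcR.
  move/cvgrPdist_lt : Fc => /(_ _ e0'); apply: filterS => x.
  rewrite -ltcR; apply: le_lt_trans; apply: le_trans (normc_ge_Re _).
  by case: (F 0) => ? ?; case: (F x).
have e0' : 0 < e%:C by rewrite ltcR.
move/cvgrPdist_lt : Fc => /(_ _ e0'); apply: filterS => x.
rewrite -ltcR; apply: le_lt_trans.
have -> : `|F 0 - F x| = `|'i * (F 0 - F x)| :> R[i] by rewrite normrM normCi mul1r.
apply: le_trans (normc_ge_Re _).
case: (F 0) => ? ?; case: (F x) => ? ? /=.
by rewrite lecR mul0r mul1r sub0r normrN.
Qed.

Lemma boundary_value_primitive (u : cL2 mu) c vr vi (cr ci : R) : boundary_value u c ->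
  locint vr -> locint vi ->
  {ae leb, forall x, 0 < x -> cL2_re u x = cr + prim vr x} ->
  {ae leb, forall x, 0 < x -> cL2_im u x = ci + prim vi x} ->
  c = cr +i* ci.
Proof.
move=> [F [Fc /half_line_ae uF <-]] ivr ivi ur ui.
have [rF iF] := complex_cvg_Re_Im ((continuous_within_itvcyP _ _).1 Fc).2.
have rE : {ae leb, forall x, 0 < x -> Re (F x) = cr + prim vr x}.
  by apply: lebesgue_aeS2 ur uF => x ux Fx x0; rewrite -ux// -Fx.
have iE : {ae leb, forall x, 0 < x -> Im (F x) = ci + prim vi x}.
  by apply: lebesgue_aeS2 ui uF => x ux Fx x0; rewrite -ux// -Fx.
have := primitive_boundary ivr rF rE; have := primitive_boundary ivi iF iE.
by case: (F 0) => a b /= -> ->.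
Qed.

(** The endpoints are arbitrary beyond n, because [energy_eq0] has to place them where the Wronskian
    is small. *)
Lemma prim_cvg f (X : nat -> R) : mu.-integrable setT (EFin \o f) ->
  (forall n, n%:R <= X n) -> prim f (X n) @[n --> \oo] --> \int[mu]_x f x.
Proof.
move=> fi nX; have /integrableP[/measurable_EFinP mf _] := fi.
have fi0 := half_line_integrable fi; have fl := half_line_locint fi.
rewrite half_line_Rintegral//.
have mI := mitv `]0, +oo[.
have primE n : prim f (X n) = \int[leb]_(x in `]0, +oo[) (f x * \1_`]0, X n]%classic x).
  rewrite prim_oc// (@Rintegral_support _ `]0, X n]%classic `]0, +oo[%classic).
  - by apply: eq_Rintegral => x xX; rewrite indicE xX mulr1.
  - exact: subset_itvl.
  - by move=> x _ xX; rewrite indicE memNset ?mulr0.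
have mfi n : measurable_fun (`]0, +oo[%classic : set (g_sigma_algebraType R.-ocitv.-measurable)) (fun x => (f x * \1_`]0, X n]%classic x)%:E).
  apply/measurable_EFinP; apply: measurable_funM; first exact: measurable_funTS.
  by apply: measurable_indic; exact: mitv.
have mf0 : measurable_fun (`]0, +oo[%classic : set (g_sigma_algebraType R.-ocitv.-measurable)) (EFin \o f).
  by apply: measurable_funTS; exact/measurable_EFinP.
have [] := @dominated_convergence _ _ R leb `]0, +oo[%classic mI
  (fun n x => (f x * \1_`]0, X n]%classic x)%:E) (EFin \o f)
  (fun x => `|f x|%:E) mfi mf0.
- apply: aeW => x /=; rewrite in_itv/= andbT => x0.
  apply: cvg_near_cst; exists (Num.truncn x).+1 => // n /= xn.
  rewrite indicE mem_set ?mulr1//= in_itv/= x0/=.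
  apply: le_trans (nX n); apply: le_trans (ltW (truncnS_gt x)) _.
  by rewrite ler_nat.
- exact: (@integrable_abse _ _ R leb _ (EFin \o f)).
- apply: aeW => x n _; rewrite lee_fin normrM ler_piMr// indicE.
  by case: (_ \in _); rewrite /= ?normr1 ?normr0.
- move=> I1 _ I2; rewrite (_ : (fun n => _) = fun n => \int[leb]_(x in `]0, +oo[) (f x * \1_`]0, X n]%classic x)).
    by rewrite /Rintegral; apply: fine_cvg; rewrite fineK ?integrable_fin_num//; exact: I2.
  by apply/funext => n; exact: primE.
Qed.

Lemma prim_parts f v1 v2 w2 (a b2 X : R) : locint v1 -> locint v2 -> locint w2 ->
  locint (fun x => f x * w2 x) -> locint (fun x => v1 x * v2 x) ->
  {ae leb, forall x, 0 < x -> f x = a + prim v1 x} ->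
  {ae leb, forall x, 0 < x -> v2 x = b2 + prim w2 x} -> 0 <= X ->
  prim (fun x => f x * w2 x) X =
  (a + prim v1 X) * (b2 + prim w2 X) - a * b2 - prim (fun x => v1 x * v2 x) X.
Proof.
move=> iv1 iv2 iw2 ifw ivv fE vE X0.
have iw2v1 := locint_mul_prim iw2 iv1; have iv1w2 := locint_mul_prim iv1 iw2.
have -> : prim (fun x => f x * w2 x) X = prim (fun x => a * w2 x + 1 * (w2 x * prim v1 x)) X.
  apply: ae_eq_prim => //; first by apply: locintD; exact: locintZ.
  by apply: lebesgue_aeS fE => x xE x0 _; rewrite (xE x0); ring.
have -> : prim (fun x => v1 x * v2 x) X = prim (fun x => b2 * v1 x + 1 * (v1 x * prim w2 x)) X.
  apply: ae_eq_prim => //; first by apply: locintD; exact: locintZ.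
  by apply: lebesgue_aeS vE => x xE x0 _; rewrite (xE x0); ring.
rewrite !prim_lin//; have := prim_mul iv1 iw2 X0.
move: (prim _ X) (prim _ X) => A B.
by move=> h; apply/eqP; rewrite -subr_eq0; apply/eqP; move: h; lra.
Qed.

(** For u = f + i g with derivatives v1 + i v2 and w1 + i w2, and h = Im (conj u A u), the function
    shown to vanish is V_I |u|^2. Integrated over [0, X] it equals the integral of h plus the
    Wronskian Im (conj u u') at X, the one at 0 being 0 by a1 b2 = a2 b1. Along a suitable sequence
    of X the limit is at most 0, and the function is nonnegative. *)
Lemma energy_eq0 (f g v1 v2 w1 w2 h : R -> R) (a1 a2 b1 b2 : R) :
  f \in Lfun mu 2%:E -> g \in Lfun mu 2%:E -> v1 \in Lfun mu 2%:E ->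
  v2 \in Lfun mu 2%:E -> w1 \in Lfun mu 2%:E -> w2 \in Lfun mu 2%:E ->
  {ae leb, forall x, 0 < x -> f x = a1 + prim v1 x} ->
  {ae leb, forall x, 0 < x -> g x = a2 + prim v2 x} ->
  {ae leb, forall x, 0 < x -> v1 x = b1 + prim w1 x} ->
  {ae leb, forall x, 0 < x -> v2 x = b2 + prim w2 x} ->
  a1 * b2 = a2 * b1 ->
  mu.-integrable setT (EFin \o h) -> \int[mu]_x h x = 0 ->
  {ae mu, forall x, 0 <= h x + (f x * w2 x - g x * w1 x)} ->
  {ae mu, forall x, h x + (f x * w2 x - g x * w1 x) = 0}.
Proof.
move=> fL gL v1L v2L w1L w2L fE gE v1E v2E bc hi h0 k0.
have iv1 := Lfun2_locint v1L; have iv2 := Lfun2_locint v2L.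
have iw1 := Lfun2_locint w1L; have iw2 := Lfun2_locint w2L.
have ifw := Lfun2_mul fL w2L; have igw := Lfun2_mul gL w1L.
have ifv := Lfun2_mul fL v2L; have igv := Lfun2_mul gL v1L.
have lfw := half_line_locint ifw; have lgw := half_line_locint igw.
have lvv := half_line_locint (Lfun2_mul v1L v2L).
have lvv' := half_line_locint (Lfun2_mul v2L v1L).
have lh := half_line_locint hi.
pose q x := 1 * (f x * w2 x) + (- 1) * (g x * w1 x).
pose k x := h x + q x.
have iq : mu.-integrable setT (EFin \o q).
  exact: integrable_lin.
have ik : mu.-integrable setT (EFin \o k).
  exact: (integrableD measurableT hi iq).
have kE x : h x + (f x * w2 x - g x * w1 x) = k x by rewrite /k /q; ring.
have {}k0 : {ae mu, forall x, 0 <= k x}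
  by move: k0; apply: half_line_aeS => x; rewrite kE.
suff : {ae mu, forall x, k x = 0} by apply: half_line_aeS => x; rewrite kE.
pose D X := (a1 + prim v1 X) * (b2 + prim w2 X) - (a2 + prim v2 X) * (b1 + prim w1 X).
have primk X : 0 <= X -> prim k X = prim h X + D X.
  move=> X0; have -> : prim k X = prim (fun x => 1 * h x + 1 * q x) X.
    by congr (prim _ X); apply/funext => x; rewrite /k !mul1r.
  rewrite prim_lin//; last exact: half_line_locint iq.
  rewrite !mul1r prim_lin// (prim_parts iv1 iv2 iw2 lfw lvv fE v2E X0).
  rewrite (prim_parts iv2 iv1 iw1 lgw lvv' gE v1E X0).
  have -> : prim (fun x => v2 x * v1 x) X = prim (fun x => v1 x * v2 x) X.
    by congr (prim _ X); apply/funext => x; rewrite mulrC.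
  by rewrite /D bc; ring.
(* The Wronskian [D] is a.e. equal to an integrable function, so it cannot stay
   above a positive constant. *)
have XE (n : nat) : exists Y : R, n%:R <= Y /\ D Y < n.+1%:R^-1.
  apply: contrapT => noX.
  have DX X : n%:R <= X -> n.+1%:R^-1 <= D X.
    by move=> nX; rewrite leNgt; apply/negP => DX; apply: noX; exists X.
  pose dd x := 1 * (f x * v2 x) + (- 1) * (g x * v1 x).
  have idd : mu.-integrable setT (EFin \o dd).
    exact: integrable_lin.
  have ddE : {ae leb, forall x, 0 < x -> dd x = D x}.
    apply: lebesgue_aeS2 (lebesgue_aeS2 _ fE v2E) (lebesgue_aeS2 _ gE v1E) => x; first last.
    - by move=> xg xv; exact: (conj xg xv).
    - by move=> xf xv; exact: (conj xf xv).
    - by move=> [xf xv2] [xg xv1] x0; rewrite /dd xf// xv2// xg// xv1// /D; ring.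
  have /integrableP[mdd ddy] := half_line_integrable idd.
  have n0 : (0 : R) <= n%:R by [].
  have sub : `]n%:R, +oo[%classic `<=` `]0 : R, +oo[%classic.
    by move=> x /=; rewrite !in_itv/= !andbT; exact: le_lt_trans.
  have : (\int[leb]_(x in `]n%:R, +oo[) (n.+1%:R^-1)%:E <= \int[leb]_(x in `]0%R, +oo[) `|(EFin \o dd) x|)%E.
    apply: (@le_trans _ _ (\int[leb]_(x in `]n%:R, +oo[) `|(EFin \o dd) x|)%E).
      apply: ae_ge0_le_integral => //.
      - by apply: measurableT_comp => //; apply: measurable_funS mdd => //; exact: mitv.
      - apply: lebesgue_aeS ddE => x xE; rewrite /= in_itv/= andbT => nx.
        rewrite lee_fin xE ?(le_lt_trans n0)//.
        by apply: le_trans (ler_norm _); apply: DX; exact: ltW.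
    apply: ge0_subset_integral => //.
    exact: measurableT_comp.
  rewrite integral_cst; last exact: mitv.
  rewrite [X in (_ * X)%E](lebesgue_measure_itv `]n%:R, +oo[) /= ltry addye//.
  rewrite gt0_muley ?lte_fin ?invr_gt0// => /le_lt_trans /(_ ddy).
  by rewrite ltxx.
have [X XP] := choice XE.
have kle : \int[mu]_x k x <= 0.
  have X1 n := (XP n).1.
  have c1 := prim_cvg ik X1; have c2 := prim_cvg hi X1.
  have c3 : prim h (X n) + n.+1%:R^-1 @[n --> \oo] --> \int[mu]_x h x + 0.
    by apply: cvgD c2 _; exact: cvg_harmonic.
  rewrite h0 addr0 in c3; apply: (ler_cvg_to c1 c3); apply: nearW => n.
  rewrite primk; last by apply: le_trans (X1 n).
  by rewrite lerD2l ltW// (XP n).2.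
have mk : measurable_fun setT (EFin \o k) by case/integrableP : ik.
have kge : 0 <= \int[mu]_x k x.
  have -> : \int[mu]_x k x = \int[mu]_x `|k x|.
    apply: ae_eq_Rintegral; [exact/measurable_EFinP| |].
      by apply: measurableT_comp => //; exact/measurable_EFinP.
    by apply: half_line_aeS k0 => x kx; rewrite ger0_norm.
  exact: Rintegral_ge0.
have [+ _] := ae_eq_integral_abs mu measurableT mk.
have -> : (\int[mu]_x `|(EFin \o k) x| = 0)%E.
  have -> : (\int[mu]_x `|(EFin \o k) x| = \int[mu]_x (k x)%:E)%E.
    apply: ae_eq_integral => //; first exact: measurableT_comp.
    by apply: half_line_aeS k0 => x kx _; rewrite /= ger0_norm.
  rewrite -(fineK (integrable_fin_num measurableT ik)); congr EFin.
  by apply/eqP; rewrite eq_le kle kge.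
by move=> /(_ erefl); apply: half_line_aeS => x /(_ I) [].
Qed.

Lemma is_derive_prim v (b : R) w x : locint v -> locint w ->
  {ae leb, forall x, 0 < x -> v x = b + prim w x} -> 0 < x ->
  is_derive x 1 (prim v) (b + prim w x).
Proof.
move=> iv iw vE x0; pose W y := b + prim w y.
have iW : locint W.
  apply: (locintD (locint_cst b)); have := locint_mul_prim (locint_cst 1) iw.
  by congr locint; apply/funext => y; rewrite mul1r.
have -> : prim v = prim W.
  by apply/funext => y; apply: ae_eq_prim => //; apply: lebesgue_aeS vE => t vt t0 _; exact: vt.
have x1 : x < x + 1 by rewrite ltrDl.
have l0 : (0%:E < x%:E)%E by rewrite lte_fin.
have cW : {for x, continuous W}.
  by apply: cvgD; [exact: cvg_cst|exact: prim_continuous_at].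
have [d1 d2] := @continuous_FTC1 _ W (BLeft 0) x (x + 1) x1 (iW _) l0 cW.
rewrite derive1E in d2; exact: (DeriveDef d1 d2).
Qed.

Lemma cauchy_data_eq0 v w (a b x0 : R) : locint v -> locint w ->
  {ae leb, forall x, 0 < x -> v x = b + prim w x} -> 0 < x0 ->
  (forall d, 0 < d -> exists y, [/\ `|y - x0| < d, y != x0, 0 < y & a + prim v y = 0]) ->
  a + prim v x0 = 0 /\ b + prim w x0 = 0.
Proof.
move=> iv iw vE x00 acc.
have cF : {for x0, continuous (fun y => a + prim v y)}.
  by apply: cvgD; [exact: cvg_cst|exact: prim_continuous_at].
have cW : {for x0, continuous (fun y => b + prim w y)}.
  by apply: cvgD; [exact: cvg_cst|exact: prim_continuous_at].
have F0 : a + prim v x0 = 0.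
  apply/eqP; apply: contrapT => /negP F0.
  have [d /= d0 dP] := cvgr_neq0 _ cF F0; have [y [yd _ _ y0]] := acc d d0.
  by have := dP y; rewrite /= distrC => /(_ yd); rewrite y0 eqxx.
split=> //; apply/eqP; apply: contrapT => /negP W0.
have [d /= d0 dP] := cvgr_neq0 _ cW W0; have [y [yd yx0 y0 Fy]] := acc d d0.
have dF (z : R) : 0 < z -> is_derive z 1 (fun y => a + prim v y) (b + prim w z).
  move=> z0; have := is_deriveD (is_derive_cst a z 1) (is_derive_prim iv iw vE z0).
  by rewrite add0r.
have rolle (c e : R) : 0 < c -> c < e -> a + prim v c = a + prim v e ->
    exists2 z, c < z < e & b + prim w z = 0.
  move=> c0 ce Fce.
  have [||z] := @Rolle _ (fun y => a + prim v y) c e ce _ _ Fce.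
  - by move=> z; rewrite in_itv/= => /andP[cz _]; case: (dF z (lt_trans c0 cz)).
  - apply: derivable_within_continuous => z; rewrite in_itv/= => /andP[cz _].
    by case: (dF z (lt_le_trans c0 cz)).
  - rewrite in_itv/= => /[dup] cze /andP[cz _] dz; exists z => //.
    by have := dF z (lt_trans c0 cz) => dz'; rewrite -(@derive_val _ _ _ _ _ _ _ dz') (@derive_val _ _ _ _ _ _ _ dz).
have [z zP Wz] : exists2 z, `|z - x0| < d & b + prim w z = 0.
  move: yd; rewrite ltr_distl => /andP[yd1 yd2].
  have [yx|xy|yx] := ltgtP y x0; last by rewrite yx eqxx in yx0.
    have [|z /andP[z1 z2] Wz] := rolle y x0 y0 yx; first by rewrite F0 Fy.
    by exists z => //; rewrite ltr_distl (lt_trans yd1 z1)/= (lt_trans z2)// ltrDl.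
  have [|z /andP[z1 z2] Wz] := rolle x0 y x00 xy; first by rewrite F0 Fy.
  by exists z => //; rewrite ltr_distl (lt_trans z2 yd2) andbT (lt_trans _ z1)// ltrBlDr ltrDl.
by have := dP z; rewrite /= distrC => /(_ zP); rewrite Wz eqxx.
Qed.

(** [x0] comes before [Q], so one point works for all full-measure sets, which vary with the element
    of D(B). If A and Q had no common point near x0 except x0, the density of A at x0 would be 0 and
    not 1. *)
Lemma accumulation_point (A : set (g_sigma_algebraType R.-ocitv.-measurable)) :
  measurable A -> ~ {ae leb, forall x, ~ A x} ->
  exists2 x0 : R, A x0 & forall Q : R -> Prop, {ae leb, forall x, Q x} ->
    forall d, 0 < d -> exists y : R, [/\ `|y - x0| < d, y != x0, A y & Q y].
Proof.
move=> mA A0; apply: contrapT => noacc; apply: A0.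
apply: lebesgue_aeS (lebesgue_density mA) => x0 dens Ax0.
apply: noacc; exists x0 => // Q [N [mN N0 QN]] d d0.
apply: contrapT => noy.
have null r : 0 < r -> r < d -> leb (A `&` ball x0 r) = 0.
  move=> r0 rd.
  have nN : leb.-negligible (N `|` [set x0]).
    apply: negligibleU; first by exists N; split.
    by exists [set x0]; split=> //; exact: lebesgue_measure_set1.
  have mAr : measurable (A `&` ball x0 r).
    by apply: measurableI => //; exact: measurable_ball.
  apply: measure_negligible => //; apply: negligibleS nN => y [Ay yr].
  apply: contrapT => /not_orP[Ny yx0]; apply: noy; exists y; split=> //.
  - by move: yr; rewrite /ball/= distrC => /lt_trans; apply.
  - exact/eqP.
  - by apply: contrapT => Qy; apply: Ny; exact: QN.
have : (leb (A `&` ball x0 r) / leb (ball x0 r))%E @[r --> 0^'+] --> 0%E.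
  apply: cvg_near_cst; near=> r; rewrite null ?mul0e//.
move=> /(cvg_unique _ dens) => /(_ (@ereal_hausdorff _)).
by rewrite indicE mem_set// => -[/eqP]; rewrite oner_eq0.
Unshelve. all: by end_near.
Qed.

End absorption.

(** * Growth away from a point of zero Cauchy data *)

Section growth.
Context (R : realType).
Local Notation leb := (@lebesgue_measure R).
Local Notation mu := (mu_half_line R).
Local Notation mitv := (@lebesgue_measurable_itv R).
Implicit Types (f g v w : R -> R) (x y : R).

Lemma integral_expR (c x0 a b : R) : c != 0 -> a <= b ->
  \int[leb]_(s in `]a, b]) expR (c * (s - x0)) =
  (expR (c * (b - x0)) - expR (c * (a - x0))) / c.
Proof.
move=> c0; rewrite le_eqVlt => /predU1P[->|ab].
  by rewrite set_itv_ge ?bnd_simp ?ltxx// Rintegral_set0 subrr mul0r.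
pose e s := expR (c * (s - x0)).
have dl (s : R) : is_derive s 1 (fun y => c * (y - x0)) c.
  have := is_deriveZ c (is_deriveB (is_derive_id s (1 : R)) (is_derive_cst x0 s 1)).
  by rewrite subr0 /GRing.scale/= mulr1.
have de (s : R) : is_derive s 1 e (c * e s).
  have := @is_derive1_comp _ expR (fun y => c * (y - x0)) s _ _
    (is_derive_expR (c * (s - x0))) (dl s).
  by rewrite mulrC.
have ce : continuous e.
  by move=> s; apply: differentiable_continuous; apply/derivable1_diffP; case: (de s).
have dF (s : R) : is_derive s 1 (fun y => c^-1 * e y) (e s).
  have := is_deriveZ c^-1 (de s).
  by rewrite /GRing.scale/= mulKf.
have cF : continuous (fun y => c^-1 * e y).
  by move=> s; apply: differentiable_continuous; apply/derivable1_diffP; case: (dF s).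
have ie : leb.-integrable `[a, b] (EFin \o e).
  by apply: continuous_compact_integrable; [exact: segment_compact|exact: continuous_subspaceT].
have := @continuous_FTC2 _ e (fun y => c^-1 * e y) a b ab (continuous_subspaceT ce).
move=> /(_ _ _) FTC.
rewrite Rintegral_itv_obnd_cbnd; last first.
  by apply: integrableS ie => // s /=; rewrite !in_itv/= => /andP[/ltW-> ->].
rewrite /Rintegral FTC.
- by rewrite -EFinB/= -mulrBr mulrC.
- split.
  + by move=> s _; case: (dF s).
  + by apply: cvg_at_right_filter; exact: cF.
  + by apply: cvg_at_left_filter; exact: cF.
- by move=> s _; rewrite derive1E; exact: derive_val.
Qed.

Lemma prim_growth v (E la x0 X x : R) : locint v -> 0 < la -> 0 <= E ->
  0 <= x0 -> x0 <= X -> 0 <= x -> x <= X ->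
  {ae leb, forall s, 0 < s -> s <= X -> `|v s| <= E * expR (la * `|s - x0|)} ->
  `|prim v x - prim v x0| <= E / la * expR (la * `|x - x0|).
Proof.
move=> iv la0 E0 x00 x0X x0' xX vE.
(* Taking c = la to the right of x0 and c = - la to its left removes the absolute value from the
   exponent. *)
have key (a b c : R) : c != 0 -> 0 <= a -> a <= b -> b <= X ->
    (forall s : R, a < s -> s <= b -> la * `|s - x0| = c * (s - x0)) ->
    `|prim v b - prim v a| <= E * ((expR (c * (b - x0)) - expR (c * (a - x0))) / c).
  move=> c0 a0 ab bX cE; rewrite primB// -integral_expR//.
  have sub : `]a, b]%classic `<=` (`[0, b]%classic : set R).
    by move=> s /=; rewrite !in_itv/= => /andP[/ltW/(le_trans a0)-> ->].
  have iab := locint_itv sub iv.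
  apply: (le_trans (le_normr_Rintegral (mitv _) iab)).
  have iexp : leb.-integrable `]a, b] (EFin \o (fun s : R => expR (c * (s - x0)))).
    apply: (locint_itv sub); apply: continuous_locint => s; apply: continuous_comp; last exact: continuous_expR.
    by apply: cvgM; [exact: cvg_cst|apply: cvgB => //; exact: cvg_cst].
  rewrite -(RintegralZl _ (mitv _) iexp).
  have {}iexp := integrable_scale E (mitv _) iexp.
  rewrite -lee_fin -!EFin_Rintegral; [|exact: iexp|exact: mitv|exact: integrable_norm|exact: mitv].
  have /integrableP[mexp _] := iexp; have /integrableP[mv _] := iab.
  apply: ae_ge0_le_integral => //.
  - by apply/measurable_EFinP; apply: measurableT_comp => //; exact/measurable_EFinP.
  - by move=> s _; rewrite lee_fin mulr_ge0// expR_ge0.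
  - apply: lebesgue_aeS vE => s vs /=; rewrite in_itv/= => /andP[sa sb].
    rewrite lee_fin -cE//; apply: vs; first exact: le_lt_trans sa.
    exact: le_trans bX.
have [xx0|x0x] := leP x x0.
  rewrite [X in X <= _]distrC (_ : `|x - x0| = x0 - x); last by rewrite distrC ger0_norm ?subr_ge0.
  apply: (le_trans (key x x0 (- la) _ x0' xx0 x0X _)).
  - by rewrite oppr_eq0 gt_eqF.
  - by move=> s _ sx0; rewrite ler0_norm ?subr_le0// mulNr mulrN.
  - rewrite subrr mulr0 expR0 -mulrA ler_wpM2l// invrN mulrN -mulNr opprB mulNr -mulrN mulrC ler_wpM2l ?invr_ge0 ?(ltW la0)//.
    by rewrite opprB gerBl.
rewrite [X in _ <= _ * expR (_ * X)]gtr0_norm ?subr_gt0//.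
apply: (le_trans (key x0 x la _ x00 (ltW x0x) xX _)).
- by rewrite gt_eqF.
- by move=> s sx0 _; rewrite gtr0_norm ?subr_gt0.
- by rewrite subrr mulr0 expR0 -mulrA ler_wpM2l// mulrC ler_wpM2l ?invr_ge0 ?(ltW la0)// gerBl.
Qed.

(** Here v and w are f' and f'', while a and b are the values at 0 of the continuous representatives
    of f and f'. The Cauchy data of f at x are thus a + prim v x and b + prim w x. *)
Definition H2_rep f v w (a b : R) := [/\ locint v, locint w,
  {ae leb, forall x, 0 < x -> f x = a + prim v x} &
  {ae leb, forall x, 0 < x -> v x = b + prim w x}].

Lemma H2_rep_growth f v w (a b E la x0 X : R) : H2_rep f v w a b ->
  a + prim v x0 = 0 -> b + prim w x0 = 0 ->
  0 < la -> 0 <= E -> 0 <= x0 -> x0 <= X ->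
  {ae leb, forall s, 0 < s -> s <= X -> `|w s| <= E * expR (la * `|s - x0|)} ->
  {ae leb, forall s, 0 < s -> s <= X ->
     `|f s| <= E / la ^+ 2 * expR (la * `|s - x0|)}.
Proof.
move=> [iv iw fE vE] a0 b0 la0 E0 x00 x0X wE.
have vb : {ae leb, forall s, 0 < s -> s <= X -> `|v s| <= E / la * expR (la * `|s - x0|)}.
  apply: lebesgue_aeS vE => s + s0 sX => -> //.
  have -> : b + prim w s = prim w s - prim w x0 by rewrite -[b](addrK (prim w x0)) b0 sub0r addrC.
  by apply: prim_growth wE => //; exact: ltW.
apply: lebesgue_aeS fE => s + s0 sX => -> //.
have -> : a + prim v s = prim v s - prim v x0 by rewrite -[a](addrK (prim v x0)) a0 sub0r addrC.
rewrite expr2 invfM mulrA; apply: prim_growth vb => //; last exact: ltW.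
by rewrite divr_ge0// ltW.
Qed.

(** The starting estimate at the end of a chain: f'' is controlled only in L1 of [0, X], so no
    negative power of [la] is kept. The 2 comes from bounding [prim w] at s and at x0 separately. *)
Lemma H2_rep_bound f v w (a b la x0 X : R) : H2_rep f v w a b ->
  a + prim v x0 = 0 -> b + prim w x0 = 0 -> 1 <= la -> 0 <= x0 -> x0 <= X ->
  {ae leb, forall s, 0 < s -> s <= X ->
     `|f s| <= 2 * prim (fun t => `|w t|) X * expR (la * `|s - x0|)}.
Proof.
move=> [iv iw fE vE] a0 b0 la1 x00 x0X; set C := 2 * _.
have X0 := le_trans x00 x0X; have la0 : 0 < la := lt_le_trans ltr01 la1.
have P0 : 0 <= prim (fun t => `|w t|) X by exact: Rintegral_ge0.
have C0 : 0 <= C by rewrite mulr_ge0.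
have e1 (s : R) : 1 <= expR (la * `|s - x0|).
  by rewrite -expR0 ler_expR mulr_ge0// ltW.
have vb : {ae leb, forall s, 0 < s -> s <= X -> `|v s| <= C * expR (la * `|s - x0|)}.
  apply: lebesgue_aeS vE => s + s0 sX => -> //.
  have -> : b + prim w s = prim w s - prim w x0 by rewrite -[b](addrK (prim w x0)) b0 sub0r addrC.
  apply: le_trans (ler_peMr C0 (e1 s)); apply: (le_trans (ler_normB _ _)).
  by rewrite /C mulr_natl mulr2n lerD//; apply: prim_bounded => //; exact: ltW.
apply: lebesgue_aeS fE => s + s0 sX => -> //.
have -> : a + prim v s = prim v s - prim v x0 by rewrite -[a](addrK (prim v x0)) a0 sub0r addrC.
apply: (le_trans (prim_growth iv la0 C0 x00 x0X (ltW s0) sX vb)).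
by rewrite ler_wpM2r ?expR_ge0// ler_piMr// invf_le1.
Qed.

(* The factor [2 K + 1] comes from [|w| <= K |f| + K |g| + |f'|]: each
   application of [H2_rep_growth] moves one step along the chain and gains
   [n ^- 2]. *)
Lemma chain_decay (f : nat -> bool -> R -> R) n (K La N x0 X : R) :
  0 <= K -> 1 <= La -> 0 < N -> 0 <= x0 -> x0 <= X ->
  (forall j b, f j b \in Lfun mu 2%:E) ->
  (forall j b, L2_dot mu (f j b) (f j b) <= (La ^+ j * N) ^+ 2) ->
  (forall j b, (j < n)%N -> exists v w (a c : R), [/\ H2_rep (f j b) v w a c,
     a + prim v x0 = 0, c + prim w x0 = 0 &
     {ae leb, forall x, 0 < x ->
        `|w x| <= K * `|f j false x| + K * `|f j true x| + `|f j.+1 b x|}]) ->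
  forall k j b, (j + k < n)%N -> {ae leb, forall x, 0 < x -> x <= X ->
    `|f j b x| <= 2 * ((2 * K + 1) * (X + 1) * N) * La ^+ (j + k).+1 *
       ((2 * K + 1) / n%:R ^+ 2) ^+ k * expR (n%:R * `|x - x0|)}.
Proof.
move=> K0 La1 N0 x00 x0X fL fN fH; set C := 2 * _.
have X0 := le_trans x00 x0X; have La0 : 0 < La := lt_le_trans ltr01 La1.
have C0 : 0 <= C by rewrite !mulr_ge0 ?addr_ge0 ?mulr_ge0// ltW.
have Lale (i j : nat) : (i <= j)%N -> La ^+ i <= La ^+ j by move=> ij; exact: ler_weXn2l.
have fi j b := locint_norm (Lfun2_locint (fL j b)).
elim=> [|k IH] j b jk.
  have [v [w [a [c [rep a0 c0 wE]]]]] := fH j b ltac:(by rewrite addn0 in jk).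
  have n1 : 1 <= n%:R :> R by rewrite ler1n (leq_ltn_trans _ jk).
  have := H2_rep_bound rep a0 c0 n1 x00 x0X; apply: lebesgue_aeS => s h s0 sX.
  apply: (le_trans (h s0 sX)); rewrite expr0 mulr1 ler_wpM2r ?expR_ge0//.
  rewrite /C -mulrA ler_wpM2l// addn0.
  (* [prim_norm_le] is used with the L2 bound La^i N itself as its parameter. *)
  have pf i d : (i <= j.+1)%N -> prim (fun t => `|f i d t|) X <= La ^+ j.+1 * N * (X + 1).
    move=> ij; have L0 : 0 < La ^+ i * N by rewrite mulr_gt0// exprn_gt0.
    apply: (le_trans (prim_norm_le (fL i d) L0 X0)).
    apply: (@le_trans _ _ (La ^+ i * N * (X + 1))).
      rewrite mulrDr mulr1 lerD2l ler_pdivrMr// -expr2; exact: fN.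
    by rewrite ler_wpM2r ?addr_ge0// ler_wpM2r ?(ltW N0)// Lale.
  have [_ iw _ _] := rep.
  have ig : locint (fun t => K * `|f j false t| + K * `|f j true t|).
    by apply: locintD; apply: locintZ; exact: fi.
  have : prim (fun t => `|w t|) X <=
      prim (fun t => 1 * (K * `|f j false t| + K * `|f j true t|) + 1 * `|f j.+1 b t|) X.
    apply: le_prim; [exact: locint_norm|by apply: locintD; apply: locintZ|].
    by apply: lebesgue_aeS wE => t wt t0 _; rewrite !mul1r; exact: wt.
  rewrite prim_lin// !mul1r prim_lin// => /le_trans; apply.
  have := ler_wpM2l K0 (pf j false (leqnSn j)); have := ler_wpM2l K0 (pf j true (leqnSn j)).
  have := pf j.+1 b (leqnn _); move: (prim _ X) (prim _ X) (prim _ X) => p1 p2 p3.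
  by move=> h1 h2 h3; apply: (le_trans (lerD (lerD h3 h2) h1)); rewrite le_eqVlt; apply/orP; left; apply/eqP; ring.
have jn : (j < n)%N by apply: leq_ltn_trans jk; exact: leq_addr.
have jkn : (j + k < n)%N by apply: ltn_trans jk; rewrite addnS.
have jkn' : (j.+1 + k < n)%N by rewrite addSnnS.
have n0 : 0 < n%:R :> R by rewrite ltr0n (leq_ltn_trans _ jn).
have [v [w [a [c [rep a0 c0 wE]]]]] := fH j b jn.
set r := (2 * K + 1) / _; have r0 : 0 <= r by rewrite divr_ge0 ?addr_ge0 ?mulr_ge0// exprn_ge0// ltW.
pose E := (2 * K + 1) * (C * La ^+ (j + k.+1).+1 * r ^+ k).
have E0 : 0 <= E by rewrite !mulr_ge0 ?addr_ge0 ?mulr_ge0 ?exprn_ge0// ltW.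
have -> : C * La ^+ (j + k.+1).+1 * r ^+ k.+1 = E / n%:R ^+ 2.
  by rewrite /E [r ^+ k.+1]exprS {1}/r; move: (r ^+ k) (La ^+ _) (_ ^- 2) => p q t; ring.
apply: (H2_rep_growth rep a0 c0 n0 E0 x00 x0X).
have hyp := lebesgue_aeS2 (fun x (p : 0 < x -> x <= X -> _) q => conj p q) (IH j false jkn) (IH j true jkn).
have := lebesgue_aeS2 (fun x (p : 0 < x -> x <= X -> _) q => conj p q) (IH j.+1 b jkn') wE.
move/(lebesgue_aeS2 (fun x p q => conj p q) hyp); apply: lebesgue_aeS => s [[h1 h2] [h3 h4]] s0 sX.
apply: (le_trans (h4 s0)).
(* The terms at level j carry one power of [La] fewer than the one at level j + 1; as La >= 1 they
   can be raised to the same power and added. *)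
have Ple : C * La ^+ (j + k).+1 * r ^+ k * expR (n%:R * `|s - x0|) <=
    C * La ^+ (j + k.+1).+1 * r ^+ k * expR (n%:R * `|s - x0|).
  by rewrite ler_wpM2r// ler_wpM2r ?exprn_ge0// ler_wpM2l// Lale// addnS.
have {}h1 := ler_wpM2l K0 (le_trans (h1 s0 sX) Ple).
have {}h2 := ler_wpM2l K0 (le_trans (h2 s0 sX) Ple).
have {}h3 := h3 s0 sX; rewrite addSnnS in h3.
apply: (le_trans (lerD (lerD h1 h2) h3)); rewrite /E le_eqVlt; apply/orP; left; apply/eqP; ring.
Qed.

End growth.

(** * The Schroedinger operator *)

Section schroedinger_operator.
Context (R : realType).
Local Notation leb := (@lebesgue_measure R).
Local Notation mu := (mu_half_line R).
Local Notation "u ^'w" := (weak_derivative u) (at level 2, format "u ^'w").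
Local Notation hn := (hnorm (@cL2_inner _ _ R mu)).
Implicit Types (x y : R) (u g : cL2 mu) (V : R -> R[i]).

Lemma sobolev_H2_rep u : sobolev_H2 u -> exists a1 b1 a2 b2,
  H2_rep (cL2_re u) (cL2_re u^'w) (cL2_re u^'w^'w) a1 b1 /\
  H2_rep (cL2_im u) (cL2_im u^'w) (cL2_im u^'w^'w) a2 b2.
Proof.
move=> /sobolev_H2_weak_derivative[/weak_derivative_real uv /weak_derivative_real vw].
have [a1 u1] := weak_primitive (cL2_reL u) (cL2_reL _) (fun phi t => (uv phi t).1).
have [b1 v1] := weak_primitive (cL2_reL _) (cL2_reL _) (fun phi t => (vw phi t).1).
have [a2 u2] := weak_primitive (cL2_imL u) (cL2_imL _) (fun phi t => (uv phi t).2).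
have [b2 v2] := weak_primitive (cL2_imL _) (cL2_imL _) (fun phi t => (vw phi t).2).
have re_l (z : cL2 mu) : locint (cL2_re z) := Lfun2_locint (cL2_reL z).
have im_l (z : cL2 mu) : locint (cL2_im z) := Lfun2_locint (cL2_imL z).
exists a1, b1, a2, b2; split.
  exact: (And4 (re_l _) (re_l _) u1 v1).
exact: (And4 (im_l _) (im_l _) u2 v2).
Qed.

(** The difference of the two sides is Im (conj (u 0) (u' 0)), which vanishes because u(0) = 0 or
    u'(0) is a real multiple of u(0). *)
Lemma boundary_condition_wronskian (h : option R) u (a1 b1 a2 b2 : R) :
  boundary_condition h u ->
  H2_rep (cL2_re u) (cL2_re u^'w) (cL2_re u^'w^'w) a1 b1 ->
  H2_rep (cL2_im u) (cL2_im u^'w) (cL2_im u^'w^'w) a2 b2 ->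
  a1 * b2 = a2 * b1.
Proof.
move=> + [iv1 iw1 u1 v1] [iv2 iw2 u2 v2].
case: h => [r [c uc vc]|uc] /=; last first.
  by have := boundary_value_primitive uc iv1 iv2 u1 u2 => -[<- <-]; rewrite !mul0r.
have := boundary_value_primitive uc iv1 iv2 u1 u2.
have := boundary_value_primitive vc iw1 iw2 v1 v2.
by move=> + cE; rewrite cE => -[<- <-]; ring.
Qed.

Lemma cLfun_infty_bound V : V \in cLfun mu +oo%E -> exists2 K : R, 0 <= K &
  {ae mu, forall x, `|Re (V x)| <= K /\ `|Im (V x)| <= K}.
Proof.
have bnd (f : R -> R) : f \in Lfun mu +oo%E ->
    exists2 K : R, 0 <= K & {ae mu, forall x, `|f x| <= K}.
  rewrite inE => /andP[_]; rewrite inE/= /finite_norm unlock /Lnorm.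
  case: ifPn => [T0 ufin|T0 _].
    have supge0 : (0 <= ess_sup mu (abse \o (EFin \o f)))%E.
      by apply: ess_sup_gee => //; apply: nearW => x /=.
    exists (fine (ess_sup mu (abse \o (EFin \o f)))); first exact: fine_ge0.
    have := ess_sup_ge mu (abse \o (EFin \o f)); apply: half_line_aeS => x /=.
    by move=> ux; rewrite -lee_fin fineK// ge0_fin_numE.
  exists 0 => //; exists setT; split => //.
  by apply/eqP; rewrite eq_le measure_ge0 andbT leNgt.
move=> /andP[/bnd[K1 K10 VK1] /bnd[K2 K20 VK2]].
exists (K1 + K2); first exact: addr_ge0.
apply: half_line_aeS2 VK1 VK2 => x h1 h2; split.
  by apply: (le_trans h1); rewrite lerDl.
by apply: (le_trans h2); rewrite lerDr.
Qed.

Lemma schroedinger_re_im V (h : option R) u : V \in cLfun mu +oo%E ->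
  {ae mu, forall x,
    cL2_re (schroedinger V h u) x = - cL2_re u^'w^'w x +
      (Re (V x) * cL2_re u x - Im (V x) * cL2_im u x) /\
    cL2_im (schroedinger V h u) x = - cL2_im u^'w^'w x +
      (Re (V x) * cL2_im u x + Im (V x) * cL2_re u x)}.
Proof.
move=> VL; have := to_cL2K (cLfun_mul2 VL (valP (repr u))).
have /= := cL2_fun_linear (-1) u^'w^'w (to_cL2 mu (fun x => V x * cL2_fun u x)).
rewrite scaleN1r => h1 h2; apply: half_line_aeS2 h1 h2 => x.
rewrite /cL2_re /cL2_im /= => -> ->.
case: (cL2_fun u^'w^'w x) => ? ?; case: (V x) => ? ?.
by rewrite -/(cL2_fun u); case: (cL2_fun u x) => ? ? /=; split; ring.
Qed.

Lemma L2_im_eq0_absorption V (h : option R) u :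
  V \in cLfun mu +oo%E -> {ae mu, forall x, 0 <= Im (V x)} ->
  op_dom (schroedinger V h) u ->
  Im (cL2_inner u (schroedinger V h u)) = 0 ->
  {ae mu, forall x, Im (V x) != 0 -> cL2_re u x = 0 /\ cL2_im u x = 0}.
Proof.
move=> VL V0 [u2 bc] e0; have [a1 [b1 [a2 [b2 [r1 r2]]]]] := sobolev_H2_rep u2.
have wr := boundary_condition_wronskian bc r1 r2.
have [_ _ f1 v1] := r1; have [_ _ f2 v2] := r2.
set A := schroedinger V h u in e0.
pose k x := 1 * (cL2_re u x * cL2_im A x) + (- 1) * (cL2_im u x * cL2_re A x).
have i1 := Lfun2_mul (cL2_reL u) (cL2_imL A).
have i2 := Lfun2_mul (cL2_imL u) (cL2_reL A).
have ik : mu.-integrable setT (EFin \o k) by exact: integrable_lin.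
have k0 : \int[mu]_x k x = 0.
  rewrite -e0 cL2_innerE_dot/= /L2_dot -RintegralB//.
  by apply: eq_Rintegral => x _; rewrite /k; ring.
have kE : {ae mu, forall x, k x + (cL2_re u x * cL2_im u^'w^'w x - cL2_im u x * cL2_re u^'w^'w x) =
    Im (V x) * (cL2_re u x ^+ 2 + cL2_im u x ^+ 2)}.
  by apply: half_line_aeS (schroedinger_re_im h u VL) => x [] xr xi; rewrite /k xr xi; ring.
have := @energy_eq0 _ _ _ _ _ _ _ k a1 a2 b1 b2 (cL2_reL u) (cL2_imL u) (cL2_reL _)
  (cL2_imL _) (cL2_reL _) (cL2_imL _) f1 f2 v1 v2 wr ik k0.
have k_ge0 : {ae mu, forall x, 0 <= k x + (cL2_re u x * cL2_im u^'w^'w x - cL2_im u x * cL2_re u^'w^'w x)}.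
  apply: half_line_aeS2 kE V0 => x -> Vx; by rewrite mulr_ge0// addr_ge0// sqr_ge0.
move=> /(_ k_ge0) e; apply: half_line_aeS2 kE e => x -> /eqP.
rewrite mulf_eq0 => /orP[->//|]; rewrite paddr_eq0 ?sqr_ge0// !sqrf_eq0.
by move=> /andP[/eqP-> /eqP->].
Qed.

(** With n = m + 1 the left-hand side is c n (q / n)^m. Once n >= 4 q this is at most c n 4^(-m),
    hence at most c / n because n <= 2^m, and n >= c / delta finishes the estimate. *)
Lemma superexponential_decay (C P tau X delta : R) :
  0 <= C -> 0 <= P -> 0 < tau -> 0 < delta -> exists m : nat,
  C * (m.+1%:R / tau) ^+ m.+1 * (P / m.+1%:R ^+ 2) ^+ m * expR (m.+1%:R * X) <= delta.
Proof.
move=> C0 P0 tau0 delta0.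
pose q := P * expR X / tau; pose c := C * expR X / tau.
have q0 : 0 <= q by rewrite divr_ge0 ?mulr_ge0 ?expR_ge0// ltW.
have c0 : 0 <= c by rewrite divr_ge0 ?mulr_ge0 ?expR_ge0// ltW.
pose m := (Num.truncn (4 * q) + Num.truncn (c / delta))%N; exists m.
have m1 : 4 * q <= m.+1%:R.
  by apply: (le_trans (ltW (truncnS_gt _))); rewrite ler_nat ltnS leq_addr.
have m2 : c / delta <= m.+1%:R.
  by apply: (le_trans (ltW (truncnS_gt _))); rewrite ler_nat ltnS leq_addl.
have m0 : 0 < m.+1%:R :> R by rewrite ltr0n.
have -> : C * (m.+1%:R / tau) ^+ m.+1 * (P / m.+1%:R ^+ 2) ^+ m * expR (m.+1%:R * X) =
    c * (m.+1%:R * (q / m.+1%:R) ^+ m).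
  rewrite expRM_natl ![_ ^+ m.+1]exprS.
  have -> : (q / m.+1%:R) ^+ m = (m.+1%:R / tau) ^+ m * (P / m.+1%:R ^+ 2) ^+ m * expR X ^+ m.
    rewrite -!exprMn; congr (_ ^+ m); rewrite /q; field.
    by rewrite !gt_eqF.
  by rewrite /c; move: ((m.+1%:R / tau) ^+ m) (_ ^+ m) (expR X ^+ m) => z1 z2 z3; field; rewrite gt_eqF.
have qm : (q / m.+1%:R) ^+ m <= (4^-1) ^+ m.
  apply: lerXn2r; rewrite ?nnegrE ?invr_ge0//; first by rewrite divr_ge0// ltW.
  by rewrite ler_pdivrMr//; move: m1; lra.
have m4 : m.+1%:R * (m.+1%:R * 4^-1 ^+ m) <= 1 :> R.
  rewrite exprVn mulrA ler_pdivrMr ?exprn_gt0// mul1r.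
  rewrite (_ : 4 = 2 * 2 :> R); last by rewrite -natrM.
  have h : m.+1%:R <= 2 ^+ m :> R by rewrite -natrX ler_nat ltn_expl.
  by rewrite exprMn; apply: ler_pM.
apply: (@le_trans _ _ (c * (m.+1%:R * 4^-1 ^+ m))).
  by rewrite ler_wpM2l// ler_wpM2l.
rewrite -(ler_pM2l m0) mulrCA; apply: (@le_trans _ _ c).
  by rewrite ler_piMr.
by rewrite -ler_pdivrMr.
Qed.

(** From u^2 <= 2 (g - u)^2 + 2 g^2, which is (u - 2 g)^2 >= 0, for both components; each component
    of g contributes 2 delta^2. *)
Lemma prim_sqr_le u g (X delta : R) : 0 <= X ->
  {ae leb, forall x, 0 < x -> x <= X -> `|cL2_re g x| <= delta} ->
  {ae leb, forall x, 0 < x -> x <= X -> `|cL2_im g x| <= delta} ->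
  prim (fun x => cL2_re u x * cL2_re u x + cL2_im u x * cL2_im u x) X <=
  2 * hn (g - u) ^+ 2 + 4 * delta ^+ 2 * X.
Proof.
move=> X0 rg ig.
rewrite (hnorm_sqr (cL2_inner_product mu)) cL2_nsqB.
set p := fun x => cL2_re g x - cL2_re u x; set q := fun x => cL2_im g x - cL2_im u x.
have pL : p \in Lfun mu 2%:E := Lfun2B (cL2_reL g) (cL2_reL u).
have qL : q \in Lfun mu 2%:E := Lfun2B (cL2_imL g) (cL2_imL u).
have pp := Lfun2_mul pL pL; have qq := Lfun2_mul qL qL.
have lp := half_line_locint pp; have lq := half_line_locint qq.
have uu : locint (fun x => cL2_re u x * cL2_re u x + cL2_im u x * cL2_im u x).
  apply: locintD; apply: half_line_locint; apply: Lfun2_mul; rewrite ?cL2_reL ?cL2_imL//.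
apply: (@le_trans _ _ (prim (fun x => 2 * (1 * (p x * p x) + 1 * (q x * q x)) + 4 * delta ^+ 2 * 1) X)).
  apply: le_prim => //.
    apply: locintD; apply: locintZ; last exact: locint_cst.
    by apply: locintD; exact: locintZ.
  apply: lebesgue_aeS2 rg ig => x rx ix x0 xX.
  have := rx x0 xX; have := ix x0 xX.
  rewrite -ler_sqr ?nnegrE ?normr_ge0//; last by apply: le_trans (ix x0 xX); exact: normr_ge0.
  rewrite real_normK ?num_real// => h1.
  rewrite -ler_sqr ?nnegrE ?normr_ge0//; last by apply: le_trans (rx x0 xX); exact: normr_ge0.
  rewrite real_normK ?num_real// => h2.
  have := sqr_ge0 (cL2_re u x - 2 * cL2_re g x); have := sqr_ge0 (cL2_im u x - 2 * cL2_im g x).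
  by rewrite /p /q; move: h1 h2; rewrite !expr2; nra.
rewrite prim_lin; [|by apply: locintD; exact: locintZ|exact: locint_cst].
rewrite prim_cst// mul1r prim_lin// !mul1r lerD// ler_wpM2l// lerD// prim_le_integral//.
- by move=> x; rewrite -expr2 sqr_ge0.
- by move=> x; rewrite -expr2 sqr_ge0.
Qed.

Lemma accumulating_zeros_cauchy_data (f v w : R -> R) (a b x0 : R) (A : set R) :
  H2_rep f v w a b -> (forall x, A x -> 0 < x) -> A x0 ->
  (forall Q : R -> Prop, {ae leb, forall x, Q x} -> forall d : R, 0 < d ->
     exists y : R, [/\ `|y - x0| < d, y != x0, A y & Q y]) ->
  {ae leb, forall x, 0 < x -> A x -> f x = 0} ->
  a + prim v x0 = 0 /\ b + prim w x0 = 0.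
Proof.
move=> [iv iw fE vE] A0 Ax0 acc fA.
apply: (cauchy_data_eq0 iv iw vE (A0 _ Ax0)) => d d0.
have [y [yd yx0 Ay [fy0 fy]]] := acc _ (lebesgue_aeS2 (fun x p q => conj p q) fA fE) d d0.
by exists y; split=> //; [exact: A0|rewrite -fy ?fy0//; exact: A0].
Qed.

Definition zero_cauchy_data x0 u := exists a1 b1 a2 b2 : R,
  [/\ H2_rep (cL2_re u) (cL2_re u^'w) (cL2_re u^'w^'w) a1 b1,
      H2_rep (cL2_im u) (cL2_im u^'w) (cL2_im u^'w^'w) a2 b2,
      a1 + prim (cL2_re u^'w) x0 = 0 /\ b1 + prim (cL2_re u^'w^'w) x0 = 0 &
      a2 + prim (cL2_im u^'w) x0 = 0 /\ b2 + prim (cL2_im u^'w^'w) x0 = 0].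

(** The length n depends only on the constants and not on the chain, which can be built only once n
    is known. The bound tau <= 1 ensures that the growth rate n / tau is at least 1. *)
Lemma chain_uniformly_small V (h : option R) (K N tau x0 X delta : R) :
  V \in cLfun mu +oo%E -> 0 <= K ->
  {ae mu, forall x, `|Re (V x)| <= K /\ `|Im (V x)| <= K} ->
  0 < N -> 0 < tau -> tau <= 1 -> 0 <= x0 -> x0 <= X -> 0 < delta ->
  exists2 n, (0 < n)%N & forall v : nat -> cL2 mu,
    (forall j, (j < n)%N -> zero_cauchy_data x0 (v j) /\
                            schroedinger V h (v j) = v j.+1) ->
    (forall j, hn (v j) <= (n%:R / tau) ^+ j * N) ->
    {ae leb, forall x, 0 < x -> x <= X -> `|cL2_re (v 0) x| <= delta} /\
    {ae leb, forall x, 0 < x -> x <= X -> `|cL2_im (v 0) x| <= delta}.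
Proof.
move=> VL K0 VK N0 tau0 tau1 x00 x0X delta0; have X0 := le_trans x00 x0X.
pose C := 2 * ((2 * K + 1) * (X + 1) * N).
have C0 : 0 <= C by rewrite !mulr_ge0 ?addr_ge0 ?mulr_ge0// ltW.
have P0 : 0 <= 2 * K + 1 by rewrite addr_ge0 ?mulr_ge0.
have [m mP] := superexponential_decay X C0 P0 tau0 delta0.
exists m.+1 => // v vD vN.
have La1 : 1 <= m.+1%:R / tau.
  by rewrite ler_pdivlMr// mul1r (le_trans tau1)// ler1n.
(* A complex V couples the two components, so the decay estimate is run on both at once. *)
pose f j (b : bool) := if b then cL2_im (v j) else cL2_re (v j).
have fL j b : f j b \in Lfun mu 2%:E by case: b; [exact: cL2_imL|exact: cL2_reL].
have fN j b : L2_dot mu (f j b) (f j b) <= ((m.+1%:R / tau) ^+ j * N) ^+ 2.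
  apply: (@le_trans _ _ (hn (v j) ^+ 2)); last first.
    by rewrite ler_sqr ?nnegrE ?hnorm_ge0 ?(le_trans (hnorm_ge0 _ _) (vN j)).
  rewrite (hnorm_sqr (cL2_inner_product mu)) cL2_nsqE.
  by case: b; rewrite /f ?lerDl ?lerDr L2_dot_ge0.
have fH j b : (j < m.+1)%N -> exists v w (a c : R), [/\ H2_rep (f j b) v w a c,
     a + prim v x0 = 0, c + prim w x0 = 0 &
     {ae leb, forall x, 0 < x ->
        `|w x| <= K * `|f j false x| + K * `|f j true x| + `|f j.+1 b x|}].
  move=> jm; have [[a1 [b1 [a2 [b2 [r1 r2 [c1 d1] [c2 d2]]]]]] vj] := vD j jm.
  have := half_line_aeS2 (fun x p q => conj p q) VK (schroedinger_re_im h (v j) VL).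
  rewrite vj => /half_line_ae VE.
  have nV (x r s p q z : R) : `|r| <= K -> `|s| <= K -> z = - x + (r * p - s * q) ->
      `|x| <= K * `|p| + K * `|q| + `|z|.
    move=> rK sK ->; rewrite [leLHS](_ : _ = `|r * p - s * q - (- x + (r * p - s * q))|); last first.
      by congr `|_|; ring.
    apply: (le_trans (ler_normB _ _)); rewrite lerD2r; apply: (le_trans (ler_normB _ _)).
    by rewrite !normrM lerD// ler_wpM2r.
  case: b.
    exists (cL2_im (v j)^'w), (cL2_im (v j)^'w^'w), a2, b2; split=> //.
    apply: lebesgue_aeS VE => x + x0' => /(_ x0')[[rK sK] [_ E]].
    rewrite [X in _ <= X + _]addrC; apply: (nV _ _ (- Im (V x)) _ _ _ rK) => //.
      by rewrite normrN.
    by rewrite mulNr opprK; exact: E.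
  exists (cL2_re (v j)^'w), (cL2_re (v j)^'w^'w), a1, b1; split=> //.
  apply: lebesgue_aeS VE => x + x0' => /(_ x0')[[rK sK] [E _]].
  exact: (nV _ _ _ _ _ _ rK sK).
have dec b : {ae leb, forall x, 0 < x -> x <= X -> `|f 0 b x| <= delta}.
  have := chain_decay K0 La1 N0 x00 x0X fL fN fH (k := m) (j := 0) b (ltnSn m).
  apply: lebesgue_aeS => x + xp xX => /(_ xp xX) /le_trans; apply.
  apply: le_trans mP; rewrite add0n; apply: ler_wpM2l.
    have La0 := le_trans ler01 La1.
    exact: (mulr_ge0 (mulr_ge0 C0 (exprn_ge0 _ La0))
      (exprn_ge0 _ (divr_ge0 P0 (exprn_ge0 _ (ler0n _ _))))).
  rewrite ler_expR ler_wpM2l// ler_norml; apply/andP; split; lra.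
by split; [exact: dec false|exact: dec true].
Qed.

End schroedinger_operator.

Theorem theorem3p8 (R : realType) (V : R -> R[i])
  (V_Linfty : V \in cLfun (mu_half_line R) +oo%E)
  (V_im_ge0 : {ae mu_half_line R, forall x, 0 <= complex.Im (V x)})
  (V_im_neq0 : ~ {ae mu_half_line R, forall x, complex.Im (V x) = 0})
  (h : option R) :
  completely_nonselfadjoint (@cL2_inner _ _ R (mu_half_line R))
    (schroedinger V h).
Proof.
move=> [M [[clM _ _ _] M_neq0 saB]].
pose hn := hnorm (@cL2_inner _ _ R (mu_half_line R)).
have ip := cL2_inner_product (mu_half_line R); have compl := @cL2_complete _ _ R (mu_half_line R).
set B := restriction (schroedinger V h) M in saB.
have B0 u : op_dom B u -> {ae mu_half_line R, forall x, Im (V x) != 0 -> cL2_re u x = 0 /\ cL2_im u x = 0}.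
  move=> Bu; apply: (L2_im_eq0_absorption V_Linfty V_im_ge0 Bu.1).
  exact: (selfadjoint_im0 ip saB Bu).
(* The values of V on ]-oo, 0] are arbitrary, so the positivity of x must be part of the set. *)
pose A : set (g_sigma_algebraType R.-ocitv.-measurable) := [set x : R | 0 < x /\ Im (V x) != 0].
have mA : measurable A.
  have /andP[_ /measurable_Lfun mV] := V_Linfty.
  have -> : A = `]0, +oo[%classic `&` (fun x => Im (V x)) @^-1` (~` [set 0]).
    by apply/seteqP; split=> x /=; rewrite in_itv/= andbT => -[x0 Vx]; split=> //; exact/eqP.
  apply: measurableI; first exact: lebesgue_measurable_itv.
  rewrite -[_ @^-1` _]setTI; apply: mV => //.
  by apply: measurableC; exact: measurable_set1.
have [|x0 Ax0 acc] := accumulation_point mA.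
  move=> A0; apply: V_im_neq0; apply/half_line_ae; apply: lebesgue_aeS A0 => x nA x0.
  by apply: contrapT => /eqP Vx; apply: nA.
have A_gt0 (x : R) : A x -> 0 < x by case.
have B_cauchy u : op_dom B u -> zero_cauchy_data x0 u.
  move=> Bu; have [a1 [b1 [a2 [b2 [r1 r2]]]]] := sobolev_H2_rep Bu.1.1.
  have uA := (half_line_ae _).1 (B0 u Bu).
  exists a1, b1, a2, b2; split=> //.
    apply: (accumulating_zeros_cauchy_data r1 A_gt0 Ax0 acc).
    by apply: lebesgue_aeS uA => x ux xp [_ /ux]; case/(_ xp).
  apply: (accumulating_zeros_cauchy_data r2 A_gt0 Ax0 acc).
  by apply: lebesgue_aeS uA => x ux xp [_ /ux]; case/(_ xp).
(* By density: an element of D(B) closer to a nonzero m in M than |m| cannot be 0. *)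
have [u Bu u_neq0] : exists2 u, op_dom B u & 0 < hn u.
  have [m Mm m0] : exists2 m, M m & m != 0.
    apply: contrapT => noM; apply: M_neq0; apply/seteqP; split=> [m Mm|_ ->]; last by case: clM.
    by apply: contrapT => /eqP m0; apply: noM; exists m.
  have hn_gt0 w : w != 0 -> 0 < hn w.
    move=> w0; rewrite lt_neqAle hnorm_ge0 andbT eq_sym; apply: contra_neq w0 => w0.
    by apply: (inner_eq0 ip); rewrite -(hnorm_sqr ip) -/(hn w) w0 expr0n.
  case: (saB) => _ _ dense _; have [u Bu um] := dense m Mm (hn m) (hn_gt0 m m0).
  exists u => //; apply: hn_gt0; apply/eqP => u0; move: um.
  by rewrite u0 subr0 ltxx.
set N := hn u in u_neq0.
(* This makes |v_0 - u| <= tau |B u| <= N / 4; the added 1 covers B u = 0. *)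
pose tau := Num.min 1 (N / (4 * (hn (B u) + 1))).
have Bu0 : 0 <= hn (B u) := hnorm_ge0 _ _.
have tau0 : 0 < tau by rewrite lt_min ltr01 divr_gt0 ?mulr_gt0 ?ltr_wpDl.
have tau1 : tau <= 1 by rewrite ge_min lexx.
have tauB : tau * hn (B u) <= N / 4.
  have h1 : tau <= N / (4 * (hn (B u) + 1)) by rewrite ge_min lexx orbT.
  have h2 := ler_wpM2r Bu0 h1; apply: (le_trans h2).
  have b0 : 0 < hn (B u) + 1 by rewrite ltr_wpDl.
  have -> : N / (4 * (hn (B u) + 1)) * hn (B u) = N / 4 * (hn (B u) / (hn (B u) + 1)).
    by field; rewrite gt_eqF.
  by rewrite ler_piMr ?divr_ge0 ?(ltW u_neq0)// ler_pdivrMr// mul1r lerDl.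
pose f x := cL2_re u x * cL2_re u x + cL2_im u x * cL2_im u x.
have if_ : (mu_half_line R).-integrable setT (EFin \o f).
  exact: (integrableD measurableT (Lfun2_mul (cL2_reL u) (cL2_reL u)) (Lfun2_mul (cL2_imL u) (cL2_imL u))).
have fN : \int[mu_half_line R]_x f x = N ^+ 2.
  rewrite (hnorm_sqr ip) cL2_nsqE /L2_dot -RintegralD//.
    exact: Lfun2_mul (cL2_reL u) (cL2_reL u).
  exact: Lfun2_mul (cL2_imL u) (cL2_imL u).
have [X x0X fX] : exists2 X : R, x0 <= X & N ^+ 2 / 2 < prim f X.
  have := prim_cvg if_ (fun n => lexx n%:R); rewrite fN => fcvg.
  have N2 : N ^+ 2 / 2 < N ^+ 2 by have := exprn_gt0 2 u_neq0; lra.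
  have [n [nf nx]] : exists n : nat, N ^+ 2 / 2 < prim f n%:R /\ x0 <= n%:R.
    near \oo => n; exists n; split.
      by near: n; exact: (cvgr_gt _ fcvg).
    by near: n; exact: nbhs_infty_ger.
  by exists n%:R.
have X0 : 0 <= X := le_trans (ltW (A_gt0 _ Ax0)) x0X.
have [K K0 VK] := cLfun_infty_bound V_Linfty.
(* The final count: the integral of |u|^2 over [0, X] exceeds N^2 / 2, but it is at most 2 (N / 4)^2
   + 4 delta^2 X <= N^2 / 8 + N^2 / 16. *)
pose delta := N / (8 * (X + 1)).
have delta0 : 0 < delta by rewrite divr_gt0// mulr_gt0// ltr_wpDl.
have [n n0 nP] := chain_uniformly_small h V_Linfty K0 VK u_neq0 tau0 tau1 (ltW (A_gt0 _ Ax0)) x0X delta0.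
have [v [vB vN v0]] := selfadjoint_chain ip compl clM saB Bu tau0 n0.
have [|vr vi] := nP v _ vN.
  by move=> j jn; have [Bv vj] := vB j jn; split; [exact: B_cauchy|exact: vj].
have := lt_le_trans fX (prim_sqr_le u X0 vr vi); apply/negP; rewrite -leNgt.
have v0N : hn (v 0 - u) ^+ 2 <= (N / 4) ^+ 2.
  by rewrite ler_sqr ?nnegrE ?hnorm_ge0 ?divr_ge0 ?(ltW u_neq0)// (le_trans v0).
have dX : 4 * delta ^+ 2 * X <= N ^+ 2 / 16.
  have -> : 4 * delta ^+ 2 * X = N ^+ 2 / 16 * (X / (X + 1) ^+ 2).
    by rewrite /delta; field; rewrite gt_eqF// ltr_wpDl.
  rewrite ler_piMr ?divr_ge0 ?sqr_ge0// ler_pdivrMr ?exprn_gt0 ?ltr_wpDl//.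
  by have := sqr_ge0 X; rewrite !expr2; nra.
by have := sqr_ge0 N; move: v0N dX; rewrite -/(hn _) !expr2; lra.
Unshelve. all: by end_near.
Qed.
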